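(* Consider the infinite-dimensional Neumann problem: find curves $f$ in $$S^\infty(M)=\Big\{f\in C^\infty(M)\;\Big|\;\int_Mf^2\mu=1\Big\}$$ that are extremal for the action functional of the Lagrangian $$L(f,\dot f)=\tfrac12\int_M\big(\dot f^2-|\nabla f|^2\big)\mu=\tfrac12\int_M\big(\dot f^2+f\Delta f\big)\mu ,$$ i.e. with potential $V(f)=\frac12\int_M|\nabla f|^2\mu$. The associated Newton's equations have the form $$\ddot f-\Delta f=-\lambda f,$$ where $\lambda$ is a Lagrange multiplier subject to the constraint $\int_Mf^2\mu=1$. In fact, $\lambda=2L(f,\dot f)=\int_M(\dot f^2+f\Delta f)\,\mu$.
   Context: $M$ is a compact oriented Riemannian manifold (without boundary) with normalized volume form $\mu$, $\int_M\mu=1$, gradient $\nabla$ and Laplacian $\Delta=\operatorname{div}\nabla$ on functions. $S^\infty(M)$ carries the metric induced by the $L^2$ inner product. The multiplier $\lambda$ depends only on time. *)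

(* Defs.v *)
From HB Require Import structures.
From mathcomp Require Import all_boot all_order all_algebra.
From mathcomp Require Import all_classical all_reals all_analysis.

Set Implicit Arguments.
Unset Strict Implicit.
Unset Printing Implicit Defensive.

Import Order.TTheory GRing.Theory Num.Theory.
Import numFieldNormedType.Exports.

Local Open Scope classical_set_scope.
Local Open Scope ring_scope.

Section Euclidean.
Context {R : realType}.

Definition partial n (k : 'I_n) (h : 'rV[R]_n -> R) : 'rV[R]_n -> R :=
  'D_(delta_mx 0 k) h.

Definition iter_partial n (s : seq 'I_n) (h : 'rV[R]_n -> R) :
    'rV[R]_n -> R :=
  foldr (@partial n) h s.

(* C^oo on the open set [U]: all iterated partial derivatives exist and are
   continuous on [U]. *)
Definition smooth_on n (U : set 'rV[R]_n) (h : 'rV[R]_n -> R) : Prop :=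
  forall (s : seq 'I_n) (y : 'rV[R]_n), U y ->
    {for y, continuous (iter_partial s h)} /\
    forall k : 'I_n, derivable (iter_partial s h) y (delta_mx 0 k).

(* Iterated one-dimensional Lebesgue integrals; by Fubini this is the Lebesgue
   integral over R^n for the functions it is used on (continuous with compact
   support). *)
Fixpoint integral_rV (n : nat) : ('rV[R]_n -> R) -> R :=
  match n with
  | 0 => fun h => h 0
  | m.+1 => fun h => \int[@lebesgue_measure R]_x
      integral_rV (fun y : 'rV[R]_m => h (row_mx (x%:M : 'rV[R]_1) y))
  end.

End Euclidean.

Section Manifold.
Context (R : realType) (n : nat) (M : topologicalType).

Record chart := Chart {
  cdom : set M;
  cimg : set 'rV[R]_n;
  cmap : M -> 'rV[R]_n;
  cinv : 'rV[R]_n -> M;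
  cdom_open : open cdom;
  cimg_open : open cimg;
  cmap_img : forall x, cdom x -> cimg (cmap x);
  cinv_dom : forall y, cimg y -> cdom (cinv y);
  cmapK : forall x, cdom x -> cinv (cmap x) = x;
  cinvK : forall y, cimg y -> cmap (cinv y) = y;
  cmap_continuous : forall x, cdom x -> {for x, continuous cmap};
  cinv_continuous : forall y, cimg y -> {for y, continuous cinv} }.

Definition overlap (p q : chart) : set 'rV[R]_n :=
  [set y | cimg p y /\ cdom q (cinv p y)].

Definition transition (p q : chart) (y : 'rV[R]_n) : 'rV[R]_n :=
  cmap q (cinv p y).

(* [chart_at] singles out a chart around each point, in which pointwise objects
   are evaluated. *)
Record oriented_atlas := OrientedAtlas {
  index : Type;
  atlas : index -> chart;
  chart_at : M -> index;
  chart_atP : forall x, cdom (atlas (chart_at x)) x;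
  transition_smooth : forall i j (l : 'I_n),
    smooth_on (overlap (atlas i) (atlas j))
      (fun y => transition (atlas i) (atlas j) y 0 l);
  transition_oriented : forall i j y, overlap (atlas i) (atlas j) y ->
    0 < \det ('J (transition (atlas i) (atlas j)) y) }.

(* A Riemannian metric, given by its Gram matrices in the charts of the
   atlas. *)
Record riemannian_metric (A : oriented_atlas) := RiemannianMetric {
  gram : index A -> 'rV[R]_n -> 'M[R]_n;
  gram_smooth : forall i (k l : 'I_n),
    smooth_on (cimg (atlas i)) (fun y => gram i y k l);
  gram_sym : forall i y, cimg (atlas i) y -> (gram i y)^T = gram i y;
  gram_posdef : forall i y, cimg (atlas i) y ->
    forall v : 'rV[R]_n, v != 0 -> 0 < (v *m gram i y *m v^T) 0 0;
  gram_transition : forall i j y, overlap (atlas i) (atlas j) y ->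
    let tau := transition (atlas i) (atlas j) in
    gram i y = 'J tau y *m gram j (tau y) *m ('J tau y)^T }.

(* C^oo(M). *)
Definition smooth (A : oriented_atlas) (f : M -> R) : Prop :=
  forall i, smooth_on (cimg (@atlas A i))
    (fun y : 'rV[R]_n => f (cinv (@atlas A i) y)).

(* [u] is jointly smooth on [W * M], for [W] an open set of parameters in R^p.
   As [M] is compact, these are the smooth maps from [W] to the Frechet space
   C^oo(M). *)
Definition smooth_family (A : oriented_atlas) p (W : set 'rV[R]_p)
    (u : 'rV[R]_p -> M -> R) : Prop :=
  forall i, smooth_on
    [set z : 'rV[R]_(p + n) | W (lsubmx z) /\ cimg (@atlas A i) (rsubmx z)]
    (fun z : 'rV[R]_(p + n) => u (lsubmx z) (cinv (@atlas A i) (rsubmx z))).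

Section VectorCalculus.
Context (A : oriented_atlas) (g : riemannian_metric A).

(* Coordinates in chart [i] of the gradient: (grad f)^k = g^{kl} d_l f. *)
Definition local_grad (i : index A) (f : M -> R) (y : 'rV[R]_n) : 'rV[R]_n :=
  (\row_l partial l (fun z => f (cinv (atlas i) z)) y) *m invmx (gram g i y).

Definition vol_density (i : index A) (y : 'rV[R]_n) : R :=
  Num.sqrt (\det (gram g i y)).

(* Divergence with respect to the Riemannian volume form (equivalently, to any
   constant multiple of it) of the vector field with coordinates [X] in chart
   [i]: (1 / sqrt |g|) d_k (sqrt |g| X^k). *)
Definition local_div (i : index A) (X : 'rV[R]_n -> 'rV[R]_n)
    (y : 'rV[R]_n) : R :=
  (vol_density i y)^-1 *
    \sum_(k < n) partial k (fun z => vol_density i z * X z 0 k) y.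

(* The values of the next two functions at [x] do not depend on the chart around
   [x] in which they are computed. *)
Definition grad_normsq (f : M -> R) (x : M) : R :=
  let i := chart_at A x in let y := cmap (atlas i) x in
  (local_grad i f y *m gram g i y *m (local_grad i f y)^T) 0 0.

Definition laplacian (f : M -> R) (x : M) : R :=
  let i := chart_at A x in
  local_div i (local_grad i f) (cmap (atlas i) x).

End VectorCalculus.
End Manifold.

(* [M] with its Borel sigma-algebra. *)
Definition borel (M : ptopologicalType) := g_sigma_algebraType (@open M).

Section NeumannProblem.
Context (R : realType) (n : nat) (M : ptopologicalType).
Context (A : oriented_atlas R n M) (g : riemannian_metric A).

(* [mu] is the probability measure given by a constant multiple of the
   Riemannian volume form sqrt |g| dy^1 /\ ... /\ dy^n.  The integral of a form
   is its value on functions supported in a positively oriented chart; those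
   determine a Borel measure on the compact manifold [M]. *)
Definition normalized_volume (mu : probability (borel M) R) : Prop :=
  exists2 c : R, 0 < c &
  forall (i : index A) (h : M -> R), continuous h ->
    (exists K : set M, [/\ compact K, K `<=` cdom (atlas i) &
       forall x, ~ K x -> h x = 0]) ->
    \int[mu]_x h x =
    c * integral_rV
          ((fun y => h (cinv (atlas i) y) * vol_density g i y)
             \_ (cimg (atlas i))).

Variable mu : probability (borel M) R.

Definition l2 (h k : M -> R) : R := \int[mu]_x (h x * k x).

(* S^oo(M). *)
Definition sphere : set (M -> R) :=
  [set f | smooth A f /\ \int[mu]_x (f x ^+ 2) = 1].

Definition potential (f : M -> R) : R :=
  2^-1 * \int[mu]_x grad_normsq g f x.

Definition lagrangian (f v : M -> R) : R :=
  2^-1 * \int[mu]_x (v x ^+ 2 - grad_normsq g f x).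

(* The time derivative of a curve [f] is [partial1of2 f]. *)
Definition smooth_curve (J : set R) (f : R -> M -> R) : Prop :=
  smooth_family A [set z : 'rV[R]_1 | J (z 0 0)]
    (fun z : 'rV[R]_1 => f (z 0 0)) /\
  forall t, J t -> sphere (f t).

Definition action (a b : R) (f : R -> M -> R) : R :=
  \int[@lebesgue_measure R]_(t in `[a, b]) lagrangian (f t) (partial1of2 f t).

(* A smooth variation [F s t], within S^oo(M), of the curve [f] over [J], fixing
   the points of the curve at times [a] and [b]. *)
Definition variation (J : set R) (a b : R) (f : R -> M -> R)
    (F : R -> R -> M -> R) : Prop :=
  exists2 e : R, 0 < e &
  [/\ smooth_family A
        [set z : 'rV[R]_2 | `|z 0 0| < e /\ J (z 0 1)]
        (fun z : 'rV[R]_2 => F (z 0 0) (z 0 1)),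
      forall s t, `|s| < e -> J t -> sphere (F s t),
      forall t, J t -> F 0 t = f t,
      forall s, `|s| < e -> F s a = f a &
      forall s, `|s| < e -> F s b = f b].

Definition extremal (J : set R) (f : R -> M -> R) : Prop :=
  forall a b : R, a < b -> `[a, b] `<=` J ->
  forall F : R -> R -> M -> R, variation J a b f F ->
    is_derive (0 : R) (1 : R) (fun s : R => action a b (F s)) 0.

Definition tangent (f : M -> R) : set (M -> R) :=
  [set h | smooth A h /\ l2 f h = 0].

(* [w] is the gradient at [f] of the potential on S^oo(M), for the metric
   induced by the L^2 inner product. *)
Definition is_potential_gradient (f w : M -> R) : Prop :=
  tangent f w /\
  forall h, tangent f h ->
    is_derive (0 : R) (1 : R)
      (fun s : R => potential (fun x => f x + s * h x)) (l2 w h).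

(* Covariant derivative of the velocity, for the Levi-Civita connection of the
   L^2 metric on S^oo(M): the L^2-orthogonal projection of the second derivative
   onto the tangent space. *)
Definition covariant_acceleration (f : R -> M -> R) (t : R) (x : M) : R :=
  let a := partial1of2 (partial1of2 f) t in a x - l2 a (f t) * f t x.

Definition newton_equation (J : set R) (f : R -> M -> R) : Prop :=
  forall t, J t ->
    is_potential_gradient (f t) (fun x => - covariant_acceleration f t x).

Definition multiplier_equation (J : set R) (lambda : R -> R)
    (f : R -> M -> R) : Prop :=
  forall t, J t -> forall x : M,
    partial1of2 (partial1of2 f) t x - laplacian g (f t) x
      = - lambda t * f t x.

End NeumannProblem.

(* Main.v *)
(* Green's formula [int <grad f, grad h> = - int h (Lap f)] is integration by
   parts in a chart when [h] is supported there, and the general case follows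
   by writing [h] as a finite sum of such functions.  The Laplacian is
   independent of the chart because in each chart it is determined, through
   Green's formula, by the invariant pairing of gradients.  It is therefore
   symmetric, [V(f) = - 1/2 int f (Lap f)], and the gradient of [V] on the
   sphere at [f] is the tangential part of [- Lap f].  Newton's equation thus
   says that [r = f'' - Lap f] is everywhere normal to the sphere, i.e. that it
   is a time-dependent multiple of [f].
     The first variation of the action along [h = dF/ds] is
   [- int_a^b int_M r h], with [h] tangent to the sphere; so it vanishes when
   [r] is normal.  Conversely, let [w] be the tangential part of [r] and [phi]
   a nonnegative cutoff in time vanishing at [a] and [b].  For the variation
   [(f + s phi w) / sqrt (1 + s^2 phi^2 |w|^2)] the first variation is
   [- int_a^b phi |w|^2], whence [w = 0].
     The value of the multiplier comes from differentiating [int f^2 = 1] twice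
   in time: [int f'^2 + int f f'' = 0]. *)

Require Import Defs.
From HB Require Import structures.
From mathcomp Require Import all_boot all_order all_algebra.
From mathcomp Require Import all_classical all_reals all_analysis.
From mathcomp Require Import ring lra.

Set Implicit Arguments.
Unset Strict Implicit.
Unset Printing Implicit Defensive.

Import Order.TTheory GRing.Theory Num.Theory.
Import numFieldNormedType.Exports.

Local Open Scope classical_set_scope.
Local Open Scope ring_scope.

(** * Differential calculus in coordinates *)

Section MeanValue.
Context {R : realType}.

(** The measure [mu] is prescribed only on continuous functions supported in one chart, while
    [laplacian] and [grad_normsq] are read in the chart picked by [chart_at], which varies with the
    point without any regularity. Hence even the continuity of the integrands has to wait for chart
    independence. A direct check for the Laplacian would involve second derivatives of the
    transition maps; testing against bump functions needs only first-order invariance, at the price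
    of proving that [mu] is strictly positive on nonzero nonnegative continuous functions.
    Derivatives pass under integrals always in the same way: a bound uniform over a compact set,
    supplied by [tube], is fed to [mean_value_estimate], and the resulting linear bound is
    integrated and handed to [is_derive_estimate]. This is why curves, variations and their
    Laplacians are kept as jointly smooth families. In the first variation an integral identity
    valid for every value of the variation parameter is differentiated, once for the integration by
    parts in time and once for the symmetry of the Laplacian; mixed derivatives are never
    exchanged. *)

Lemma mean_value_estimate (phi : R -> R) (c eta s : R) :
  (forall t, `|t| <= `|s| ->
     derivable phi t 1 /\ `|'D_1 phi t - c| <= eta) ->
  `|phi s - phi 0 - c * s| <= eta * `|s|.
Proof.
move=> H.
have cont (I : interval R) : (forall t, t \in I -> `|t| <= `|s|) ->
    {within [set` I], continuous phi}.
  move=> HI; apply: derivable_within_continuous => t tI.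
  by have [] := H t (HI _ tI).
have [s0|s0] := leP 0 s.
- have sub t : t \in `[0, s]%R -> `|t| <= `|s|.
    by rewrite in_itv/= => /andP[t0 ts]; rewrite !ger0_norm.
  have [||t ts E] := @MVT_segment R phi (fun t => 'D_1 phi t) 0 s s0.
  + move=> t ts; apply: derivableP.
    by have [] := H t (sub t (subset_itv_oo_cc ts)).
  + exact: cont.
  rewrite E subr0 -mulrBl normrM ler_wpM2r//.
  by have [] := H t (sub t ts).
- have sub t : t \in `[s, 0]%R -> `|t| <= `|s|.
    rewrite in_itv/= => /andP[t0 ts].
    by rewrite !ler0_norm ?lerN2// ltW.
  have [||t ts E] := @MVT_segment R phi (fun t => 'D_1 phi t) s 0 (ltW s0).
  + move=> t ts; apply: derivableP.
    by have [] := H t (sub t (subset_itv_oo_cc ts)).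
  + exact: cont.
  have -> : phi s - phi 0 - c * s = ('D_1 phi t - c) * s.
    by rewrite -(opprB (phi 0)) E; ring.
  rewrite normrM ler_wpM2r//.
  by have [] := H t (sub t ts).
Qed.

Context {V : normedModType R}.
Implicit Types (h : V -> R) (y v : V).

(** The two difference quotients are the same function of [e], so derivability and derivatives
    transfer by rewriting, without any argument on limits. *)
Lemma growth_lineE h y v (t : R) :
  (fun e : R => e^-1 *: (((fun r : R => h (r *: v + y)) \o shift t) (e *: (1 : R)) -
                         h (t *: v + y))) =
  (fun e : R => e^-1 *: ((h \o shift (t *: v + y)) (e *: v) - h (t *: v + y))).
Proof.
by apply/funext => e /=; rewrite [e *: 1]mulr1 scalerDl addrA.
Qed.

Lemma derivable_line h y v (t : R) :
  derivable (fun t : R => h (t *: v + y)) t 1 <-> derivable h (t *: v + y) v.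
Proof. by rewrite /derivable growth_lineE. Qed.

Lemma derive_line h y v (t : R) :
  'D_1 (fun t : R => h (t *: v + y)) t = 'D_v h (t *: v + y).
Proof. by rewrite /derive growth_lineE. Qed.

Lemma is_derive_line h y v (t b : R) :
  is_derive t (1 : R) (fun r : R => h (r *: v + y)) b <-> is_derive (t *: v + y) v h b.
Proof.
split=> -[dh dhb]; apply: DeriveDef.
- exact/derivable_line.
- by rewrite -derive_line.
- exact/derivable_line.
- by rewrite derive_line.
Qed.

Lemma is_derive_line0 h y v (b : R) :
  is_derive y v h b <-> is_derive (0 : R) (1 : R) (fun r : R => h (r *: v + y)) b.
Proof.
have {1}-> : y = 0 *: v + y by rewrite scale0r add0r.
by split=> /is_derive_line.
Qed.

Lemma is_derive_scalar_comp (phi : R -> R) h y v (a b : R) :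
  is_derive (h y) (1 : R) phi a -> is_derive y v h b ->
  is_derive y v (phi \o h) (a * b).
Proof.
move=> Hphi /is_derive_line0 Hh; apply/is_derive_line0.
pose p (r : R) := h (r *: v + y).
have p0 : p 0 = h y by rewrite /p scale0r add0r.
rewrite -p0 in Hphi.
exact: (@is_derive1_comp _ phi p 0 _ _ Hphi Hh).
Qed.

End MeanValue.

(** * Row vectors, and differentiability from continuous partial derivatives *)

Section RowVectors.
Context {R : realType}.

Lemma mxnorm_le m n (A : 'M[R]_(m, n)) (e : R) :
  0 <= e -> (forall i j, `|A i j| <= e) -> `|A| <= e.
Proof.
move=> e0 H; rewrite [leLHS]/Num.Def.normr/= mx_normrE (bigmax_le _ e0)//=.
Qed.

Lemma le_mxnorm m n (A : 'M[R]_(m, n)) i j : `|A i j| <= `|A|.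
Proof.
rewrite [leRHS]/Num.Def.normr/= mx_normrE.
exact: (le_bigmax _ (fun ij => `|A ij.1 ij.2|) (i, j)).
Qed.

Lemma cvg_mxP (T : Type) (F : set_system T) (FF : Filter F) m n
    (f : T -> 'M[R]_(m, n)) (l : 'M[R]_(m, n)) :
  (forall i j, f x i j @[x --> F] --> l i j) -> f x @[x --> F] --> l.
Proof.
move=> H; apply/cvgrPdist_le => /= e e0.
have : \forall x \near F, forall i j, `|l i j - f x i j| <= e.
  apply: filter_forall => i; apply: filter_forall => j.
  exact: ((cvgrPdist_le _ _).1 (H i j)).
apply: filterS => x Hx; apply: mxnorm_le; first exact: ltW.
by move=> i j; rewrite !mxE.
Qed.

Lemma cvg_sumR (T : Type) (F : set_system T) (FF : Filter F) (I : Type)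
    (r : seq I) (P : pred I) (f : I -> T -> R) (l : I -> R) :
  (forall i, P i -> f i x @[x --> F] --> l i) ->
  \sum_(i <- r | P i) f i x @[x --> F] --> \sum_(i <- r | P i) l i.
Proof.
move=> H; elim: r => [|i r IH].
  by rewrite big_nil; under eq_fun do rewrite big_nil; exact: cvg_cst.
rewrite big_cons; under eq_fun do rewrite big_cons.
by case: ifPn => // Pi; apply: cvgD => //; exact: H.
Qed.

Lemma continuous_mxP (T : topologicalType) m n (f : T -> 'M[R]_(m, n)) x :
  (forall i j, {for x, continuous (fun z => f z i j)}) -> {for x, continuous f}.
Proof. by move=> H; apply: cvg_mxP => i j; exact: H. Qed.

(** The corners of the staircase path from 0 to [v] that follows the coordinate axes one after the
    other. *)
Definition headpart n (k : nat) (v : 'rV[R]_n) : 'rV[R]_n :=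
  \sum_(l < n | (l < k)%N) v 0 l *: delta_mx 0 l.

Lemma headpartE n k (v : 'rV[R]_n) i j :
  headpart k v i j = if (j < k)%N then v 0 j else 0.
Proof.
rewrite /headpart summxE ord1.
under eq_bigr do rewrite !mxE eqxx /=.
case: ifPn => jk.
  rewrite (bigD1 j)//= eqxx mulr1 big1 ?addr0// => l /andP[_ lj].
  by rewrite eq_sym (negbTE lj) mulr0.
rewrite big1// => l lk; case: eqP => [jl|]; last by rewrite mulr0.
by move: jk; rewrite jl lk.
Qed.

Lemma delta_norm_le n (k : 'I_n) : `|(delta_mx 0 k : 'rV[R]_n)| <= 1.
Proof.
apply: mxnorm_le => // i j; rewrite mxE; case: (_ && _); by rewrite ?normr1 ?normr0.
Qed.

(* Telescoping along the coordinates, each increment being controlled by the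
   mean value theorem. *)
Lemma C1_differential n (U : set 'rV[R]_n) (h : 'rV[R]_n -> R) y : open U -> U y ->
  (forall k z, U z -> derivable h z (delta_mx 0 k)) ->
  (forall k, {for y, continuous (partial k h)}) ->
  forall e : R, 0 < e -> \forall v \near (0 : 'rV[R]_n),
   `|h (v + y) - h y - \sum_(k < n) v 0 k * partial k h y| <= e * `|v|.
Proof.
move=> oU Uy dh ch e e0.
(* Each of the [n] coordinate steps receives an equal share of the tolerance; dividing by [n.+1]
   keeps the share positive when [n] is 0. *)
pose e' := e / (n.+1)%:R.
have e'0 : 0 < e' by rewrite divr_gt0.
have [d d0 Hd] : exists2 d : R, 0 < d & forall z, `|z - y| < d -> U z /\
    forall k, `|partial k h z - partial k h y| <= e'.
  have : \forall z \near y, U z /\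
    forall k, `|partial k h z - partial k h y| <= e'.
    apply: filterI; first by move: oU; rewrite openE; exact.
    apply: (@filter_forall _ _ (fun k z => `|partial k h z - partial k h y| <= e') _ (nbhs_filter y)) => k.
    move/cvgrPdist_le : (ch k) => /(_ _ e'0); apply: filterS => z.
    by rewrite distrC.
  move=> /nbhs_ballP[d /= d0 H]; exists d => // z zd; apply: H.
  by rewrite -ball_normE/= distrC.
have H (v : 'rV[R]_n) (k : nat) : `|v| < d -> (k <= n)%N ->
    `|h (headpart k v + y) - h y - \sum_(l < n | (l < k)%N) v 0 l * partial l h y|
       <= k%:R * (e' * `|v|).
  move=> vd; elim: k => [|k IH] kn.
    by rewrite /headpart !big_pred0// add0r !subrr normr0 mul0r.
  have hS : headpart k.+1 v = v 0 (Ordinal kn) *: delta_mx 0 (Ordinal kn) + headpart k v.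
    rewrite /headpart (bigD1 (Ordinal kn))//=; congr (_ + _).
    apply: eq_bigl => l; rewrite ltnS ltn_neqAle andbC; congr (_ && _).
  have sS : \sum_(l < n | (l < k.+1)%N) v 0 l * partial l h y =
    v 0 (Ordinal kn) * partial (Ordinal kn) h y + \sum_(l < n | (l < k)%N) v 0 l * partial l h y.
    rewrite (bigD1 (Ordinal kn))//=; congr (_ + _).
    apply: eq_bigl => l; rewrite ltnS ltn_neqAle andbC; congr (_ && _).
  set K := Ordinal kn in hS sS *.
  have := @mean_value_estimate R (fun t => h (t *: delta_mx 0 K + (headpart k v + y)))
     (partial K h y) e' (v 0 K).
  rewrite scale0r add0r => mv.
  have {}mv : `|h (v 0 K *: delta_mx 0 K + (headpart k v + y)) - h (headpart k v + y)
      - partial K h y * v 0 K| <= e' * `|v 0 K|.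
    apply: mv => t tv.
    (* The norm is the largest absolute entry, and the entries along the staircase never exceed
       those of [v]; so the whole path stays in the ball. *)
    have /Hd[Uz Hz] : `|t *: delta_mx 0 K + (headpart k v + y) - y| < d.
      rewrite addrA addrK; apply: le_lt_trans vd.
      apply: mxnorm_le => // i j; rewrite !mxE headpartE ord1 eqxx/=.
      have [->|/eqP jK] := eqVneq j K.
        by rewrite mulr1 ltnn addr0 (le_trans tv)// le_mxnorm.
      rewrite mulr0 add0r; case: ifP => _; first exact: le_mxnorm.
      by rewrite normr0.
    split; first by apply/derivable_line; exact: dh.
    by rewrite derive_line; exact: Hz.
  rewrite hS sS -(addrA (v 0 K *: delta_mx 0 K)).
  rewrite -natr1 mulrDl mul1r.
  have := IH (ltnW kn).
  move: mv; set A := h _; set B := h (headpart k v + y).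
  set S := \sum_(l < n | _) _ => mv IH'.
  have -> : A - h y - (v 0 K * partial K h y + S) =
     (B - h y - S) + (A - B - partial K h y * v 0 K) by ring.
  apply: le_trans (ler_normD _ _) _; apply: lerD => //.
  by apply: le_trans mv _; rewrite ler_wpM2l ?(ltW e'0)// le_mxnorm.
apply/nbhs_ballP; exists d => //= v.
rewrite -ball_normE/= sub0r normrN => vd.
have := H v n vd (leqnn n).
have -> : headpart n v = v.
  by rewrite [RHS]row_sum_delta /headpart; apply: eq_bigl => l; exact: ltn_ord.
rewrite [X in `|_ - X| <= n%:R * _](eq_bigl xpredT); last by move=> l; rewrite ltn_ord.
move=> /le_trans; apply.
rewrite mulrA ler_wpM2r// /e' mulrCA ler_piMr//; first exact: ltW.
by rewrite ler_pdivrMr// mul1r ler_nat.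
Qed.

(** Directional derivatives do not compose, Frechet derivatives do: this gives access to the chain
    rule for transition maps. *)
Lemma C1_differentiable n (U : set 'rV[R]_n) (h : 'rV[R]_n -> R) y : open U -> U y ->
  (forall k z, U z -> derivable h z (delta_mx 0 k)) ->
  (forall k, {for y, continuous (partial k h)}) ->
  differentiable h y.
Proof.
move=> oU Uy dh ch.
pose g (v : 'rV[R]_n) : R := \sum_(k < n) v 0 k * partial k h y.
have glin : linear g.
  move=> a u v; rewrite /g scaler_sumr -big_split/=; apply: eq_bigr => k _.
  by rewrite !mxE mulrDl -mulrA.
pose glM := GRing.isLinear.Build _ _ _ _ _ glin.
pose gL : {linear _ -> _} := HB.pack g glM.
have gc : continuous g.
  move=> z; apply: (@cvg_sumR _ _ (nbhs_filter z)) => k _.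
  by apply: cvgMr_tmp; exact: coord_continuous.
have o_gL : forall e : R, 0 < e -> \forall v \near (0 : 'rV[R]_n),
    `|(h \o shift y - (cst (h y) + g)) v| <= e * `|v|.
  move=> e e0; have := C1_differential oU Uy dh ch e0.
  apply: filterS => v Hv.
  by rewrite -[X in `|X|]/(h (v + y) - (h y + g v)) opprD addrA.
have dE : 'd h y = gL :> (_ -> _) by apply: diff_unique => //; apply/eqaddoP.
by apply/diff_locallyP; rewrite dE; split => //; apply/eqaddoP.
Qed.

End RowVectors.

(** * Closure properties of C^k functions on open sets *)

Section Ck.
Context {R : realType} {n : nat}.
Implicit Types (U : set 'rV[R]_n) (h u v : 'rV[R]_n -> R).

(** [smooth_on] speaks of the iterated derivatives of one function, but the derivative of a product
    or of a composite is a sum of products of other functions. Counting the order yields an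
    induction hypothesis that covers all functions at once. *)
Fixpoint Ck (k : nat) U h : Prop :=
  (forall y, U y -> {for y, continuous h}) /\
  if k is k'.+1 then
    (forall j y, U y -> derivable h y (delta_mx 0 j)) /\
    (forall j, Ck k' U (partial j h))
  else True.

Lemma Ck_continuous k U h : Ck k U h -> forall y, U y -> {for y, continuous h}.
Proof. by case: k => [|k] [ch _] y Uy; exact: (ch _ Uy). Qed.

Lemma Ck_derivable k U h j y : Ck k.+1 U h -> U y -> derivable h y (delta_mx 0 j).
Proof. by move=> [_ [dh _]] Uy; exact: (dh _ _ Uy). Qed.

Lemma Ck_partial k U h j : Ck k.+1 U h -> Ck k U (partial j h).
Proof. by move=> [_ [_ Dh]]; exact: Dh. Qed.

Lemma CkS k U h : (forall y, U y -> {for y, continuous h}) ->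
    (forall j y, U y -> derivable h y (delta_mx 0 j)) ->
    (forall j, Ck k U (partial j h)) -> Ck k.+1 U h.
Proof. by []. Qed.

Lemma smooth_onP U h : smooth_on U h <-> forall k, Ck k U h.
Proof.
split=> [H k|H s].
  suff : forall s, Ck k U (iter_partial s h) by move=> /(_ [::]).
  elim: k => [|k IH] s; first by split => // y Uy; have [] := H s y Uy.
  apply: CkS => [y Uy|j y Uy|j]; [by have [] := H s y Uy|by have [_] := H s y Uy|].
  exact: (IH (j :: s)).
suff H' k : Ck k U (iter_partial s h).
  move=> y Uy; split; first exact: (Ck_continuous (H' 0%N)).
  by move=> j; apply: Ck_derivable (H' 1%N) Uy.
by elim: s k => [//|j s IH] k; apply: Ck_partial; exact: IH.
Qed.

Lemma CkW k U h : Ck k.+1 U h -> Ck k U h.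
Proof.
elim: k h => [|k IH] h [ch [dh Dh]]; first by split.
by apply: CkS => // j; exact: IH.
Qed.

Lemma eq_continuous_open (T S : topologicalType) (A : set T) (f g : T -> S) y :
  open A -> {in A, f =1 g} -> A y -> {for y, continuous f} -> {for y, continuous g}.
Proof.
move=> oA fg Ay cf; rewrite /prop_for/continuous_at -fg ?inE//.
apply: cvg_trans cf; apply: near_eq_cvg.
move: (open_nbhs_nbhs (conj oA Ay)); apply: filterS => z Az.
by rewrite fg ?inE.
Qed.

(** Formulas for derivatives of products, inverses or composites hold only on [U]; as [U] is open,
    agreement there is enough for derivatives of every order. *)
Lemma Ck_eq k U h u : open U -> {in U, h =1 u} -> Ck k U h -> Ck k U u.
Proof.
move=> oU; elim: k h u => [|k IH] h u hu [ch rest].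
  by split => // y Uy; exact: (eq_continuous_open oU hu Uy (ch y Uy)).
have nE y : U y -> {near y, h =1 u}.
  move=> Uy; move: (open_nbhs_nbhs (conj oU Uy)); apply: filterS => z Uz.
  by rewrite hu ?inE.
case: rest => dh Dh; apply: CkS => [y Uy|j y Uy|j].
- exact: (eq_continuous_open oU hu Uy (ch y Uy)).
- by apply: near_eq_derivable (dh _ _ Uy); exact: nE.
- apply: IH (Dh j) => y /set_mem Uy.
  by apply: near_eq_derive; exact: nE.
Qed.

Lemma Ck_local k U h :
  (forall y, U y -> exists V, [/\ open V, V y & Ck k V h]) -> Ck k U h.
Proof.
elim: k h => [|k IH] h H.
  by split => // y /H[V [oV Vy [cV _]]]; exact: (cV _ Vy).
apply: CkS => [y /H[V [oV Vy]]|j y /H[V [oV Vy]]|j].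
- by move=> Vh; exact: (Ck_continuous Vh Vy).
- by move=> Vh; exact: (Ck_derivable Vh Vy).
- apply: IH => y /H[V [oV Vy /(@Ck_partial _ _ _ j) Vh]]; by exists V.
Qed.

Lemma Ck_cst k U (c : R) : Ck k U (fun=> c).
Proof.
elim: k c => [|k IH] c; first by split => // y _; exact: cst_continuous.
apply: CkS => [y _|j y _|j]; [exact: cst_continuous|exact: derivable_cst|].
suff -> : partial j (fun=> c) = fun=> 0 by exact: IH.
by apply/funext => y; exact: derive_cst.
Qed.

Lemma CkD k U h u : open U -> Ck k U h -> Ck k U u -> Ck k U (fun y => h y + u y).
Proof.
move=> oU; elim: k h u => [|k IH] h u Hh Hu.
  split => // y Uy.
  by apply: continuousD; [exact: (Ck_continuous Hh Uy)|exact: (Ck_continuous Hu Uy)].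
apply: CkS => [y Uy|j y Uy|j].
- by apply: continuousD; [exact: (Ck_continuous Hh Uy)|exact: (Ck_continuous Hu Uy)].
- by apply: derivableD; [exact: (Ck_derivable Hh Uy)|exact: (Ck_derivable Hu Uy)].
- apply: Ck_eq (IH _ _ (Ck_partial j Hh) (Ck_partial j Hu)) => // y /set_mem Uy.
  by rewrite /partial deriveD//;
    [exact: (Ck_derivable Hh Uy)|exact: (Ck_derivable Hu Uy)].
Qed.

Lemma CkM k U h u : open U -> Ck k U h -> Ck k U u -> Ck k U (fun y => h y * u y).
Proof.
move=> oU; elim: k h u => [|k IH] h u Hh Hu.
  split => // y Uy.
  by apply: continuousM; [exact: (Ck_continuous Hh Uy)|exact: (Ck_continuous Hu Uy)].
apply: CkS => [y Uy|j y Uy|j].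
- by apply: continuousM; [exact: (Ck_continuous Hh Uy)|exact: (Ck_continuous Hu Uy)].
- by apply: derivableM; [exact: (Ck_derivable Hh Uy)|exact: (Ck_derivable Hu Uy)].
- apply: Ck_eq (CkD oU (IH _ _ (CkW Hh) (Ck_partial j Hu))
                       (IH _ _ (CkW Hu) (Ck_partial j Hh))) => // y /set_mem Uy.
  by rewrite /partial deriveM//;
    [exact: (Ck_derivable Hh Uy)|exact: (Ck_derivable Hu Uy)].
Qed.

Lemma Ck_sum k U (I : Type) (r : seq I) (P : pred I) (h : I -> 'rV[R]_n -> R) :
  open U -> (forall i, P i -> Ck k U (h i)) ->
  Ck k U (fun y => \sum_(i <- r | P i) h i y).
Proof.
move=> oU H; elim: r => [|i r IH].
  rewrite (_ : (fun _ => _) = fun=> 0); first exact: Ck_cst.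
  by apply/funext => y; rewrite big_nil.
rewrite (_ : (fun _ => _) = fun y => if P i then h i y + \sum_(j <- r | P j) h j y
    else \sum_(j <- r | P j) h j y); last by apply/funext => y; rewrite big_cons.
case Pi: (P i) => //; apply: CkD => //; exact: H.
Qed.

Lemma Ck_prod k U (I : Type) (r : seq I) (P : pred I) (h : I -> 'rV[R]_n -> R) :
  open U -> (forall i, P i -> Ck k U (h i)) ->
  Ck k U (fun y => \prod_(i <- r | P i) h i y).
Proof.
move=> oU H; elim: r => [|i r IH].
  rewrite (_ : (fun _ => _) = fun=> 1); first exact: Ck_cst.
  by apply/funext => y; rewrite big_nil.
rewrite (_ : (fun _ => _) = fun y => if P i then h i y * \prod_(j <- r | P j) h j y
    else \prod_(j <- r | P j) h j y); last by apply/funext => y; rewrite big_cons.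
case Pi: (P i) => //; apply: CkM => //; exact: H.
Qed.

(* The family [phi] is closed under differentiation, [phi (d i)] being the
   derivative of [phi i]. *)
Lemma Ck_scalar_comp (K : Type) (d : K -> K) (phi : K -> R -> R) (V : set R) k U u i :
  open U ->
  (forall i x, V x -> is_derive x (1 : R) (phi i) (phi (d i) x)) ->
  (forall y, U y -> V (u y)) ->
  Ck k U u -> Ck k U (fun y => phi i (u y)).
Proof.
move=> oU Hd HV.
have ct i' y : Ck 0 U u -> U y -> {for y, continuous (fun y => phi i' (u y))}.
  move=> Hu Uy; apply: (@continuous_comp _ _ _ u (phi i')).
    exact: (Ck_continuous Hu Uy).
  have [dphi _] := Hd i' _ (HV _ Uy).
  by apply: differentiable_continuous; apply/derivable1_diffP.
elim: k i => [|k IH] i Hu; first by split => // y Uy; exact: ct.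
have dE j y : U y ->
    is_derive y (delta_mx 0 j) (phi i \o u) (phi (d i) (u y) * partial j u y).
  move=> Uy; apply: is_derive_scalar_comp; first exact: Hd (HV _ Uy).
  by apply: derivableP; exact: (Ck_derivable Hu Uy).
apply: CkS => [y Uy|j y Uy|j].
- by apply: ct => //; split => // z Uz; exact: (Ck_continuous Hu Uz).
- by have [] := dE j y Uy.
- apply: Ck_eq (CkM oU (IH (d i) (CkW Hu)) (Ck_partial j Hu)) => // y /set_mem Uy.
  by have [_ <-] := dE j y Uy.
Qed.

Lemma CkV k U u : open U -> (forall y, U y -> u y != 0) ->
  Ck k U u -> Ck k U (fun y => (u y)^-1).
Proof.
move=> oU u0 Hu.
(* The functions [c * x^-m] contain the inverse and are closed under differentiation: the pair
   [(c, m)] becomes [(- c m, m + 1)]. *)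
pose phi (a : R * nat) (x : R) : R := a.1 * x^-1 ^+ a.2.
pose d (a : R * nat) := (- (a.1 * a.2%:R), a.2.+1).
have dphi a x : x != 0 -> is_derive x (1 : R) (phi a) (phi (d a) x).
  move=> x0; have dV : is_derive x (1 : R) (@GRing.inv R) (- x ^- 2).
    by apply: DeriveDef; [exact: derivableV|
      rewrite (@deriveV R R id x 1)// derive_id [_ *: _]mulr1].
  have -> : phi a = a.1 *: ((@GRing.inv R) ^+ a.2).
    by apply/funext => z; rewrite /phi -[in RHS]/(a.1 * _) exprfctE.
  apply: is_derive_eq.
  case: a => c m /=; rewrite /phi /= /GRing.scale/= -exprVn.
  by case: m => [|m]; rewrite !exprS ?expr0; ring.
have -> : (fun y => (u y)^-1) = fun y => phi (1, 1%N) (u y).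
  by apply/funext => y; rewrite /phi mul1r expr1.
exact: (@Ck_scalar_comp _ d phi [set x | x != 0]).
Qed.

Lemma Ck_sqrt k U u : open U -> (forall y, U y -> 0 < u y) ->
  Ck k U u -> Ck k U (fun y => Num.sqrt (u y)).
Proof.
move=> oU u0 Hu.
(* Likewise for [c * sqrt x * x^-m], whose derivative is [c (1/2 - m) * sqrt x * x^-(m + 1)]. *)
pose phi (a : R * nat) (x : R) : R := a.1 * (Num.sqrt x * x^-1 ^+ a.2).
pose d (a : R * nat) := (a.1 * (2^-1 - a.2%:R), a.2.+1).
have dphi a (x : R) : 0 < x -> is_derive x (1 : R) (phi a) (phi (d a) x).
  move=> x0; have dV : is_derive x (1 : R) (@GRing.inv R) (- x ^- 2).
    by apply: DeriveDef; [apply: derivableV => //; rewrite gt_eqF|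
      rewrite (@deriveV R R id x 1) ?gt_eqF// derive_id [_ *: _]mulr1].
  have dS := is_derive1_sqrt x0.
  have -> : phi a = a.1 *: ((Num.sqrt : R -> R) * (@GRing.inv R) ^+ a.2).
    by apply/funext => z; rewrite /phi -[in RHS]/(a.1 * _) /= exprfctE.
  apply: is_derive_eq.
  have s0 : 0 < Num.sqrt x by rewrite sqrtr_gt0.
  have xE : x = Num.sqrt x * Num.sqrt x by rewrite -expr2 sqr_sqrtr// ltW.
  case: a => c m /=; rewrite /phi /=.
  rewrite /GRing.scale/= exprfctE.
  have sV : (2 * Num.sqrt x)^-1 = 2^-1 * (Num.sqrt x * x^-1).
    set s := Num.sqrt x in s0 xE *.
    by rewrite xE; field; rewrite gt_eqF.
  rewrite sV -exprVn.
  by case: m => [|m]; rewrite !exprS ?expr0/=; ring.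
have -> : (fun y => Num.sqrt (u y)) = fun y => phi (1, 0%N) (u y).
  by apply/funext => y; rewrite /phi mul1r expr0 mulr1.
exact: (@Ck_scalar_comp _ d phi [set x | 0 < x]).
Qed.

End Ck.

(** * The chain rule and composition of C^k maps *)

Section Composition.
Context {R : realType}.

Lemma Ck_differentiable k n (U : set 'rV[R]_n) (h : 'rV[R]_n -> R) y :
  open U -> U y -> Ck k.+1 U h -> differentiable h y.
Proof.
move=> oU Uy Hh; apply: (C1_differentiable oU Uy).
  by move=> j z Uz; exact: (Ck_derivable Hh Uz).
by move=> j; exact: (Ck_continuous (Ck_partial j Hh) Uy).
Qed.

Lemma derive_partial n (h : 'rV[R]_n -> R) y w : differentiable h y ->
  'D_w h y = \sum_(l < n) w 0 l * partial l h y.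
Proof.
move=> dh; rewrite deriveE// {1}[w]row_sum_delta linear_sum/=.
by apply: eq_bigr => l _; rewrite linearZ/= /partial deriveE.
Qed.

Lemma differentiable_row (V : normedModType R) n (tau : V -> 'rV[R]_n) y :
  (forall l, differentiable (fun z => tau z 0 l : R) y) -> differentiable tau y.
Proof.
move=> H; have -> : tau = \sum_(l < n) (fun z => (tau z 0 l : R) *: (delta_mx 0 l : 'rV[R]_n)).
  by apply/funext => z; rewrite [LHS]row_sum_delta fct_sumE.
by apply: differentiable_sum => l; apply: differentiableZl; exact: H.
Qed.

Lemma derive_comp m n (tau : 'rV[R]_m -> 'rV[R]_n) (h : 'rV[R]_n -> R) y w :
  (forall l, differentiable (fun z => tau z 0 l : R) y) ->
  differentiable h (tau y) ->
  derivable (h \o tau) y w /\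
  'D_w (h \o tau) y = \sum_(l < n) 'D_w (fun z => tau z 0 l : R) y * partial l h (tau y).
Proof.
move=> dtau dh; have dt := differentiable_row dtau.
have dc : differentiable (h \o tau) y by exact: differentiable_comp.
split; first exact: diff_derivable.
have dtw := diff_derivable (v := w) dt.
rewrite deriveE// diff_comp//= -(deriveE _ dt) -deriveE// derive_partial//.
by apply: eq_bigr => l _; rewrite derive_mx// mxE.
Qed.

(** Vectors are rows and the Jacobian acts on the right, so its rows are indexed by the directions
    in the source. *)
Lemma jacobianE m n (tau : 'rV[R]_m -> 'rV[R]_n) y k l :
  (forall l, differentiable (fun z => tau z 0 l : R) y) ->
  ('J tau y) k l = partial k (fun z => tau z 0 l : R) y.
Proof.
move=> dtau; have dt := differentiable_row dtau.
have := deriveEjacobian (delta_mx 0 k) dt; rewrite -rowE => /rowP/(_ l).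
rewrite !mxE => <-; rewrite derive_mx ?mxE//; exact: diff_derivable.
Qed.

Lemma Ck_comp k m n (U : set 'rV[R]_m) (V : set 'rV[R]_n)
    (tau : 'rV[R]_m -> 'rV[R]_n) (h : 'rV[R]_n -> R) :
  open U -> open V -> (forall y, U y -> V (tau y)) ->
  (forall l, Ck k U (fun y => tau y 0 l)) -> Ck k V h -> Ck k U (h \o tau).
Proof.
move=> oU oV UV; elim: k h => [|k IH] h Ht Hh.
  split => // y Uy; apply: continuous_comp; last exact: (Ck_continuous Hh (UV _ Uy)).
  apply: continuous_mxP => i j; rewrite ord1; exact: (Ck_continuous (Ht j) Uy).
have dt l y : U y -> differentiable (fun z => tau z 0 l : R) y.
  by move=> Uy; exact: (Ck_differentiable oU Uy (Ht l)).
have dh y : U y -> differentiable h (tau y).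
  by move=> Uy; exact: (Ck_differentiable oV (UV _ Uy) Hh).
apply: CkS => [y Uy|j y Uy|j].
- apply: continuous_comp; last exact: (Ck_continuous Hh (UV _ Uy)).
  by apply: continuous_mxP => i j; rewrite ord1; exact: (Ck_continuous (Ht j) Uy).
- by have [] := derive_comp (delta_mx 0 j) (fun l => dt l y Uy) (dh y Uy).
- apply: (@Ck_eq _ _ _ _ (fun y => \sum_(l < n) partial j (fun z => tau z 0 l : R) y *
      (partial l h \o tau) y)) => //.
    move=> y /set_mem Uy.
    by have [_ <-] := derive_comp (delta_mx 0 j) (fun l => dt l y Uy) (dh y Uy).
  apply: Ck_sum => // l _; apply: CkM => //; first exact: (Ck_partial j (Ht l)).
  apply: IH; last exact: (Ck_partial l Hh).
  by move=> l'; apply: CkW; exact: Ht.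
Qed.

Lemma Ck_coord k n (U : set 'rV[R]_n) l : open U -> Ck k U (fun y => y 0 l).
Proof.
case: k => [|k] oU; first by split => // y _; exact: coord_continuous.
apply: CkS => [y _|j y _|j]; first exact: coord_continuous.
  by apply: diff_derivable; exact: differentiable_coord.
have -> : partial j (fun y : 'rV[R]_n => y 0 l) = fun=> (delta_mx 0 j : 'rV[R]_n) 0 l.
  apply/funext => y; rewrite /partial.
  have := @derive_mx R _ 1 n id y (delta_mx 0 j) (@derivable_id _ _ _ _).
  by rewrite derive_id => /matrixP/(_ 0 l) ->; rewrite mxE.
exact: Ck_cst.
Qed.

Lemma partialM n (f h : 'rV[R]_n -> R) y k :
  derivable f y (delta_mx 0 k) -> derivable h y (delta_mx 0 k) ->
  partial k (fun z => f z * h z) y = f y * partial k h y + h y * partial k f y.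
Proof. exact: deriveM. Qed.

Lemma partialD n (f h : 'rV[R]_n -> R) y k :
  derivable f y (delta_mx 0 k) -> derivable h y (delta_mx 0 k) ->
  partial k (fun z => f z + h z) y = partial k f y + partial k h y.
Proof. exact: deriveD. Qed.

End Composition.

(** * A smooth function vanishing exactly on the nonpositive half-line *)

Section Bump.
Context {R : realType}.

(* These functions are stable under differentiation, also at [0], where the
   exponential kills every power of [x^-1]. *)
Definition flat (p : {poly R}) (x : R) : R :=
  if 0 < x then p.[x^-1] * expR (- x^-1) else 0.

(** With [u = x^-1], the derivative in [x] of [p(u) exp(-u)] is [u^2 (p(u) - p'(u)) exp(-u)]. *)
Definition flat_deriv (p : {poly R}) : {poly R} := 'X^2 * (p - p^`()).

(** Monomial by monomial: [exp u >= u^(i+1) / (i+1)!] gives [u^i exp(-u) <= (i+1)! / u], and [1 / u]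
    is [x]. *)
Lemma flat_bound (p : {poly R}) : exists2 C : R, 0 <= C &
  forall x, `|flat p x| <= C * `|x|.
Proof.
exists (\sum_(i < size p) `|p`_i| * (i.+1)`!%:R).
  by apply: sumr_ge0 => i _; rewrite mulr_ge0.
move=> x; rewrite /flat; case: ifPn => x0; last first.
  by rewrite normr0 mulr_ge0// sumr_ge0// => i _; rewrite mulr_ge0.
set u := x^-1; have u0 : 0 < u by rewrite invr_gt0.
rewrite (gtr0_norm x0) -[x]invrK -/u -ler_pdivrMr ?invr_gt0// invrK.
rewrite -[X in _ * X <= _](gtr0_norm u0) -normrM horner_coef 2!mulr_suml.
apply: le_trans (ler_norm_sum _ _ _) _; apply: ler_sum => i _.
rewrite -!mulrA normrM ler_wpM2l// ger0_norm; last first.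
  by rewrite !mulr_ge0// ?exprn_ge0 ?expR_ge0// ltW.
rewrite expRN mulrCA -exprSr ler_pdivrMl ?expR_gt0//.
have := expR_ge1Dxn i (ltW u0).
rewrite -ler_pdivrMr//.
by apply: le_trans; rewrite lerDr.
Qed.

Lemma is_derive_flat (p : {poly R}) (x : R) :
  is_derive x (1 : R) (flat p) (flat (flat_deriv p) x).
Proof.
have [x0|x0|->] := ltgtP x 0.
- rewrite {2}/flat ltNge (ltW x0)/=.
  apply: (@near_eq_is_derive _ _ _ (cst (0 : R))).
  near=> z; rewrite /flat ifF//; apply/negbTE; rewrite -leNgt ltW//.
  by near: z; exact: lt_nbhsl.
- rewrite {2}/flat x0 /flat_deriv.
  apply: (@near_eq_is_derive _ _ _ (fun z => (horner p \o @GRing.inv R) z *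
     (expR \o (fun z : R => - z^-1)) z)).
    near=> z; rewrite /flat ifT//; near: z; exact: lt_nbhsr.
  have xn0 : x != 0 by rewrite gt_eqF.
  have dV : is_derive x (1 : R) (@GRing.inv R) (- x ^- 2).
    by apply: DeriveDef; [exact: derivableV|
      rewrite (@deriveV R R id x 1)// derive_id [_ *: _]mulr1].
  have dNV : is_derive x (1 : R) (fun z : R => - z^-1) (x ^- 2).
    by apply: is_derive_eq (is_deriveN _) _; rewrite opprK.
  have dE : is_derive x (1 : R) (expR \o (fun z : R => - z^-1)) (expR (- x^-1) * x ^- 2).
    exact: is_derive1_comp.
  have dP : is_derive x (1 : R) (horner p \o @GRing.inv R) ((p^`()).[x^-1] * - x ^- 2).
    exact: is_derive1_comp.
  apply: is_derive_eq (is_deriveM dP dE) _.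
  rewrite /GRing.scale/= hornerM hornerXn hornerD hornerN -exprVn; ring.
- have f0 q : flat q 0 = 0 by rewrite /flat ltxx.
  (* At 0 the difference quotient [flat p h / h] is again a flat function, that of ['X * p]; the
     linear bound on the latter sends it to 0. *)
  rewrite f0; have [C C0 HC] := flat_bound ('X * p).
  suff H : (fun h : R => h^-1 *: ((flat p \o shift (0:R)) (h *: (1:R)) - flat p 0)) @ 0^' --> (0:R).
    by apply: DeriveDef; [apply/cvg_ex; exists 0|exact: cvg_lim].
  apply: cvg_within_filter; apply/cvgr0Pnorm_le => e e0.
  have C1 : 0 < C + 1 by rewrite ltr_wpDl.
  near=> h; rewrite f0 subr0 /= addr0 [h *: 1]mulr1.
  have -> : h^-1 *: flat p h = flat ('X * p) h.
    rewrite /flat; case: ifP => _; last by rewrite scaler0.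
    by rewrite hornerM hornerX -mulrA.
  apply: le_trans (HC h) _; apply: (@le_trans _ _ ((C + 1) * `|h|)).
    by rewrite ler_wpM2r// lerDl.
  rewrite -ler_pdivlMl// mulrC; near: h; apply/nbhs_ballP => /=.
  exists (e / (C + 1)); first by rewrite /= divr_gt0.
  by move=> z; rewrite -ball_normE /= sub0r normrN => /ltW.
Unshelve. all: by end_near. Qed.

Definition bump : R -> R := flat 1.

Lemma bump_gt0 x : (0 < bump x) = (0 < x).
Proof.
rewrite /bump /flat; case: ifP => [x0|]; last by rewrite ltxx.
by rewrite hornerC mul1r expR_gt0.
Qed.

Lemma bump_ge0 x : 0 <= bump x.
Proof.
by rewrite /bump /flat; case: ifP => // x0; rewrite hornerC mul1r expR_ge0.
Qed.

Lemma bump_eq0 x : x <= 0 -> bump x = 0.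
Proof. by move=> x0; rewrite /bump /flat ltNge x0. Qed.

Lemma Ck_bump k n (U : set 'rV[R]_n) u : open U -> Ck k U u ->
  Ck k U (fun y => bump (u y)).
Proof.
move=> oU Hu.
by apply: (@Ck_scalar_comp _ _ _ flat_deriv flat setT) => // i x _; exact: is_derive_flat.
Qed.

End Bump.

Section ContinuousAt.
Implicit Types T U V : topologicalType.

Lemma continuous_pair T U V (f : T -> U) (g : T -> V) x :
  {for x, continuous f} -> {for x, continuous g} ->
  {for x, continuous (fun z => (f z, g z))}.
Proof. by move=> cf cg; apply: cvg_pair. Qed.

Lemma continuous_fst T U (z : T * U) : {for z, continuous (@fst T U)}.
Proof. by apply: cvg_fst. Qed.

Lemma continuous_snd T U (z : T * U) : {for z, continuous (@snd T U)}.
Proof. by apply: cvg_snd. Qed.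

Lemma continuous_id T (z : T) : {for z, continuous (@id T)}.
Proof. by apply: cvg_id. Qed.

Lemma continuous_cst T U (c : U) (z : T) : {for z, continuous (fun=> c)}.
Proof. by apply: cvg_cst. Qed.

Lemma continuous_ext T U (f g : T -> U) x :
  f =1 g -> {for x, continuous f} -> {for x, continuous g}.
Proof. by move=> /funext ->. Qed.

Lemma continuous_affine (R : realType) T (f g : T -> R) (a : R) x :
  {for x, continuous f} -> {for x, continuous g} ->
  {for x, continuous (fun z => a * f z + g z)}.
Proof. by move=> cf cg; apply: cvgD => //; apply: cvgMl_tmp. Qed.

Lemma continuous_sub (R : realType) T (f g : T -> R) x :
  {for x, continuous f} -> {for x, continuous g} ->
  {for x, continuous (fun z => f z - g z)}.
Proof. by move=> cf cg; apply: cvgB. Qed.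

Lemma continuous_eps (R : realType) T (W : normedModType R) (f : T -> W) y :
  (forall e, 0 < e -> \forall z \near y, `|f y - f z| <= e) <-> {for y, continuous f}.
Proof. by split=> H; apply/cvgrPdist_le. Qed.

End ContinuousAt.

(** * Uniform closeness over compact sets, and derivatives from linear estimates *)

Section Estimates.
Context {R : realType}.

(** Each point of [K] has a neighbourhood on which one neighbourhood of [t0] works, and compactness
    makes the latter common to all. This plays the part of dominated convergence throughout. *)
Lemma tube (X T : topologicalType) (K : set X) (u : T -> X -> R) (t0 : T) :
  compact K ->
  (forall x, K x -> {for (t0, x), continuous (fun z => u z.1 z.2)}) ->
  forall e : R, 0 < e -> \forall t \near t0, forall x, K x -> `|u t x - u t0 x| <= e.
Proof.
move=> /compact_near_coveringP cK cu e e0.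
apply: (cK _ (nbhs t0) (fun t x => `|u t x - u t0 x| <= e)) => x Kx.
have c : {for (t0, x), continuous (fun z : T * X => u z.1 z.2 - u t0 z.2)}.
  apply: continuous_sub; first exact: cu.
  apply: (@continuous_comp _ _ _ (fun z : T * X => (t0, z.2)) (fun z => u z.1 z.2)).
    by apply: continuous_pair; [exact: continuous_cst|exact: continuous_snd].
  exact: cu.
move/continuous_eps : c => /(_ e e0); rewrite /= subrr => -[[A B] [/= FA xB] AB].
exists (B, A) => // -[x' t] [/= Bx' At].
by have := AB (t, x') (conj At Bx'); rewrite /= sub0r normrN.
Qed.

(** A pointwise bound [e * |s|] is multiplied, when integrated, by the size of the domain; [C]
    stands for that size. *)
Lemma is_derive_estimate (H : R -> R) (s0 G C : R) :
  (forall e : R, 0 < e -> \forall s \near (0 : R),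
     `|H (s + s0) - H s0 - s * G| <= C * (e * `|s|)) ->
  is_derive s0 (1 : R) H G.
Proof.
move=> HC.
suff L : (fun h : R => h^-1 *: ((H \o shift s0) (h *: (1 : R)) - H s0)) @ 0^' --> G.
  by apply: DeriveDef; [apply/cvg_ex; exists G|exact: cvg_lim].
apply/cvgrPdist_le => e e0.
(* Nothing is assumed about the sign of [C], so the tolerance is divided by a quantity that is
   positive in all cases. *)
have C1 : 0 < `|C| + 1 by rewrite ltr_wpDl.
have := HC (e / (`|C| + 1)) (divr_gt0 e0 C1).
move=> Hs; rewrite near_withinE; apply: filterS Hs => h Hh h0 /=.
rewrite [h *: 1]mulr1.
have -> : G - h^-1 *: (H (h + s0) - H s0) = - (h^-1 * (H (h + s0) - H s0 - h * G)).
  by rewrite /GRing.scale/= [in RHS]mulrBr mulKf// opprB.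
rewrite normrN normrM normfV ler_pdivrMl ?normr_gt0//.
apply: le_trans Hh _.
have -> : C * (e / (`|C| + 1) * `|h|) = C / (`|C| + 1) * (`|h| * e) by ring.
rewrite ler_piMl ?mulr_ge0 ?(ltW e0)// ler_pdivrMr// mul1r.
by rewrite (le_trans (ler_norm C))// lerDl.
Qed.

End Estimates.

(** * Integration by parts for iterated integrals *)

Section LineIntegrals.
Context {R : realType}.
Local Notation leb := (@lebesgue_measure R).
Implicit Types (phi : R -> R) (r e : R).

Definition cs1 r phi := continuous phi /\ forall x, r < `|x| -> phi x = 0.

Lemma continuous_itv_integrable phi (a b : R) : {within `[a, b], continuous phi} ->
  leb.-integrable `[a, b] (EFin \o phi).
Proof.
by move=> c; apply: continuous_compact_integrable => //; exact: segment_compact.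
Qed.

Lemma cs1_restrict r phi : cs1 r phi -> phi = phi \_ `[- r, r].
Proof.
move=> [_ phi0]; apply/funext => x; rewrite patchE; case: ifPn => // xr.
apply: phi0; rewrite ltNge ler_norml; apply: contra xr => xr.
by rewrite inE/= in_itv/=.
Qed.

Lemma cs1_integrable r phi : cs1 r phi -> leb.-integrable setT (EFin \o phi).
Proof.
move=> H; rewrite (cs1_restrict H) -restrict_EFin.
 apply: (iffLR (integrable_mkcond _ _)) => //.
by apply: continuous_itv_integrable; apply: continuous_subspaceT; exact: H.1.
Qed.

Lemma cs1_Rintegral r phi : cs1 r phi ->
  \int[leb]_x phi x = \int[leb]_(x in `[- r, r]) phi x.
Proof. by move=> H; rewrite [in LHS](cs1_restrict H) [RHS]Rintegral_mkcond. Qed.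

Lemma Rintegral_cst_itv (a b c : R) : a <= b ->
  \int[leb]_(x in `[a, b]) c = c * (b - a).
Proof.
move=> ab; rewrite Rintegral_cst//; congr (_ * _).
have := lebesgue_measure_itv `[a, b]%R => /= ->.
by move: ab; rewrite lte_fin le_eqVlt => /predU1P[->|->]//; rewrite ltxx subrr.
Qed.

Lemma cs1_bound r phi e : 0 <= r -> cs1 r phi -> (forall x, `|phi x| <= e) ->
  `|\int[leb]_x phi x| <= (2 * r) * e.
Proof.
move=> r0 H phie.
have ir : leb.-integrable `[- r, r] (EFin \o phi).
  by apply: continuous_itv_integrable; apply: continuous_subspaceT; exact: H.1.
rewrite (cs1_Rintegral H); apply: le_trans (le_normr_Rintegral _ ir) _ => //.
apply: (@le_trans _ _ (\int[leb]_(x in `[- r, r]) e)).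
  apply: le_Rintegral => //.
    apply: continuous_itv_integrable; apply: continuous_subspaceT.
    by move=> x; apply: (continuous_comp (H.1 x)); exact: norm_continuous.
  by apply: continuous_itv_integrable; apply: continuous_subspaceT => x; exact: cst_continuous.
rewrite Rintegral_cst_itv; last by rewrite (le_trans _ r0)// oppr_le0.
by rewrite opprK mulrC ler_wpM2r ?(le_trans _ (phie 0))// mulr_natl mulr2n.
Qed.

Lemma cs1_gt0 r phi x0 : cs1 r phi -> (forall x, 0 <= phi x) -> 0 < phi x0 ->
  0 < \int[leb]_x phi x.
Proof.
move=> H phi0 px0.
have [d d0 Hd] : exists2 d : R, 0 < d & forall x, `|x0 - x| <= d -> phi x0 / 2 <= phi x.
  have : \forall x \near x0, phi x0 / 2 <= phi x.
    have := (cvgr_ge _ (H.1 x0) (phi x0 / 2)); apply.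
    by rewrite gtr_pMr// invf_lt1// ltr1n.
  move=> /nbhs_ballP[d /= d0 Hd]; exists (d / 2); first by rewrite divr_gt0.
  move=> x xd; apply: Hd; rewrite -ball_normE/=; apply: le_lt_trans xd _.
  by rewrite gtr_pMr// invf_lt1// ltr1n.
apply: (@lt_le_trans _ _ (\int[leb]_(x in `[x0 - d, x0 + d]) (phi x0 / 2))).
  rewrite Rintegral_cst_itv; last by rewrite lerBlDr -addrA lerDl addr_ge0 ?ltW.
  by rewrite mulr_gt0 ?divr_gt0//; lra.
rewrite Rintegral_mkcond; apply: le_Rintegral => //.
- rewrite -restrict_EFin; apply: (iffLR (integrable_mkcond _ _)) => //.
  by apply: continuous_itv_integrable; apply: continuous_subspaceT => x; exact: cst_continuous.
- exact: cs1_integrable H.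
- move=> x _; rewrite patchE; case: ifPn => // /set_mem/=; rewrite in_itv/= => /andP[h1 h2].
  by apply: Hd; rewrite ler_norml; apply/andP; split; lra.
Qed.

Lemma itv_Rintegral_gt0 phi (a b x0 : R) : {within `[a, b], continuous phi} ->
  (forall x, a <= x <= b -> 0 <= phi x) -> a < x0 < b -> {for x0, continuous phi} ->
  0 < phi x0 -> 0 < \int[leb]_(x in `[a, b]) phi x.
Proof.
move=> cphi phi0 /andP[ax0 x0b] cx0 px0.
have [d d0 Hd] : exists2 d : R, 0 < d & forall x, `|x0 - x| <= d ->
    (a <= x <= b) /\ phi x0 / 2 <= phi x.
  have : \forall x \near x0, (a <= x <= b) /\ phi x0 / 2 <= phi x.
    apply: filterI.
      have : \forall x \near x0, x \in `]a, b[ by apply: near_in_itvoo; rewrite in_itv/= ax0.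
      by apply: filterS => x; rewrite in_itv/= => /andP[? ?]; rewrite !ltW.
    have := (cvgr_ge _ cx0 (phi x0 / 2)); apply.
    by rewrite gtr_pMr// invf_lt1// ltr1n.
  move=> /nbhs_ballP[d /= d0 Hd]; exists (d / 2); first by rewrite divr_gt0.
  move=> x xd; apply: Hd; rewrite -ball_normE/=; apply: le_lt_trans xd _.
  by rewrite gtr_pMr// invf_lt1// ltr1n.
apply: (@lt_le_trans _ _ (\int[leb]_(x in `[x0 - d, x0 + d]) (phi x0 / 2))).
  rewrite Rintegral_cst_itv; last by rewrite lerBlDr -addrA lerDl addr_ge0 ?ltW.
  by rewrite mulr_gt0 ?divr_gt0//; lra.
rewrite Rintegral_mkcond [leRHS]Rintegral_mkcond; apply: le_Rintegral => //.
- rewrite -restrict_EFin; apply: (iffLR (integrable_mkcond _ _)) => //.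
  by apply: continuous_itv_integrable; apply: continuous_subspaceT => x; exact: cst_continuous.
- rewrite -restrict_EFin; apply: (iffLR (integrable_mkcond _ _)) => //.
  exact: continuous_itv_integrable.
- move=> x _; rewrite !patchE; case: ifPn => [/set_mem/=|_]; last first.
    by case: ifPn => // /set_mem/=; rewrite in_itv/= => /phi0.
  rewrite in_itv/= => /andP[h1 h2].
  have [|/andP[ax xb] px] := Hd x; first by rewrite ler_norml; apply/andP; split; lra.
  by rewrite mem_set//= in_itv/= ax.
Qed.

Lemma continuous_FTC2_line phi (G : R -> R) (a b : R) : a < b ->
  (forall x, x \in `[a, b]%R -> is_derive x (1 : R) phi (G x)) ->
  {within `[a, b], continuous G} ->
  \int[leb]_(x in `[a, b]) G x = phi b - phi a.
Proof.
move=> ab dphi cG.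
have cphi x : x \in `[a, b]%R -> {for x, continuous phi}.
  move=> /dphi[dx _]; apply: differentiable_continuous; exact/derivable1_diffP.
rewrite /Rintegral (@continuous_FTC2 _ G phi a b ab cG)//.
- split.
  + by move=> x xab; have [] := dphi x (subset_itv_oo_cc xab).
  + apply: cvg_at_right_filter; apply: cphi; by rewrite in_itv/= lexx ltW.
  + apply: cvg_at_left_filter; apply: cphi; by rewrite in_itv/= lexx ltW.
- by move=> x xab; rewrite derive1E; have [_] := dphi x (subset_itv_oo_cc xab).
Qed.

Lemma cs1_derive r phi (G : R -> R) : 0 <= r -> cs1 r phi -> cs1 r G ->
  (forall x, is_derive x (1 : R) phi (G x)) -> \int[leb]_x G x = 0.
Proof.
move=> r0 Hphi HG dphi.
(* Vanishing is only known for [r < |x|], so the endpoints are moved out to [r + 1]; the interval is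
   then also nondegenerate when [r] is 0. *)
have H' : cs1 (r + 1) G.
  by split; [exact: HG.1|move=> x rx; apply: HG.2; apply: lt_trans rx; rewrite ltrDl].
have r1 : 0 < r + 1 by rewrite ltr_wpDl.
have cG : {within `[- (r + 1), r + 1], continuous G}.
  by apply: continuous_subspaceT; exact: HG.1.
rewrite (cs1_Rintegral H') (continuous_FTC2_line _ (fun x _ => dphi x) cG) ?gtrN//.
by rewrite !Hphi.2 ?subrr// ?normrN gtr0_norm// ltrDl.
Qed.

End LineIntegrals.

Section RowBlocks.
Context {R : realType}.

Lemma compact_ball_rV n (y0 : 'rV[R]_n) (r : R) : compact [set y : 'rV[R]_n | `|y - y0| <= r].
Proof.
apply: bounded_closed_compact.
  exists (r + `|y0|); split; first exact: num_real.
  move=> x rx y /= yr; apply: le_trans (ltW rx).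
  by rewrite -[y](subrK y0); apply: le_trans (ler_normD _ _) _; rewrite lerD2r.
have -> : [set y : 'rV[R]_n | `|y - y0| <= r] = (fun y => `|y - y0|) @^-1` [set x | x <= r] by [].
apply: closed_comp; last exact: closed_le.
move=> y _; apply/continuous_eps => e e0.
apply/nbhs_ballP; exists e => // z; rewrite -ball_normE/= => yz.
apply: le_trans (ler_dist_dist _ _) _.
by rewrite opprB addrA subrK ltW.
Qed.

Lemma norm_row_mx_r m n (x : 'rV[R]_m) (y : 'rV[R]_n) : `|y| <= `|row_mx x y|.
Proof.
apply: mxnorm_le => // i j; rewrite -(row_mxEr x y); exact: le_mxnorm.
Qed.

Lemma row_mx_continuous m n : continuous (fun z : 'rV[R]_m * 'rV[R]_n => row_mx z.1 z.2).
Proof.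
move=> z; apply: continuous_mxP => i j; rewrite ord1.
have [k ->|k ->] := split_ordP j.
  apply: (@continuous_ext _ _ (fun z : 'rV[R]_m * 'rV[R]_n => z.1 0 k)).
    by move=> w; rewrite row_mxEl.
  apply: (@continuous_comp _ _ _ fst (fun x : 'rV[R]_m => x 0 k)); first exact: continuous_fst.
  exact: coord_continuous.
apply: (@continuous_ext _ _ (fun z : 'rV[R]_m * 'rV[R]_n => z.2 0 k)).
  by move=> w; rewrite row_mxEr.
apply: (@continuous_comp _ _ _ snd (fun x : 'rV[R]_n => x 0 k)); first exact: continuous_snd.
exact: coord_continuous.
Qed.

Lemma delta_lshift m n (k : 'I_m) :
  (delta_mx 0 (lshift n k) : 'rV[R]_(m + n)) = row_mx (delta_mx 0 k) 0.
Proof.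
apply/rowP => j; have [l ->|l ->] := split_ordP j.
  by rewrite row_mxEl !mxE (inj_eq (@lshift_inj _ _)).
by rewrite row_mxEr !mxE eqxx/= eq_rlshift.
Qed.

Lemma delta_rshift m n (k : 'I_n) :
  (delta_mx 0 (rshift m k) : 'rV[R]_(m + n)) = row_mx 0 (delta_mx 0 k).
Proof.
apply/rowP => j; have [l ->|l ->] := split_ordP j.
  by rewrite row_mxEl !mxE eqxx/= eq_lrshift.
by rewrite row_mxEr !mxE (inj_eq (@rshift_inj _ _)).
Qed.

Lemma row_mx_shiftl m n (k : 'I_m) (t : R) (x : 'rV[R]_m) (y : 'rV[R]_n) :
  t *: delta_mx 0 (lshift n k) + row_mx x y = row_mx (t *: delta_mx 0 k + x) y.
Proof. by rewrite delta_lshift scale_row_mx add_row_mx scaler0 add0r. Qed.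

Lemma row_mx_shiftr m n (k : 'I_n) (t : R) (x : 'rV[R]_m) (y : 'rV[R]_n) :
  t *: delta_mx 0 (rshift m k) + row_mx x y = row_mx x (t *: delta_mx 0 k + y).
Proof. by rewrite delta_rshift scale_row_mx add_row_mx scaler0 add0r. Qed.

Lemma growth_rowl m n (h : 'rV[R]_(m + n) -> R) k (x : 'rV[R]_m) (y : 'rV[R]_n) :
  (fun t : R => t^-1 *: (((fun x' : 'rV[R]_m => h (row_mx x' y)) \o shift x) (t *: delta_mx 0 k) - h (row_mx x y))) =
  (fun t : R => t^-1 *: ((h \o shift (row_mx x y)) (t *: delta_mx 0 (lshift n k)) - h (row_mx x y))).
Proof. by apply/funext => t /=; rewrite row_mx_shiftl. Qed.

Lemma derivable_rowl m n (h : 'rV[R]_(m + n) -> R) k (x : 'rV[R]_m) (y : 'rV[R]_n) :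
  derivable (fun x' => h (row_mx x' y)) x (delta_mx 0 k) <->
  derivable h (row_mx x y) (delta_mx 0 (lshift n k)).
Proof. by rewrite /derivable growth_rowl. Qed.

Lemma partial_rowl m n (h : 'rV[R]_(m + n) -> R) k (x : 'rV[R]_m) (y : 'rV[R]_n) :
  partial k (fun x' => h (row_mx x' y)) x = partial (lshift n k) h (row_mx x y).
Proof. by rewrite /partial /derive growth_rowl. Qed.

Lemma growth_rowr m n (h : 'rV[R]_(m + n) -> R) k (x : 'rV[R]_m) (y : 'rV[R]_n) :
  (fun t : R => t^-1 *: (((fun y' : 'rV[R]_n => h (row_mx x y')) \o shift y) (t *: delta_mx 0 k) - h (row_mx x y))) =
  (fun t : R => t^-1 *: ((h \o shift (row_mx x y)) (t *: delta_mx 0 (rshift m k)) - h (row_mx x y))).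
Proof. by apply/funext => t /=; rewrite row_mx_shiftr. Qed.

Lemma derivable_rowr m n (h : 'rV[R]_(m + n) -> R) k (x : 'rV[R]_m) (y : 'rV[R]_n) :
  derivable (fun y' => h (row_mx x y')) y (delta_mx 0 k) <->
  derivable h (row_mx x y) (delta_mx 0 (rshift m k)).
Proof. by rewrite /derivable growth_rowr. Qed.

Lemma partial_rowr m n (h : 'rV[R]_(m + n) -> R) k (x : 'rV[R]_m) (y : 'rV[R]_n) :
  partial k (fun y' => h (row_mx x y')) y = partial (rshift m k) h (row_mx x y).
Proof. by rewrite /partial /derive growth_rowr. Qed.

End RowBlocks.

(** * Iterated integrals of compactly supported continuous functions *)

Section IntegralRV.
Context {R : realType}.
Local Notation leb := (@lebesgue_measure R).

(** The support is controlled by an explicit radius because all slices of a function inherit the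
    same one: the max norm of a block never exceeds that of the whole vector. *)
Definition csupp n (r : R) (h : 'rV[R]_n -> R) :=
  continuous h /\ forall y, r < `|y| -> h y = 0.

Definition row_cons m (x : R) (y : 'rV[R]_m) : 'rV[R]_m.+1 :=
  row_mx (x%:M : 'rV[R]_1) y.

Lemma integral_rVS m (h : 'rV[R]_m.+1 -> R) :
  integral_rV h = \int[leb]_x integral_rV (fun y => h (row_cons x y)).
Proof. by []. Qed.

Lemma row_consK m (z : 'rV[R]_m.+1) : row_cons (z 0 0) (@rsubmx _ 1 1 m z) = z.
Proof.
have -> : row_cons (z 0 0) (@rsubmx _ 1 1 m z) = row_mx (@lsubmx _ 1 1 m z) (@rsubmx _ 1 1 m z).
  rewrite /row_cons; congr (@row_mx _ 1 1 m _ _).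
  by apply/rowP => j; rewrite ord1 !mxE mulr1n; congr (z _ _); exact: val_inj.
exact: (@hsubmxK _ 1 1 m z).
Qed.

Lemma norm_row_cons_l m x (y : 'rV[R]_m) : `|x| <= `|row_cons x y|.
Proof.
have := le_mxnorm (row_cons x y) 0 0; rewrite /row_cons.
by rewrite (_ : 0 = lshift m (0 : 'I_1)) ?(row_mxEl (x%:M : 'rV_1) y) ?mxE ?mulr1n//; exact: val_inj.
Qed.

Lemma norm_row_cons_r m x (y : 'rV[R]_m) : `|y| <= `|row_cons x y|.
Proof. exact: (@norm_row_mx_r _ 1 m). Qed.

Lemma row_cons_continuous m : continuous (fun z : R * 'rV[R]_m => row_cons z.1 z.2).
Proof.
move=> z; rewrite /row_cons.
apply: (@continuous_comp _ _ _ (fun z : R * 'rV[R]_m => (z.1%:M : 'rV[R]_1, z.2))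
  (fun z : 'rV[R]_1 * 'rV[R]_m => row_mx z.1 z.2)); last exact: row_mx_continuous.
apply: continuous_pair; last exact: continuous_snd.
apply: continuous_mxP => i j; rewrite !ord1.
apply: (@continuous_ext _ _ (fun z : R * 'rV[R]_m => z.1)); last exact: continuous_fst.
by move=> w; rewrite mxE mulr1n.
Qed.

Lemma row_cons_continuousr m x : continuous (fun y : 'rV[R]_m => row_cons x y).
Proof.
move=> y; apply: (@continuous_comp _ _ _ (fun y : 'rV[R]_m => (x, y))
   (fun z : R * 'rV[R]_m => row_cons z.1 z.2)); last exact: row_cons_continuous.
by apply: continuous_pair; [exact: continuous_cst|exact: continuous_id].
Qed.

Lemma csupp_slice m r (h : 'rV[R]_m.+1 -> R) x : csupp r h ->
  csupp r (fun y => h (row_cons x y)).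
Proof.
move=> [ch h0]; split.
  by move=> y; apply: continuous_comp; [exact: row_cons_continuousr|exact: ch].
by move=> y ry; apply: h0; exact: lt_le_trans ry (norm_row_cons_r _ _).
Qed.

Lemma csupp_lin n r (h u : 'rV[R]_n -> R) a : csupp r h -> csupp r u ->
  csupp r (fun y => a * h y + u y).
Proof.
move=> [ch h0] [cu u0]; split.
  by move=> y; apply: continuous_affine; [exact: ch|exact: cu].
by move=> y ry; rewrite h0// u0// mulr0 addr0.
Qed.

(** Linearity in dimension [n.+1] presupposes that slice integrals are integrable, which follows
    from their continuity, which in turn rests on linearity and the bound in dimension [n]. The two
    premises are thus the induction hypotheses of [integral_rV_basic]. *)
Lemma integral_rV_slice n (r : R) : 0 <= r ->
  (forall (h u : 'rV[R]_n -> R) a, csupp r h -> csupp r u ->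
     integral_rV (fun y => a * h y + u y) = a * integral_rV h + integral_rV u) ->
  (forall (h : 'rV[R]_n -> R) e, csupp r h -> (forall y, `|h y| <= e) ->
     `|integral_rV h| <= (2 * r) ^+ n * e) ->
  forall h : 'rV[R]_n.+1 -> R, csupp r h ->
    cs1 r (fun x => integral_rV (fun y => h (row_cons x y))).
Proof.
move=> r0 IHlin IHbd h.
move=> Hh; split; last first.
  move=> x rx.
  have := IHbd (fun y => h (row_cons x y)) 0 (csupp_slice x Hh).
  rewrite mulr0 => H; apply/eqP; rewrite -normr_le0; apply: H => y.
  by rewrite Hh.2 ?normr0//; exact: lt_le_trans rx (norm_row_cons_l _ _).
move=> x; apply/cvgrPdist_le => e e0.
(* The added 1 keeps the divisor positive when [r] is 0. *)
have C0 : 0 < (2 * r) ^+ n + 1 by rewrite ltr_wpDl// exprn_ge0// mulr_ge0.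
have := @tube R _ _ _ (fun x y => h (row_cons x y)) x (@compact_ball_rV R n 0 r) _
   (e / ((2 * r) ^+ n + 1)) (divr_gt0 e0 C0).
have L (y : 'rV[R]_n) : [set y | `|y - 0| <= r] y ->
    {for (x, y), continuous (fun z => h (row_cons z.1 z.2))}.
  move=> _; apply: (@continuous_comp _ _ _ (fun z => row_cons z.1 z.2) h (x, y)).
    exact: row_cons_continuous.
  exact: Hh.1.
move=> /(_ L); apply: filterS => x' Hx'.
have -> : integral_rV (fun y => h (row_cons x y)) - integral_rV (fun y => h (row_cons x' y)) =
  integral_rV (fun y => (-1) * h (row_cons x' y) + h (row_cons x y)).
  rewrite IHlin; [|exact: csupp_slice..].
  by rewrite mulN1r addrC.
apply: le_trans (IHbd _ (e / ((2 * r) ^+ n + 1)) _ _) _.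
- by apply: csupp_lin; exact: csupp_slice.
- move=> y; rewrite mulN1r addrC distrC; have [yr|yr] := leP `|y| r.
    by apply: Hx'; rewrite /= subr0.
  rewrite !Hh.2 ?subrr ?normr0 ?divr_ge0 ?ltW//; exact: lt_le_trans yr (norm_row_cons_r _ _).
- by rewrite mulrCA ler_piMr ?(ltW e0)// ler_pdivrMr// mul1r lerDl.
Qed.

Lemma integral_rV_basic n (r : R) : 0 <= r ->
  (forall (h u : 'rV[R]_n -> R) a, csupp r h -> csupp r u ->
     integral_rV (fun y => a * h y + u y) = a * integral_rV h + integral_rV u) /\
  (forall (h : 'rV[R]_n -> R) e, csupp r h -> (forall y, `|h y| <= e) ->
     `|integral_rV h| <= (2 * r) ^+ n * e).
Proof.
move=> r0; elim: n => [|n [IHlin IHbd]].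
  by split=> [//|h e _ he]; rewrite expr0 mul1r; exact: he.
have cs1_int := integral_rV_slice r0 IHlin IHbd.
split.
  move=> h u a Hh Hu; rewrite !integral_rVS.
  have [ch h0] := cs1_int _ Hh.
  rewrite -(RintegralZl _ measurableT (cs1_integrable (cs1_int _ Hh))).
  rewrite -RintegralD//; last exact: (cs1_integrable (cs1_int _ Hu)).
    by apply: eq_Rintegral => x _; rewrite IHlin//; exact: csupp_slice.
  apply: (@cs1_integrable _ r); split; first by move=> x; apply: cvgMl_tmp; exact: ch.
  by move=> x /h0 ->; rewrite mulr0.
move=> h e Hh he; rewrite integral_rVS exprS -mulrA.
apply: (cs1_bound r0 (cs1_int _ Hh)) => x; apply: IHbd; first exact: csupp_slice.
by move=> y; exact: he.
Qed.

Lemma integral_rV_lin n r (h u : 'rV[R]_n -> R) a : 0 <= r -> csupp r h -> csupp r u ->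
  integral_rV (fun y => a * h y + u y) = a * integral_rV h + integral_rV u.
Proof. by move=> r0; have [H _] := integral_rV_basic n r0; exact: H. Qed.

Lemma integral_rV_bound n r (h : 'rV[R]_n -> R) e : 0 <= r -> csupp r h ->
  (forall y, `|h y| <= e) -> `|integral_rV h| <= (2 * r) ^+ n * e.
Proof. by move=> r0; have [_ H] := integral_rV_basic n r0; exact: H. Qed.

Lemma integral_rV_cs1 n r (h : 'rV[R]_n.+1 -> R) : 0 <= r -> csupp r h ->
  cs1 r (fun x => integral_rV (fun y => h (row_cons x y))).
Proof.
by move=> r0; have [H1 H2] := integral_rV_basic n r0; exact: integral_rV_slice.
Qed.

Lemma csupp0 n r : csupp r ((fun=> 0) : 'rV[R]_n -> R).
Proof. by split => // y; exact: continuous_cst. Qed.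

Lemma integral_rV0 n : integral_rV ((fun=> 0) : 'rV[R]_n -> R) = 0.
Proof.
have := @integral_rV_bound n 0 (fun=> 0) 0 (lexx _) (csupp0 n 0).
by move=> H; apply/eqP; rewrite -normr_le0 (le_trans (H _))// ?mulr0// => y; rewrite normr0.
Qed.

Lemma integral_rV_sum n r (I : Type) (s : seq I) (h : I -> 'rV[R]_n -> R) : 0 <= r ->
  (forall i, csupp r (h i)) ->
  csupp r (fun y => \sum_(i <- s) h i y) /\
  integral_rV (fun y => \sum_(i <- s) h i y) = \sum_(i <- s) integral_rV (h i).
Proof.
move=> r0 H; elim: s => [|i s [IH1 IH2]].
  rewrite (_ : (fun y => _) = fun=> 0); last by apply/funext => y; rewrite big_nil.
  by rewrite big_nil integral_rV0; split; [exact: csupp0|].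
rewrite (_ : (fun y => _) = fun y => 1 * h i y + \sum_(i <- s) h i y); last first.
  by apply/funext => y; rewrite big_cons mul1r.
by split; [exact: csupp_lin|rewrite (integral_rV_lin _ r0)// mul1r big_cons IH2].
Qed.

Lemma integral_rV_ge0 n (h : 'rV[R]_n -> R) : (forall y, 0 <= h y) -> 0 <= integral_rV h.
Proof.
elim: n h => [|n IH] h h0; first exact: h0.
by rewrite integral_rVS; apply: Rintegral_ge0 => x _; apply: IH => y; exact: h0.
Qed.

Lemma integral_rV_gt0 n r (h : 'rV[R]_n -> R) y0 : 0 <= r -> csupp r h ->
  (forall y, 0 <= h y) -> 0 < h y0 -> 0 < integral_rV h.
Proof.
move=> r0; elim: n h y0 => [|n IH] h y0 Hh h0 hy0.
  by rewrite /= (_ : 0 = y0)//; apply/rowP => -[].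
rewrite integral_rVS; apply: (cs1_gt0 (x0 := y0 0 0) (integral_rV_cs1 r0 Hh)).
  by move=> x; apply: integral_rV_ge0 => y; exact: h0.
apply: (IH _ (@rsubmx _ 1 1 n y0)); first exact: csupp_slice.
  by move=> y; exact: h0.
by rewrite row_consK.
Qed.

Lemma csupp_partial n r (h : 'rV[R]_n -> R) k : csupp r h -> continuous (partial k h) ->
  csupp r (partial k h).
Proof.
move=> [ch h0] cD; split=> // y ry.
rewrite /partial (@near_eq_derive _ _ _ h (cst 0)); first exact: derive_cst.
apply/nbhs_ballP; exists (`|y| - r); first by rewrite /= subr_gt0.
move=> z; rewrite -ball_normE/= => yz; rewrite h0//.
have := ler_dist_dist y z; have := ler_norm (`|y| - `|z|); lra.
Qed.

(** The order of integration is never exchanged. A derivative in an inner variable is handled slice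
    by slice by induction; one in the outermost variable is moved outside the inner integrals, and
    the fundamental theorem of calculus applies to the slice integral. *)
Lemma integral_rV_partial n r (h : 'rV[R]_n -> R) k : 0 <= r -> csupp r h ->
  (forall y, derivable h y (delta_mx 0 k)) -> continuous (partial k h) ->
  integral_rV (partial k h) = 0.
Proof.
move=> r0; elim: n h k => [|n IH] h k Hh dh cD; first by case: k dh cD.
have Hp := csupp_partial Hh cD.
rewrite integral_rVS.
have [j|j] := @split_ordP 1 n k => kj; last first.
  rewrite (_ : (fun x => _) = fun=> 0); last first.
    apply/funext => x.
    rewrite -(IH (fun y => h (row_cons x y)) j (csupp_slice x Hh)).
    - congr integral_rV; apply/funext => y.
      by rewrite kj -(@partial_rowr R 1 n).
    - move=> y; apply/(@derivable_rowr R 1 n); rewrite -kj; exact: dh.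
    - have := (csupp_slice x Hp).1.
      rewrite (_ : partial j _ = fun y => partial k h (row_cons x y))//.
      by apply/funext => y; rewrite kj -(@partial_rowr R 1 n).
  by rewrite Rintegral_cst// mul0r.
apply: (cs1_derive r0 (integral_rV_cs1 r0 Hh) (integral_rV_cs1 r0 Hp)) => x.
apply: (@is_derive_estimate _ _ _ _ ((2 * r) ^+ n)) => e e0.
have := @tube R _ _ _ (fun x y => partial k h (row_cons x y)) x (@compact_ball_rV R n 0 r) _ e e0.
have L (y : 'rV[R]_n) : [set y | `|y - 0| <= r] y ->
    {for (x, y), continuous (fun z => partial k h (row_cons z.1 z.2))}.
  move=> _; apply: (@continuous_comp _ _ _ (fun z => row_cons z.1 z.2) (partial k h) (x, y)).
    exact: row_cons_continuous.
  exact: cD.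
move=> /(_ L) /nbhs_ballP[d /= d0 Hd].
have row_consD (t : R) y : row_cons (t + x) y = t *: delta_mx 0 k + row_cons x y.
  rewrite kj (@row_mx_shiftl R 1 n) /row_cons; congr (@row_mx _ 1 1 n _ _).
  by apply/rowP => i; rewrite !ord1 !mxE !eqxx/= !mulr1n ?mulr1.
apply/nbhs_ballP; exists d => // s; rewrite -ball_normE/= sub0r normrN => sd.
have -> : integral_rV (fun y => h (row_cons (s + x) y)) - integral_rV (fun y => h (row_cons x y))
   - s * integral_rV (fun y => partial k h (row_cons x y)) =
   integral_rV (fun y => (- s) * partial k h (row_cons x y) +
     ((-1) * h (row_cons x y) + h (row_cons (s + x) y))).
  rewrite (integral_rV_lin _ r0); [|exact: csupp_slice|].
    by rewrite (integral_rV_lin _ r0); [ring|exact: csupp_slice..].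
  by apply: csupp_lin; exact: csupp_slice.
apply: (integral_rV_bound r0).
  apply: csupp_lin; first exact: csupp_slice.
  by apply: csupp_lin; exact: csupp_slice.
move=> y.
have [yr|yr] := leP `|y| r; last first.
  have ry z : r < `|row_cons z y| by exact: lt_le_trans yr (norm_row_cons_r _ _).
  by rewrite !Hh.2// Hp.2// !mulr0 !addr0 normr0 mulr_ge0// ltW.
have -> : - s * partial k h (row_cons x y) + (-1 * h (row_cons x y) + h (row_cons (s + x) y)) =
  h (s *: delta_mx 0 k + row_cons x y) - h (0 *: delta_mx 0 k + row_cons x y)
   - partial k h (row_cons x y) * s.
  by rewrite row_consD scale0r add0r; ring.
apply: (@mean_value_estimate R (fun t => h (t *: delta_mx 0 k + row_cons x y))) => t ts.
split; first by apply/derivable_line; exact: dh.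
rewrite derive_line -row_consD; apply: Hd; last by rewrite /= subr0.
by rewrite -ball_normE/= opprD addrCA subrr addr0 normrN (le_lt_trans ts).
Qed.

End IntegralRV.

(** * Functions supported in a chart *)

Section Charts.
Context {R : realType} {n : nat} {M : topologicalType}.
Hypothesis hausdorffM : hausdorff_space M.
Implicit Types (p q : chart R n M) (K : set M) (u : 'rV[R]_n -> R).

Lemma open_preimage_in (S T : topologicalType) (D : set S) (f : S -> T) (B : set T) :
  open D -> open B -> (forall x, D x -> {for x, continuous f}) ->
  open [set x | D x /\ B (f x)].
Proof.
move=> oD oB cf; rewrite openE => x [Dx Bfx].
apply: filterI; first exact: (open_nbhs_nbhs (conj oD Dx)).
by apply: (cf _ Dx); exact: (open_nbhs_nbhs (conj oB Bfx)).
Qed.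

Lemma overlap_open p q : open (overlap p q).
Proof.
apply: open_preimage_in; [exact: cimg_open|exact: cdom_open|].
by move=> x Dx; exact: cinv_continuous.
Qed.

Lemma transition_img p q y : overlap p q y -> cimg q (transition p q y).
Proof. by move=> [_]; exact: cmap_img. Qed.

Lemma transition_inv p q y : overlap p q y -> cinv q (transition p q y) = cinv p y.
Proof. by move=> [_ dy]; rewrite /transition cmapK. Qed.

Definition extend p u : M -> R := (u \o cmap p) \_ (cdom p).

Lemma extendE p u x : cdom p x -> extend p u x = u (cmap p x).
Proof. by move=> px; rewrite /extend patchE mem_set. Qed.

Lemma extend_out p u x : ~ cdom p x -> extend p u x = 0.
Proof. by move=> px; rewrite /extend patchE memNset. Qed.

(** The support of a coordinate function is recorded as a subset of [M], so that the same [K] can be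
    used in several charts. *)
Definition supported p K u := forall y, cimg p y -> ~ K (cinv p y) -> u y = 0.

Lemma extend_zero p K u x : supported p K u -> ~ K x -> extend p u x = 0.
Proof.
move=> uK Kx; have [px|px] := pselect (cdom p x); last exact: extend_out.
by rewrite extendE// uK ?cmapK//; exact: cmap_img.
Qed.

Lemma continuous_near (S T : topologicalType) (f h : S -> T) x (D : set S) :
  open D -> D x -> (forall z, D z -> f z = h z) ->
  {for x, continuous f} -> {for x, continuous h}.
Proof.
move=> oD Dx fh; apply: (eq_continuous_open oD) => // z /set_mem; exact: fh.
Qed.

(** Off the chart domain, [K] being compact in a Hausdorff space is closed, and its complement is an
    open set on which the extension is identically 0. *)
Lemma extend_continuous p K u : compact K -> K `<=` cdom p -> supported p K u ->
  (forall y, cimg p y -> {for y, continuous u}) -> continuous (extend p u).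
Proof.
move=> cK Kp uK cu x; have [px|px] := pselect (cdom p x).
  apply: (@continuous_near _ _ (u \o cmap p) _ _ (cdom p)) => //; first exact: cdom_open.
    by move=> z pz; rewrite extendE.
  apply: continuous_comp; first exact: cmap_continuous.
  by apply: cu; exact: cmap_img.
apply: (@continuous_near _ _ (fun=> 0) _ _ (~` K)).
- by apply: closed_openC; exact: compact_closed.
- by move/Kp.
- by move=> z Kz; rewrite (extend_zero uK).
- exact: continuous_cst.
Qed.

Lemma image_compact_in (S T : topologicalType) (f : S -> T) (B : set S) :
  compact B -> (forall x, B x -> {for x, continuous f}) -> compact (f @` B).
Proof.
move=> cB cf; apply: continuous_compact => //.
by apply: continuous_in_subspaceT => x /set_mem; exact: cf.
Qed.

Lemma compact_cmap p K : compact K -> K `<=` cdom p -> compact (cmap p @` K).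
Proof. by move=> cK Kp; apply: image_compact_in => // x /Kp; exact: cmap_continuous. Qed.

Lemma open_cmapC p K : compact K -> K `<=` cdom p -> open (~` (cmap p @` K)).
Proof.
move=> cK Kp; apply: closed_openC; apply: compact_closed; first exact: norm_hausdorff.
exact: compact_cmap.
Qed.

Lemma cmapC_cimg p K y : K `<=` cdom p -> ~ cimg p y -> (~` (cmap p @` K)) y.
Proof. by move=> Kp py [x /Kp px xy]; apply: py; rewrite -xy; exact: cmap_img. Qed.

Lemma patch_out p K u y : supported p K u -> ~ (cmap p @` K) y -> (u \_ (cimg p)) y = 0.
Proof.
move=> uK yK; rewrite patchE; case: ifPn => // /set_mem py; apply: uK => // Ky.
by apply: yK; exists (cinv p y) => //; exact: cinvK.
Qed.

(** The chart image and the complement of the compact image of [K] are two open sets covering the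
    whole coordinate space, and the patched function vanishes on the second. *)
Lemma patch_Ck k p K u : compact K -> K `<=` cdom p -> supported p K u ->
  Ck k (cimg p) u -> Ck k setT (u \_ (cimg p)).
Proof.
move=> cK Kp uK Cu; apply: Ck_local => y _.
have [py|py] := pselect (cimg p y).
  exists (cimg p); split => //; first exact: cimg_open.
  apply: (Ck_eq _ _ Cu); first exact: cimg_open.
  by move=> z pz; rewrite patchE pz.
exists (~` (cmap p @` K)); split; [exact: open_cmapC|exact: cmapC_cimg|].
apply: (@Ck_eq _ _ _ _ (fun=> 0)); [exact: open_cmapC| |exact: Ck_cst].
by move=> z /set_mem zK; rewrite (patch_out uK).
Qed.

(** The radius depends on [K] alone: the components of a vector field supported in [K] are later
    summed under a common [csupp] bound. *)
Lemma patch_csupp p K : compact K -> K `<=` cdom p ->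
  exists2 r : R, 0 <= r & forall u, supported p K u ->
    (forall y, cimg p y -> {for y, continuous u}) -> csupp r (u \_ (cimg p)).
Proof.
move=> cK Kp; have [r [_ Hr]] := compact_bounded (compact_cmap cK Kp).
exists (`|r| + 1); first by rewrite addr_ge0.
move=> u uK cu; split=> [y|y yr]; last first.
  have r1 : r < `|r| + 1 by rewrite (le_lt_trans (ler_norm r))// ltrDl.
  by apply: (patch_out uK) => yK; have /= := Hr _ r1 _ yK; rewrite leNgt yr.
by have [+ _] := @patch_Ck 0 p K u cK Kp uK (conj cu I); exact.
Qed.

Lemma supported_partial p K u k : compact K -> supported p K u ->
  supported p K (partial k u).
Proof.
move=> cK uK y py Ky.
have oD : open [set z | cimg p z /\ (~` K) (cinv p z)].
  apply: open_preimage_in; first exact: cimg_open.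
  - by apply: closed_openC; exact: compact_closed.
  - by move=> z; exact: cinv_continuous.
rewrite /partial (@near_eq_derive _ _ _ u (cst 0)); first exact: derive_cst.
by move: (open_nbhs_nbhs (conj oD (conj py Ky))); apply: filterS => z [pz Kz]; rewrite uK.
Qed.

Lemma patch_partial p K u k y : compact K -> K `<=` cdom p -> supported p K u ->
  partial k (u \_ (cimg p)) y = ((partial k u) \_ (cimg p)) y.
Proof.
move=> cK Kp uK; have [py|py] := pselect (cimg p y).
  rewrite [RHS]patchE mem_set//; apply: near_eq_derive.
  move: (open_nbhs_nbhs (conj (@cimg_open _ _ _ p) py)); apply: filterS => z pz.
  by rewrite patchE mem_set.
rewrite [RHS]patchE memNset//.
rewrite /partial (@near_eq_derive _ _ _ _ (cst 0)); first exact: derive_cst.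
move: (open_nbhs_nbhs (conj (open_cmapC cK Kp) (cmapC_cimg Kp py))).
by apply: filterS => z zK; rewrite (patch_out uK).
Qed.

End Charts.

(** * Bump functions on the manifold *)

Section Bumps.
Context {R : realType} {n : nat} {M : topologicalType}.
Hypothesis hausdorffM : hausdorff_space M.
Context (A : oriented_atlas R n M).

Lemma smooth_continuous (f : M -> R) : smooth A f -> continuous f.
Proof.
move=> sf x; set i := chart_at A x.
have ix := @chart_atP _ _ _ A x.
apply: (@continuous_near _ _ ((fun y => f (cinv (atlas i) y)) \o cmap (atlas i)) _ _ (cdom (atlas i))) => //.
- exact: cdom_open.
- by move=> z iz /=; rewrite cmapK.
- apply: continuous_comp; first exact: cmap_continuous.
  by have [] := sf i [::] _ (cmap_img ix).
Qed.

Lemma Ck_transition k (i j : Defs.index A) l :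
  Ck k (overlap (atlas i) (atlas j)) (fun y => transition (atlas i) (atlas j) y 0 l).
Proof. by move: k; apply/smooth_onP; exact: transition_smooth. Qed.

Lemma smooth_extend (i : Defs.index A) K b : compact K -> K `<=` cdom (atlas i) ->
  supported (atlas i) K b -> smooth_on (cimg (atlas i)) b -> smooth A (extend (atlas i) b).
Proof.
move=> cK Ki bK sb j; apply/smooth_onP => k; apply: Ck_local => y jy.
have [iy|iy] := pselect (cdom (atlas i) (cinv (atlas j) y)).
  exists (overlap (atlas j) (atlas i)); split => //; first exact: overlap_open.
  apply: (@Ck_eq _ _ _ _ (b \o transition (atlas j) (atlas i))).
  - exact: overlap_open.
  - by move=> z /set_mem [jz iz]; rewrite /= extendE.
  - apply: Ck_comp; first exact: overlap_open.
    + exact: (@cimg_open _ _ _ (atlas i)).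
    + by move=> z; exact: transition_img.
    + by move=> l; exact: Ck_transition.
    + by move: k; apply/smooth_onP.
exists [set z | cimg (atlas j) z /\ (~` K) (cinv (atlas j) z)]; split.
- apply: open_preimage_in; first exact: cimg_open.
  + by apply: closed_openC; exact: compact_closed.
  + by move=> z; exact: cinv_continuous.
- by split => // /Ki.
- apply: (@Ck_eq _ _ _ _ (fun=> 0)); last exact: Ck_cst.
  + apply: open_preimage_in; first exact: cimg_open.
    * by apply: closed_openC; exact: compact_closed.
    * by move=> z; exact: cinv_continuous.
  + by move=> z /set_mem [jz Kz]; rewrite (extend_zero bK).
Qed.

Lemma exists_bump (i : Defs.index A) (U : set M) x0 : open U -> U x0 -> cdom (atlas i) x0 ->
  exists K (b : M -> R), [/\ compact K, K `<=` U `&` cdom (atlas i) &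
    [/\ smooth A b, forall x, 0 <= b x, 0 < b x0 & forall x, ~ K x -> b x = 0]].
Proof.
move=> oU Ux0 ix0; set p := atlas i in ix0 *; set y0 := cmap p x0.
have oV : open [set y | cimg p y /\ U (cinv p y)].
  apply: open_preimage_in => //; first exact: cimg_open.
  by move=> y; exact: cinv_continuous.
have Vy0 : [set y | cimg p y /\ U (cinv p y)] y0.
  by split; [exact: cmap_img|rewrite /y0 cmapK].
have [r r0 Hr] : exists2 r : R, 0 < r & forall y, `|y - y0| <= r -> cimg p y /\ U (cinv p y).
  have /nbhs_ballP[d /= d0 Hd] := open_nbhs_nbhs (conj oV Vy0).
  exists (d / 2); first by rewrite divr_gt0.
  move=> y yd; apply: Hd; rewrite -ball_normE/= distrC (le_lt_trans yd)//.
  by rewrite gtr_pMr// invf_lt1// ltr1n.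
(* Balls of the max norm are cubes, so a product of one-variable bumps is positive exactly on the
   open cube of half-side [r] around [y0]. *)
pose b (y : 'rV[R]_n) : R := \prod_(k < n) bump (r ^+ 2 - (y 0 k - y0 0 k) ^+ 2).
have b0 y : 0 <= b y by apply: prodr_ge0 => k _; exact: bump_ge0.
have by0 : 0 < b y0.
  by apply: prodr_gt0 => k _; rewrite bump_gt0 subrr expr0n subr0 exprn_gt0.
have bsupp y : ~ (`|y - y0| <= r) -> b y = 0.
  move=> yr; have [k kr] : exists k, r < `|y 0 k - y0 0 k|.
    apply: contrapT => H; apply: yr; apply: mxnorm_le; first exact: ltW.
    move=> a k; rewrite !mxE ord1 leNgt; apply/negP => rk; apply: H; by exists k.
  rewrite /b (bigD1 k)//= bump_eq0 ?mul0r// subr_le0.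
  rewrite -[leRHS]real_normK ?num_real// lerXn2r// ?nnegrE//; exact: ltW.
pose K := cinv p @` [set y | `|y - y0| <= r].
have cK : compact K.
  apply: image_compact_in; first exact: compact_ball_rV.
  by move=> y /Hr[? _]; exact: cinv_continuous.
have KU : K `<=` U `&` cdom p.
  by move=> _ [y /Hr[py Uy] <-]; split => //; exact: cinv_dom.
have bK : supported p K b.
  by move=> y py Ky; apply: bsupp => yr; apply: Ky; exists y.
exists K, (extend p b); split => //; split.
- apply: smooth_extend cK _ bK _; first by move=> x /KU[].
  apply/smooth_onP => k; apply: Ck_prod => [|l _]; first exact: cimg_open.
  apply: Ck_bump; first exact: cimg_open.
  have oI := @cimg_open _ _ _ p.
  have c1 : Ck k (cimg p) (fun y : 'rV[R]_n => y 0 l - y0 0 l).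
    by apply: CkD => //; [exact: Ck_coord|exact: Ck_cst].
  apply: (@Ck_eq _ _ _ _ (fun y => r ^+ 2 + (-1) * ((y 0 l - y0 0 l) * (y 0 l - y0 0 l)))) => //.
    by move=> y _; rewrite mulN1r -expr2.
  by apply: CkD => //; [exact: Ck_cst|apply: CkM => //; [exact: Ck_cst|exact: CkM]].
- by move=> x; rewrite /extend patchE; case: ifP => _; [exact: b0|exact: lexx].
- by rewrite extendE.
- by move=> x; exact: (extend_zero bK).
Qed.

End Bumps.

(** * Integrals of continuous functions on a compact space *)

Section CompactIntegral.
Context (R : realType) (M : ptopologicalType).
Hypothesis compactM : compact [set: M].
Variable mu : probability (borel M) R.
Implicit Types h u : M -> R.

Lemma continuous_borel_measurable h : continuous h ->
  measurable_fun [set: borel M] (h : borel M -> R).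
Proof.
move=> ch; apply: (measurability _ (measurable_realfun.RGenOpens.measurableE R)).
move=> _ [_ [a [b ->] <-]]; rewrite setTI; apply: sub_sigma_algebra.
by move/continuousP : ch; apply; exact: interval_open.
Qed.

Lemma continuous_integrable h : continuous h ->
  mu.-integrable [set: borel M] (EFin \o h).
Proof.
move=> ch; apply: measurable_bounded_integrable => //.
- by apply: le_lt_trans (probability_le1 mu measurableT) _; rewrite ltry.
- exact: continuous_borel_measurable.
- have := @continuous_compact _ _ h setT (continuous_subspaceT ch) compactM.
  move=> /compact_bounded[r [_ Hr]]; exists r; split; first exact: num_real.
  by move=> x rx y _; apply: Hr => //; exists y.
Qed.

Lemma mu_lin h u a : continuous h -> continuous u ->
  \int[mu]_x (a * h x + u x) = a * \int[mu]_x h x + \int[mu]_x u x.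
Proof.
move=> ch cu; have cah : continuous (fun x => a * h x).
  by move=> x; apply: cvgMl_tmp; exact: ch.
rewrite RintegralD//; [|exact: (continuous_integrable cah)|exact: (continuous_integrable cu)].
by rewrite RintegralZl//; exact: (continuous_integrable ch).
Qed.

Lemma muD h u : continuous h -> continuous u ->
  \int[mu]_x (h x + u x) = \int[mu]_x h x + \int[mu]_x u x.
Proof.
move=> ch cu; rewrite -[in RHS](mul1r (\int[mu]_x h x)) -mu_lin//.
by apply: eq_Rintegral => x _; rewrite mul1r.
Qed.

Lemma mu_cst (a : R) : \int[mu]_x a = a.
Proof.
rewrite Rintegral_cst// -[RHS]mulr1; congr (a * _).
exact: (congr1 fine (probability_setT mu)).
Qed.

Lemma muZ h a : continuous h -> \int[mu]_x (a * h x) = a * \int[mu]_x h x.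
Proof.
move=> ch; have c0 : continuous (fun _ : M => 0 : R) by move=> x; exact: continuous_cst.
have := @mu_lin h (fun=> 0) a ch c0.
by rewrite mu_cst addr0 => <-; apply: eq_Rintegral => x _; rewrite addr0.
Qed.

Lemma mu_bound h e : continuous h -> (forall x, `|h x| <= e) -> `|\int[mu]_x h x| <= e.
Proof.
move=> ch he; apply: le_trans (le_normr_Rintegral _ _) _ => //.
  exact: (continuous_integrable ch).
rewrite -[leRHS]mu_cst; apply: le_Rintegral => //.
- apply: (@continuous_integrable (fun x => `|h x|)) => x.
  by apply: (continuous_comp (ch x)); exact: norm_continuous.
- by apply: (@continuous_integrable (fun=> e)) => x; exact: continuous_cst.
Qed.

End CompactIntegral.

(** * Determinants of positive definite matrices *)

Section PosDef.
Context {R : rcfType}.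

(* The determinant does not vanish on the segment from [1%:M] to [S]. *)
Lemma posdef_det_gt0 n (S : 'M[R]_n) :
  (forall v : 'rV[R]_n, v != 0 -> 0 < (v *m S *m v^T) 0 0) -> 0 < \det S.
Proof.
move=> Spos.
pose Q (t : R) := t *: S + (1 - t) *: 1%:M.
have Q0 t : 0 <= t <= 1 -> \det (Q t) != 0.
  move=> /andP[t0 t1]; apply/negP => /det0P[v v0 Hv].
  have : (v *m Q t *m v^T) 0 0 = 0 by rewrite Hv mul0mx mxE.
  rewrite mulmxDr -!scalemxAr mulmx1 mulmxDl -!scalemxAl !mxE => /eqP.
  have vv : 0 < (v *m v^T) 0 0.
    rewrite mxE; have [k vk] : exists k, v 0 k != 0.
      by apply/existsP; apply: contraNT v0 => /existsPn H; apply/eqP/rowP => k;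
        rewrite mxE; apply/eqP; have := H k; rewrite negbK.
    rewrite (bigD1 k)//= ltr_wpDr// ?mxE.
      by apply: sumr_ge0 => l _; rewrite mxE -expr2 sqr_ge0.
    by rewrite -expr2 exprn_even_gt0.
  have := Spos v v0; rewrite !mxE in vv * => h1; rewrite gt_eqF//.
  have [->|t0'] := eqVneq t 0; first by rewrite mul0r add0r subr0 mul1r.
  have tpos : 0 < t by rewrite lt_def t0'.
  by apply: ltr_pwDl; [exact: mulr_gt0|apply: mulr_ge0; [rewrite subr_ge0|exact: ltW]].
(* Along the segment the determinant is a polynomial in the parameter. A nonpositive value at 1
   would, with the value 1 at 0, force a root in between. *)
pose P : {poly R} := \det (\matrix_(i, j) ((S i j)%:P * 'X + ((i == j)%:R)%:P * (1 - 'X))).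
have PE t : P.[t] = \det (Q t).
  rewrite /P -[LHS]/(horner_eval t _) -det_map_mx; congr (\det _).
  apply/matrixP => i j; rewrite !mxE -[LHS]/(horner _ t) !hornerE mulrC; congr (_ + _).
  by rewrite mulrC.
have P0 : 0 < P.[0] by rewrite PE /Q scale0r add0r subr0 scale1r det1.
have <- : P.[1] = \det S by rewrite PE /Q subrr scale0r addr0 scale1r.
rewrite ltNge; apply/negP => P1.
have [||t t01 /rootP Pt] := @poly_ivt R (- P) 0 1; first exact: ler01.
  by rewrite !hornerN oppr_le0 oppr_ge0 (ltW P0) P1.
have := Q0 t t01; rewrite -PE; move: Pt; rewrite hornerN => /eqP.
by rewrite oppr_eq0 => ->.
Qed.

End PosDef.

Section LocalSmooth.
Context {R : realType}.

Lemma Ck_det k n m (U : set 'rV[R]_n) (B : 'rV[R]_n -> 'M[R]_m) : open U ->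
  (forall i j, Ck k U (fun y => B y i j)) -> Ck k U (fun y => \det (B y)).
Proof.
move=> oU HB; apply: Ck_sum => // s _; apply: CkM => //; first exact: Ck_cst.
by apply: Ck_prod => // i _; exact: HB.
Qed.

Lemma Ck_invmx k n m (U : set 'rV[R]_n) (B : 'rV[R]_n -> 'M[R]_m) i j : open U ->
  (forall y, U y -> \det (B y) != 0) ->
  (forall i j, Ck k U (fun y => B y i j)) -> Ck k U (fun y => invmx (B y) i j).
Proof.
move=> oU B0 HB.
(* Cramer's rule; [invmx] is defined by cases on invertibility, so the two sides are compared only
   on [U]. *)
apply: (@Ck_eq _ _ _ _ (fun y => (\det (B y))^-1 *
   ((-1) ^+ (j + i) * \det (row' j (col' i (B y)))))) => //.
  by move=> y /set_mem Uy; rewrite /invmx unitmxE unitfE B0// !mxE.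
apply: CkM => //; first by apply: CkV => //; exact: Ck_det.
apply: CkM => //; first exact: Ck_cst.
apply: Ck_det => // a b; apply: (@Ck_eq _ _ _ _ (fun y => B y (lift j a) (lift i b))) => //.
by move=> y _; rewrite !mxE.
Qed.

End LocalSmooth.

(** * Green's formula *)

Section Riemannian.
Context {R : realType} {n : nat} {M : ptopologicalType}.
Context {A : oriented_atlas R n M} (g : riemannian_metric A).
Implicit Types (i j : Defs.index A) (phi psi : 'rV[R]_n -> R).

Lemma gram_det_gt0 i y : cimg (atlas i) y -> 0 < \det (gram g i y).
Proof. by move=> iy; apply: posdef_det_gt0; exact: gram_posdef. Qed.

Lemma gram_unit i y : cimg (atlas i) y -> gram g i y \in unitmx.
Proof. by move=> iy; rewrite unitmxE unitfE gt_eqF// gram_det_gt0. Qed.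

Lemma Ck_gram k i a b : Ck k (cimg (atlas i)) (fun y => gram g i y a b).
Proof. by move: k; apply/smooth_onP; exact: gram_smooth. Qed.

Lemma vol_density_gt0 i y : cimg (atlas i) y -> 0 < vol_density g i y.
Proof. by move=> iy; rewrite sqrtr_gt0 gram_det_gt0. Qed.

Lemma Ck_vol_density k i : Ck k (cimg (atlas i)) (vol_density g i).
Proof.
have o := @cimg_open _ _ _ (@atlas _ _ _ A i).
apply: Ck_sqrt => //; first by move=> y; exact: gram_det_gt0.
by apply: Ck_det => // a b; exact: Ck_gram.
Qed.

Lemma Ck_inv_gram k i a b : Ck k (cimg (atlas i)) (fun y => invmx (gram g i y) a b).
Proof.
have o := @cimg_open _ _ _ (@atlas _ _ _ A i).
apply: Ck_invmx => //; first by move=> y iy; rewrite gt_eqF// gram_det_gt0.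
by move=> c d; exact: Ck_gram.
Qed.

Definition drow phi (y : 'rV[R]_n) : 'rV[R]_n := \row_l partial l phi y.

Definition coord_grad i phi (y : 'rV[R]_n) : 'rV[R]_n :=
  drow phi y *m invmx (gram g i y).

(** In [grad phi G (grad psi)^T] the Gram matrix [G] cancels the inverse contained in one of the
    gradients, leaving a gradient paired with a differential. *)
Definition coord_dot i phi psi (y : 'rV[R]_n) : R :=
  (coord_grad i phi y *m (drow psi y)^T) 0 0.

Definition coord_lap i phi (y : 'rV[R]_n) : R :=
  (vol_density g i y)^-1 *
    \sum_(k < n) partial k (fun z => vol_density g i z * coord_grad i phi z 0 k) y.

Lemma coord_gradE i phi y k :
  coord_grad i phi y 0 k = \sum_(l < n) partial l phi y * invmx (gram g i y) l k.
Proof. by rewrite mxE; apply: eq_bigr => l _; rewrite mxE. Qed.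

Lemma coord_dotE i phi psi y :
  coord_dot i phi psi y = \sum_(k < n) coord_grad i phi y 0 k * partial k psi y.
Proof. by rewrite /coord_dot mxE; apply: eq_bigr => l _; rewrite !mxE. Qed.

Lemma Ck_coord_grad k i phi l : Ck k.+1 (cimg (atlas i)) phi ->
  Ck k (cimg (atlas i)) (fun y => coord_grad i phi y 0 l).
Proof.
move=> Hphi; have o := @cimg_open _ _ _ (@atlas _ _ _ A i).
apply: (@Ck_eq _ _ _ _ (fun y => \sum_(m < n) partial m phi y * invmx (gram g i y) m l)) => //.
  by move=> y _; rewrite coord_gradE.
by apply: Ck_sum => // m _; apply: CkM => //; [exact: Ck_partial Hphi|exact: Ck_inv_gram].
Qed.

(** The gradient as a vector density: its plain coordinate divergence is the volume density times
    the Laplacian. *)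
Definition flux i phi (l : 'I_n) (y : 'rV[R]_n) : R :=
  vol_density g i y * coord_grad i phi y 0 l.

Lemma coord_lapE i phi y :
  coord_lap i phi y = (vol_density g i y)^-1 * \sum_(k < n) partial k (flux i phi k) y.
Proof. by []. Qed.

Lemma Ck_flux k i phi l : Ck k.+1 (cimg (atlas i)) phi ->
  Ck k (cimg (atlas i)) (flux i phi l).
Proof.
move=> H; have o := @cimg_open _ _ _ (@atlas _ _ _ A i).
by apply: CkM => //; [exact: Ck_vol_density|exact: Ck_coord_grad].
Qed.

Lemma Ck_coord_lap k i phi : Ck k.+2 (cimg (atlas i)) phi ->
  Ck k (cimg (atlas i)) (coord_lap i phi).
Proof.
move=> H; have o := @cimg_open _ _ _ (@atlas _ _ _ A i).
apply: CkM => //.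
  by apply: CkV => //; [move=> y iy; rewrite gt_eqF// vol_density_gt0|exact: Ck_vol_density].
by apply: Ck_sum => // m _; exact: (Ck_partial m (Ck_flux m H)).
Qed.

Lemma Ck_coord_dot k i phi psi : Ck k.+1 (cimg (atlas i)) phi ->
  Ck k.+1 (cimg (atlas i)) psi -> Ck k (cimg (atlas i)) (coord_dot i phi psi).
Proof.
move=> H1 H2; have o := @cimg_open _ _ _ (@atlas _ _ _ A i).
apply: (@Ck_eq _ _ _ _ (fun y => \sum_(k < n) coord_grad i phi y 0 k * partial k psi y)) => //.
  by move=> y _; rewrite coord_dotE.
by apply: Ck_sum => // m _; apply: CkM => //; [exact: Ck_coord_grad|exact: Ck_partial H2].
Qed.

Definition local_rep i (f : M -> R) (y : 'rV[R]_n) : R := f (cinv (atlas i) y).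

Lemma Ck_local_rep k i f : smooth A f -> Ck k (cimg (atlas i)) (local_rep i f).
Proof. by move=> sf; move: k; apply/smooth_onP; exact: sf. Qed.

Lemma drow_transition i j f y : smooth A f -> overlap (atlas i) (atlas j) y ->
  drow (local_rep i f) y =
  drow (local_rep j f) (transition (atlas i) (atlas j) y)
    *m ('J (transition (atlas i) (atlas j)) y)^T.
Proof.
move=> sf oy; set tau := transition _ _.
have oo := @overlap_open _ _ _ (atlas i) (atlas j).
have dt l : differentiable (fun z => tau z 0 l : R) y.
  by apply: (@Ck_differentiable _ 0 _ _ _ _ oo oy); exact: Ck_transition.
have df : differentiable (local_rep j f) (tau y).
  apply: (@Ck_differentiable _ 0 _ (cimg (atlas j))); first exact: cimg_open.
    exact: transition_img.
  exact: Ck_local_rep.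
apply/rowP => k; rewrite mxE [RHS]mxE.
have -> : partial k (local_rep i f) y = partial k (local_rep j f \o tau) y.
  apply: near_eq_derive; move: (open_nbhs_nbhs (conj oo oy)); apply: filterS => z oz.
  by rewrite /local_rep /= /tau transition_inv.
have [_] := derive_comp (delta_mx 0 k) dt df; rewrite /partial => ->.
by apply: eq_bigr => l _; rewrite [drow _ _ _ _]mxE [(_^T) _ _]mxE (jacobianE _ _ dt) mulrC.
Qed.

Lemma coord_dot_transition i j f h y : smooth A f -> smooth A h ->
  overlap (atlas i) (atlas j) y ->
  coord_dot i (local_rep i f) (local_rep i h) y =
  coord_dot j (local_rep j f) (local_rep j h) (transition (atlas i) (atlas j) y).
Proof.
move=> sf sh oy; rewrite /coord_dot /coord_grad !(drow_transition _ oy)//.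
have uG : gram g i y \in unitmx by apply: gram_unit; have [] := oy.
have := gram_transition g oy => /= E; rewrite {}E in uG *.
move: uG; set tau := transition _ _; set J := 'J tau y; set G := gram g j _.
(* The Gram matrix in chart [i] is invertible and equals [J G J^T], so all three factors are. The
   Jacobians then cancel between the differentials and the inverse of this product. *)
move=> uG; have [uJG uJT] : J *m G \in unitmx /\ J^T \in unitmx by apply/andP; rewrite -unitmx_mul.
move: (uJG); rewrite unitmx_mul => /andP[uJ uGj].
congr (fun_of_matrix _ 0 0); rewrite trmx_mul trmxK -!mulmxA; congr (_ *m _).
rewrite !mulmxA; congr (_ *m _).
suff -> : invmx (J *m G *m J^T) = invmx J^T *m invmx G *m invmx J.
  by rewrite !mulmxA mulmxV// mul1mx -mulmxA mulVmx// mulmx1.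
apply: (can_inj (mulKmx uG)); rewrite mulmxV// !mulmxA.
by rewrite mulmxK// mulmxK// mulmxV.
Qed.

Lemma grad_normsqE f x :
  grad_normsq g f x =
  coord_dot (chart_at A x) (local_rep (chart_at A x) f) (local_rep (chart_at A x) f)
    (cmap (atlas (chart_at A x)) x).
Proof.
rewrite /grad_normsq; set i := chart_at A x; set y := cmap _ x.
have uG : gram g i y \in unitmx by apply: gram_unit; apply: cmap_img; exact: chart_atP.
have -> : local_grad g i f y = drow (local_rep i f) y *m invmx (gram g i y) by [].
rewrite /coord_dot /coord_grad; set D := drow _ _.
rewrite mulmxKV//; set X := D *m invmx _.
have -> : D *m X^T = (X *m D^T)^T by rewrite (trmx_mul X) trmxK.
by rewrite mxE.
Qed.

End Riemannian.

(** * Positivity of the measure, and Green's formula inside a chart *)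

Section Green.
Context {R : realType} {n : nat} {M : ptopologicalType}.
Hypothesis hausdorffM : hausdorff_space M.
Hypothesis compactM : compact [set: M].
Context {A : oriented_atlas R n M} (g : riemannian_metric A).
Variable mu : probability (borel M) R.
Hypothesis volmu : normalized_volume g mu.
Implicit Types (i j : Defs.index A) (phi psi u : 'rV[R]_n -> R) (f h : M -> R) (K : set M).

Lemma extend_integral : exists2 c : R, 0 < c &
  forall i K u, compact K -> K `<=` cdom (atlas i) -> supported (atlas i) K u ->
    (forall y, cimg (atlas i) y -> {for y, continuous u}) ->
    \int[mu]_x extend (atlas i) u x =
    c * integral_rV ((fun y => u y * vol_density g i y) \_ (cimg (atlas i))).
Proof.
have [c c0 Hc] := volmu; exists c => // i K u cK Ki uK cu.
rewrite (Hc i); [|exact: extend_continuous cK Ki uK cu|].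
  congr (_ * integral_rV _); apply/funext => y; rewrite !patchE.
  case: ifPn => // /set_mem iy.
  by rewrite extendE ?cinvK//; exact: cinv_dom.
exists K; split => // x Kx; exact: (extend_zero uK).
Qed.

Lemma continuous_bounded f : continuous f -> exists2 B : R, 0 < B & forall x, `|f x| <= B.
Proof.
move=> cf; have := @continuous_compact _ _ f setT (continuous_subspaceT cf) compactM.
move=> /compact_bounded[r [_ Hr]]; exists (`|r| + 1); first by rewrite ltr_wpDl.
move=> x; apply: (Hr (`|r| + 1)); last by exists x.
by rewrite (le_lt_trans (ler_norm r))// ltrDl.
Qed.

Lemma supported_local_rep i K f : (forall x, ~ K x -> f x = 0) ->
  supported (atlas i) K (local_rep i f).
Proof. by move=> fK y iy Ky; exact: fK. Qed.

Lemma continuous_local_rep i f y : continuous f -> cimg (atlas i) y ->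
  {for y, continuous (local_rep i f)}.
Proof.
move=> cf iy; apply: (@continuous_comp _ _ _ (cinv (atlas i)) f); last exact: cf.
exact: cinv_continuous.
Qed.

(** The explicit formula for [mu] reaches only functions supported in a chart. So [f] is multiplied
    by a bump [b], whose product with [f] has positive integral, and compared through
    [f b <= B f]. *)
Lemma mu_gt0 f x0 : continuous f -> (forall x, 0 <= f x) -> 0 < f x0 ->
  0 < \int[mu]_x f x.
Proof.
move=> cf f0 fx0; set i := chart_at A x0.
have ix0 : cdom (atlas i) x0 := chart_atP A x0.
have [K [b [cK KU [sb b0 bx0 bK]]]] :=
  exists_bump hausdorffM openT (I : [set: M] x0) ix0.
have cb := smooth_continuous sb.
have [B B0 HB] := continuous_bounded cb.
have cfb : continuous (fun x => f x * b x).
  by move=> x; apply: cvgM; [exact: cf|exact: cb].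
have Ki : K `<=` cdom (atlas i) by move=> x /KU[].
have fbK : forall x, ~ K x -> f x * b x = 0 by move=> x /bK ->; rewrite mulr0.
have sK := @supported_local_rep i K _ fbK.
have cl y : cimg (atlas i) y -> {for y, continuous (local_rep i (fun x => f x * b x))}.
  exact: continuous_local_rep.
have E : (fun x => f x * b x) = extend (atlas i) (local_rep i (fun x => f x * b x)).
  apply/funext => x; have [ix|ix] := pselect (cdom (atlas i) x).
    by rewrite extendE// /local_rep cmapK.
  by rewrite extend_out// fbK// => /Ki.
have pos : 0 < \int[mu]_x (f x * b x).
  have [c c0 Hc] := extend_integral; rewrite E (Hc _ _ _ cK Ki sK cl).
  have cv y : cimg (atlas i) y -> {for y, continuous (vol_density g i)}.
    by move=> iy; exact: (Ck_continuous (Ck_vol_density g 0 i) iy).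
  have [r r0 Hr] := patch_csupp cK Ki.
  rewrite mulr_gt0//; apply: (@integral_rV_gt0 _ _ r _ (cmap (atlas i) x0) r0).
  - apply: Hr; first by move=> y iy Ky; rewrite sK// mul0r.
    by move=> y iy; apply: continuousM; [exact: (cl _ iy)|exact: (cv _ iy)].
  - move=> y; rewrite patchE; case: ifPn => // /set_mem iy.
    rewrite /local_rep mulr_ge0//; last exact/ltW/vol_density_gt0.
    by rewrite mulr_ge0.
  - have iy := cmap_img ix0; rewrite patchE mem_set// /local_rep cmapK//.
    by rewrite !mulr_gt0// vol_density_gt0.
have : \int[mu]_x (f x * b x) <= B * \int[mu]_x f x.
  rewrite -(muZ compactM mu B cf); apply: le_Rintegral => //.
  - exact: (continuous_integrable compactM mu cfb).
  - apply: (@continuous_integrable _ _ compactM mu (fun x => B * f x)) => x.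
    by apply: cvgMl_tmp; exact: cf.
  - move=> x _; rewrite mulrC ler_wpM2r//.
    by rewrite (le_trans _ (HB x))// ler_norm.
by move=> /(lt_le_trans pos); rewrite pmulr_rgt0.
Qed.

Lemma mu_eq0 f : continuous f -> (forall x, 0 <= f x) -> \int[mu]_x f x = 0 ->
  forall x, f x = 0.
Proof.
move=> cf f0 If x; apply/eqP; rewrite eq_le f0 andbT leNgt; apply/negP => fx.
by have := mu_gt0 cf f0 fx; rewrite If ltxx.
Qed.

(** In coordinates, the divergence of the vector field [psi grad phi]. *)
Definition green_form i phi psi y := coord_lap g i phi y * psi y + coord_dot g i phi psi y.

Lemma supported_green_form i K phi psi : compact K -> supported (atlas i) K psi ->
  supported (atlas i) K (green_form i phi psi).
Proof.
move=> cK sK y iy Ky; rewrite /green_form sK// mulr0 add0r coord_dotE big1// => k _.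
by rewrite (supported_partial hausdorffM k cK sK)// mulr0.
Qed.

Lemma Ck_green_form k i phi psi : Ck k.+2 (cimg (atlas i)) phi ->
  Ck k.+1 (cimg (atlas i)) psi -> Ck k (cimg (atlas i)) (green_form i phi psi).
Proof.
move=> Hphi Hpsi; have o := @cimg_open _ _ _ (@atlas _ _ _ A i).
apply: CkD => //; last by apply: Ck_coord_dot => //; exact: CkW.
by apply: CkM => //; [exact: Ck_coord_lap|exact: CkW].
Qed.

Lemma green_local i K phi psi : compact K -> K `<=` cdom (atlas i) ->
  supported (atlas i) K psi ->
  Ck 2 (cimg (atlas i)) phi -> Ck 1 (cimg (atlas i)) psi ->
  \int[mu]_x extend (atlas i) (green_form i phi psi) x = 0.
Proof.
move=> cK Ki sK Hphi Hpsi; have o := @cimg_open _ _ _ (@atlas _ _ _ A i).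
have cG y : cimg (atlas i) y -> {for y, continuous (green_form i phi psi)}.
  by move=> iy; exact: (Ck_continuous (Ck_green_form (k := 0) Hphi Hpsi) iy).
have [c c0 Hc] := extend_integral.
rewrite (Hc _ _ _ cK Ki (supported_green_form phi cK sK) cG).
have [r r0 Hr] := patch_csupp cK Ki.
pose Z k y := flux g i phi k y * psi y.
have CZ k : Ck 1 (cimg (atlas i)) (Z k) by apply: CkM => //; exact: Ck_flux.
have sZ k : supported (atlas i) K (Z k) by move=> y iy Ky; rewrite /Z sK// mulr0.
have CP k : Ck 1 setT (Z k \_ (cimg (atlas i))) by exact: (patch_Ck cK Ki (sZ k)).
have csZ k : csupp r (Z k \_ (cimg (atlas i))).
  by apply: Hr => // y; exact: (Ck_continuous (CZ k)).
have cP k : continuous (partial k (Z k \_ (cimg (atlas i)))).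
  by move=> y; exact: (Ck_continuous (Ck_partial k (CP k)) I).
have csP k := csupp_partial (csZ k) (cP k).
(* By the Leibniz rule the integrand times the density is a sum of partial derivatives of the
   compactly supported functions [flux * psi], each of which integrates to 0. *)
have -> : (fun y => green_form i phi psi y * vol_density g i y) \_ (cimg (atlas i)) =
   fun y => \sum_(k <- enum 'I_n) partial k (Z k \_ (cimg (atlas i))) y.
  apply/funext => y; under eq_bigr do rewrite (patch_partial _ _ cK Ki (sZ _)).
  rewrite patchE; case: ifPn => [/set_mem iy|iy]; last first.
    by rewrite big1// => k _; rewrite patchE (negbTE iy).
  under eq_bigr do rewrite patchE mem_set//.
  rewrite big_enum /green_form coord_dotE coord_lapE.
  have v0 : vol_density g i y != 0 by rewrite gt_eqF// vol_density_gt0.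
  set S1 := \sum_(k < n) _; set S2 := \sum_(k < n) _.
  have -> : ((vol_density g i y)^-1 * S1 * psi y + S2) * vol_density g i y =
    S1 * psi y + S2 * vol_density g i y by field.
  rewrite !mulr_suml -big_split/=; apply: eq_bigr => k _.
  have dF := Ck_derivable (j := k) (Ck_flux g k Hphi) iy.
  have dpsi := Ck_derivable (j := k) Hpsi iy.
  by rewrite (partialM dF dpsi) /flux; ring.
have [_ ->] := integral_rV_sum (enum 'I_n) r0 csP.
rewrite big1 ?mulr0// => k _; apply: (integral_rV_partial r0 (csZ k)) => //.
by move=> y; exact: (Ck_derivable (CP k) I).
Qed.

End Green.

Section SmoothFunctions.
Context {R : realType} {n : nat} {M : topologicalType} {A : oriented_atlas R n M}.
Implicit Types f h : M -> R.

Lemma smoothP f : smooth A f <->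
  forall k (i : Defs.index A), Ck k (cimg (atlas i)) (fun y => f (cinv (atlas i) y)).
Proof.
split=> [sf k i|sf i]; first by move: k; apply/smooth_onP; exact: sf.
by apply/smooth_onP => k; exact: sf.
Qed.

Lemma smooth_cst (a : R) : smooth A (fun=> a).
Proof. by apply/smoothP => k i; exact: Ck_cst. Qed.

Lemma smoothD f h : smooth A f -> smooth A h -> smooth A (fun x => f x + h x).
Proof.
move=> /smoothP sf /smoothP sh; apply/smoothP => k i.
by apply: CkD; [exact: cimg_open|exact: sf|exact: sh].
Qed.

Lemma smoothM f h : smooth A f -> smooth A h -> smooth A (fun x => f x * h x).
Proof.
move=> /smoothP sf /smoothP sh; apply/smoothP => k i.
by apply: CkM; [exact: cimg_open|exact: sf|exact: sh].
Qed.

Lemma smoothZ f (a : R) : smooth A f -> smooth A (fun x => a * f x).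
Proof. by move=> sf; exact: (smoothM (smooth_cst a) sf). Qed.

Lemma smoothB f h : smooth A f -> smooth A h -> smooth A (fun x => f x - h x).
Proof.
move=> sf sh; rewrite (_ : (fun x => _) = fun x => f x + (-1) * h x); last first.
  by apply/funext => x; rewrite mulN1r.
exact: (smoothD sf (smoothZ (-1) sh)).
Qed.

Lemma smoothV f : (forall x, f x != 0) -> smooth A f -> smooth A (fun x => (f x)^-1).
Proof.
move=> f0 /smoothP sf; apply/smoothP => k i.
by apply: CkV; [exact: cimg_open|move=> y _; exact: f0|exact: sf].
Qed.

Lemma smooth_sum (I : Type) (s : seq I) (b : I -> M -> R) :
  (forall i, smooth A (b i)) -> smooth A (fun x => \sum_(i <- s) b i x).
Proof.
move=> sb; apply/smoothP => k i; apply: Ck_sum; first exact: cimg_open.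
by move=> j _; have /smoothP := sb j; exact.
Qed.

End SmoothFunctions.

(** * Chart independence of the Laplacian, and Green's formula on the manifold *)

Section GlobalGreen.
Context {R : realType} {n : nat} {M : ptopologicalType}.
Hypothesis hausdorffM : hausdorff_space M.
Hypothesis compactM : compact [set: M].
Context {A : oriented_atlas R n M} (g : riemannian_metric A).
Variable mu : probability (borel M) R.
Hypothesis volmu : normalized_volume g mu.
Implicit Types (i j : Defs.index A) (f h : M -> R) (K : set M).

(** The chart is a parameter, so the expression is visibly continuous on the chart domain;
    [laplacian], which changes chart with the point, is not until all charts are known to agree. *)
Definition chart_lap i f x := coord_lap g i (local_rep i f) (cmap (atlas i) x).

Definition chart_dot i f h x :=
  coord_dot g i (local_rep i f) (local_rep i h) (cmap (atlas i) x).

Definition grad_dot f h x := chart_dot (chart_at A x) f h x.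

Lemma overlap_cmap i j x : cdom (atlas i) x -> cdom (atlas j) x ->
  overlap (atlas i) (atlas j) (cmap (atlas i) x) /\
  transition (atlas i) (atlas j) (cmap (atlas i) x) = cmap (atlas j) x.
Proof.
by move=> ix jx; rewrite /overlap /transition /= cmapK//; split=> //; split=> //; exact: cmap_img.
Qed.

Lemma chart_dot_eq i j f h x : smooth A f -> smooth A h ->
  cdom (atlas i) x -> cdom (atlas j) x -> chart_dot i f h x = chart_dot j f h x.
Proof.
move=> sf sh ix jx; have [oy E] := overlap_cmap ix jx.
by rewrite /chart_dot (coord_dot_transition g sf sh oy) E.
Qed.

Lemma grad_dotE i f h x : smooth A f -> smooth A h -> cdom (atlas i) x ->
  grad_dot f h x = chart_dot i f h x.
Proof. by move=> sf sh ix; apply: chart_dot_eq => //; exact: chart_atP. Qed.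

Lemma grad_normsq_dot f x : grad_normsq g f x = grad_dot f f x.
Proof. exact: grad_normsqE. Qed.

Lemma continuous_chart_lap i f x : smooth A f -> cdom (atlas i) x ->
  {for x, continuous (chart_lap i f)}.
Proof.
move=> sf ix; apply: (@continuous_comp _ _ _ (cmap (atlas i)) (coord_lap g i (local_rep i f))).
  exact: cmap_continuous.
apply: (Ck_continuous (Ck_coord_lap (k := 0) g (Ck_local_rep 2 i sf))).
exact: cmap_img.
Qed.

(* Both chart expressions represent the same functional on test functions
   supported in the overlap, by [green_local] and the invariance of the
   pairing of gradients; positivity of the measure then separates them. *)
Lemma chart_lap_le i j f x : smooth A f -> cdom (atlas i) x -> cdom (atlas j) x ->
  chart_lap i f x <= chart_lap j f x.
Proof.
move=> sf ix jx; rewrite leNgt; apply/negP => ltij.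
(* A bump inside this open set makes the difference of the two Green integrands nonnegative
   everywhere and positive at [x], whereas both have integral 0. *)
pose U := [set z | (cdom (atlas i) `&` cdom (atlas j)) z /\
  [set t : R | 0 < t] (chart_lap i f z - chart_lap j f z)].
have oU : open U.
  apply: open_preimage_in.
  - by apply: openI; exact: cdom_open.
  - exact: open_gt.
  - by move=> z [iz jz]; apply: continuous_sub; exact: continuous_chart_lap.
have Ux : U x by split => //=; rewrite subr_gt0.
have [K [b [cK KU [sb b0 bx bK]]]] := exists_bump hausdorffM oU Ux ix.
have Ki : K `<=` cdom (atlas i) by move=> z /KU[].
have Kj : K `<=` cdom (atlas j) by move=> z /KU[[[]]].
have G k : K `<=` cdom (atlas k) ->
  continuous (extend (atlas k) (green_form g k (local_rep k f) (local_rep k b))) /\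
  \int[mu]_z extend (atlas k) (green_form g k (local_rep k f) (local_rep k b)) z = 0.
  move=> Kk; have sK := @supported_local_rep R n M A k K b bK.
  have sG := supported_green_form hausdorffM g (local_rep k f) cK sK.
  split; last first.
    by apply: (green_local hausdorffM volmu cK Kk sK); exact: Ck_local_rep.
  apply: (extend_continuous hausdorffM cK Kk sG) => y ky.
  apply: (Ck_continuous (Ck_green_form (k := 0) g _ _) ky); exact: Ck_local_rep.
have [ci Ii] := G i Ki; have [cj Ij] := G j Kj.
set Ei := extend _ _ in ci Ii; set Ej := extend _ _ in cj Ij.
(* The gradient pairings agree and cancel, which leaves the bump times the difference of the
   Laplacians. Off [K] the chart expressions may have no meaning, hence the default value 0. *)
have E z : Ei z - Ej z = b z * (if `[< K z >] then chart_lap i f z - chart_lap j f z else 0).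
  have [Kz|Kz] := pselect (K z).
    have iz := Ki z Kz; have jz := Kj z Kz.
    rewrite asboolT// /Ei /Ej !extendE// /green_form -!/(chart_lap _ _ _) -!/(chart_dot _ _ _ _).
    by rewrite (chart_dot_eq sf sb iz jz) /local_rep !cmapK//; ring.
  by rewrite bK// mul0r /Ei /Ej !(@extend_zero _ _ _ _ K) ?subrr//;
    apply: supported_green_form => //; exact: supported_local_rep.
have cE : continuous (fun z => Ei z - Ej z).
  by move=> z; apply: continuous_sub; [exact: ci|exact: cj].
have E0 z : 0 <= Ei z - Ej z.
  rewrite E; case: asboolP => [/KU[[_ /ltW ?] _]|_]; last by rewrite mulr0.
  by rewrite mulr_ge0.
have Kx : K x by apply: contrapT => /bK bx0; rewrite bx0 ltxx in bx.
have Ex : 0 < Ei x - Ej x by rewrite E asboolT// mulr_gt0// subr_gt0.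
have := mu_gt0 hausdorffM compactM volmu cE E0 Ex.
rewrite (@eq_Rintegral _ _ _ mu _ (fun z => (-1) * Ej z + Ei z)); last first.
  by move=> z _; rewrite mulN1r addrC.
by rewrite (mu_lin compactM mu _ cj ci) Ii Ij mulr0 addr0 ltxx.
Qed.

Lemma laplacianE i f x : smooth A f -> cdom (atlas i) x ->
  laplacian g f x = chart_lap i f x.
Proof.
move=> sf ix; have jx := @chart_atP _ _ _ A x.
apply/eqP; rewrite eq_le; apply/andP; split.
- exact: (@chart_lap_le (chart_at A x) i).
- exact: (@chart_lap_le i (chart_at A x)).
Qed.

Lemma smooth_laplacian f : smooth A f -> smooth A (laplacian g f).
Proof.
move=> sf; apply/smoothP => k i.
apply: (@Ck_eq _ _ _ _ (coord_lap g i (local_rep i f))); first exact: cimg_open.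
  move=> y /set_mem iy; rewrite (@laplacianE i)//; last exact: cinv_dom.
  by rewrite /chart_lap cinvK.
by apply: Ck_coord_lap; exact: Ck_local_rep.
Qed.

Lemma smooth_grad_dot f h : smooth A f -> smooth A h -> smooth A (grad_dot f h).
Proof.
move=> sf sh; apply/smoothP => k i.
apply: (@Ck_eq _ _ _ _ (coord_dot g i (local_rep i f) (local_rep i h))); first exact: cimg_open.
  move=> y /set_mem iy; rewrite (@grad_dotE i)//; last exact: cinv_dom.
  by rewrite /chart_dot cinvK.
by apply: Ck_coord_dot; exact: Ck_local_rep.
Qed.

Lemma grad_dotC f h x : grad_dot f h x = grad_dot h f x.
Proof.
rewrite /grad_dot /chart_dot /coord_dot /coord_grad; set i := chart_at A x; set y := cmap _ x.
set G := gram g i y; set D := drow _ _; set E := drow _ _.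
have GT : (invmx G)^T = invmx G.
  by rewrite trmx_inv gram_sym//; apply: cmap_img; exact: chart_atP.
have -> : D *m invmx G *m E^T = (E *m invmx G *m D^T)^T by rewrite !trmx_mul trmxK GT mulmxA.
by rewrite mxE.
Qed.

Lemma grad_dotDr f h1 h2 x : smooth A f -> smooth A h1 -> smooth A h2 ->
  grad_dot f (fun z => h1 z + h2 z) x = grad_dot f h1 x + grad_dot f h2 x.
Proof.
move=> sf s1 s2; rewrite /grad_dot /chart_dot; set i := chart_at A x; set y := cmap _ x.
have iy : cimg (atlas i) y by apply: cmap_img; exact: chart_atP.
rewrite !coord_dotE -big_split/=; apply: eq_bigr => k _; rewrite -mulrDr; congr (_ * _).
by apply: partialD; apply: Ck_derivable iy; [exact: (Ck_local_rep 1 i s1)|exact: (Ck_local_rep 1 i s2)].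
Qed.

Lemma grad_dotZr f h (a : R) x : smooth A f -> smooth A h ->
  grad_dot f (fun z => a * h z) x = a * grad_dot f h x.
Proof.
move=> sf sh; rewrite /grad_dot /chart_dot; set i := chart_at A x; set y := cmap _ x.
have iy : cimg (atlas i) y by apply: cmap_img; exact: chart_atP.
rewrite !coord_dotE mulr_sumr; apply: eq_bigr => k _; rewrite mulrCA; congr (_ * _).
have dh := Ck_derivable (j := k) (Ck_local_rep 1 i sh) iy.
have := partialM (derivable_cst a y (delta_mx 0 k)) dh.
rewrite /partial derive_cst mulr0 addr0; exact.
Qed.

(** The defect in Green's formula; being additive in [h], it can be shown to vanish one summand at a
    time. *)
Definition green f h := \int[mu]_x (grad_dot f h x + h x * laplacian g f x).

Lemma smooth_green f h : smooth A f -> smooth A h ->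
  smooth A (fun x => grad_dot f h x + h x * laplacian g f x).
Proof.
move=> sf sh.
exact: (smoothD (smooth_grad_dot sf sh) (smoothM sh (smooth_laplacian sf))).
Qed.

Lemma green_supported i K f h : compact K -> K `<=` cdom (atlas i) ->
  smooth A f -> smooth A h -> (forall x, ~ K x -> h x = 0) -> green f h = 0.
Proof.
move=> cK Ki sf sh hK; have sK := @supported_local_rep R n M A i K h hK.
rewrite -(green_local hausdorffM volmu cK Ki sK (Ck_local_rep 2 i sf) (Ck_local_rep 1 i sh)).
apply: eq_Rintegral => x _; have [Kx|Kx] := pselect (K x).
  rewrite extendE; last exact: Ki.
  rewrite (grad_dotE sf sh (Ki x Kx)) (laplacianE sf (Ki x Kx)) addrC /green_form mulrC.
  by rewrite /local_rep cmapK//; exact: Ki.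
rewrite (@extend_zero _ _ _ _ K) ?hK// ?mul0r ?addr0; last exact: supported_green_form.
(* Off [K] the pairing is computed in [chart_at A x], possibly a chart other than [i]; [h] is
   supported in [K] there too, so its partial derivatives vanish. *)
rewrite /grad_dot /chart_dot coord_dotE big1// => k _; set j := chart_at A x.
have jx := @chart_atP _ _ _ A x.
rewrite (supported_partial hausdorffM k cK (@supported_local_rep R n M A j K h hK)) ?mulr0//.
  exact: cmap_img.
by rewrite cmapK.
Qed.

Lemma greenD f h1 h2 : smooth A f -> smooth A h1 -> smooth A h2 ->
  green f (fun x => h1 x + h2 x) = green f h1 + green f h2.
Proof.
move=> sf s1 s2; have c h : smooth A h -> continuous (fun x => grad_dot f h x + h x * laplacian g f x).
  by move=> sh; apply: smooth_continuous (smooth_green sf sh).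
rewrite /green -(muD compactM mu (c _ s1) (c _ s2)).
by apply: eq_Rintegral => x _; rewrite grad_dotDr//; ring.
Qed.

Lemma green0 f : smooth A f -> green f (fun=> 0) = 0.
Proof.
move=> sf; have s0 := @smooth_cst _ _ _ A (0 : R).
have := greenD sf s0 s0; rewrite (_ : (fun _ : M => 0 + 0) = fun=> 0 : R); last first.
  by apply/funext => x; rewrite addr0.
by move/eqP; rewrite -subr_eq0 opprD addNKr oppr_eq0 => /eqP.
Qed.

(** Weaker than a partition of unity: only positivity of the sum is asked for, and dividing by it is
    left to the use. *)
Lemma finite_bump_cover : exists (I : Type) (s : seq I) (b : I -> M -> R),
  [/\ forall k, smooth A (b k),
      forall k, exists i K, [/\ compact K, K `<=` cdom (atlas i) & forall x, ~ K x -> b k x = 0] &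
      forall x, 0 < \sum_(k <- s) b k x].
Proof.
have bx (x : M) : exists b : M -> R, [/\ smooth A b, forall z, 0 <= b z, 0 < b x &
   exists i K, [/\ compact K, K `<=` cdom (atlas i) & forall x, ~ K x -> b x = 0]].
  have ix := @chart_atP _ _ _ A x.
  have [K [b [cK KU [sb b0 b1 bK]]]] := exists_bump hausdorffM openT (I : [set: M] x) ix.
  exists b; split => //; exists (chart_at A x), K; split => //.
  by move=> z /KU[].
pose b x := sval (cid (bx x)).
have [sb b0 b1 bK] : [/\ forall x, smooth A (b x), forall x z, 0 <= b x z, forall x, 0 < b x x &
   forall x, exists i K, [/\ compact K, K `<=` cdom (atlas i) & forall z, ~ K z -> b x z = 0]].
  by split=> x; rewrite /b; case: cid => ? [].
have cM : cover_compact [set: M] by rewrite -compact_cover.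
have [||D _ HD] := cM M setT (fun x => [set z | 0 < b x z]).
- move=> x _; have -> : [set z | 0 < b x z] = b x @^-1` [set t | 0 < t] by [].
  apply: open_comp; last exact: open_gt.
  by move=> z _; have c := smooth_continuous (sb x); exact: c.
- by move=> x _; exists x => //; exact: b1.
exists M, (finmap.enum_fset D), b; split => // x.
have [k /= Dk bk] := HD x I.
rewrite (big_rem k)//= ltr_pwDl// sumr_ge0//.
Qed.

Lemma green_identity f h : smooth A f -> smooth A h ->
  \int[mu]_x grad_dot f h x = - \int[mu]_x (h x * laplacian g f x).
Proof.
move=> sf sh; apply/eqP; rewrite -addr_eq0; apply/eqP.
have sl := smooth_laplacian sf.
rewrite -(muD compactM mu (smooth_continuous (smooth_grad_dot sf sh))
            (smooth_continuous (smoothM sh sl))) -/(green f h).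
have [I [s [b [sb bK bpos]]]] := finite_bump_cover.
pose S x := \sum_(k <- s) b k x.
have sS : smooth A S by exact: smooth_sum.
have S0 x : S x != 0 by rewrite gt_eqF// bpos.
pose w x := h x * (S x)^-1.
have sw : smooth A w := smoothM sh (smoothV S0 sS).
(* With [S] the positive sum of the bumps, [h] is the sum of the functions [b k * (h / S)], each
   supported in one chart. *)
have -> : h = fun x => \sum_(k <- s) (b k x * w x).
  by apply/funext => x; rewrite -mulr_suml -/(S x) /w mulrCA mulfV ?mulr1.
have sbw k : smooth A (fun x => b k x * w x) := smoothM (sb k) sw.
elim: (s) => [|k r IH].
  rewrite (_ : (fun x => _) = fun=> 0); first exact: green0.
  by apply/funext => x; rewrite big_nil.
rewrite (_ : (fun x => _) = fun x => b k x * w x + \sum_(j <- r) (b j x * w x)); last first.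
  by apply/funext => x; rewrite big_cons.
rewrite (greenD sf (sbw k) (smooth_sum r sbw)).
have [i [K [cK Ki Kb]]] := bK k.
rewrite IH addr0; apply: (green_supported cK Ki sf (sbw k)) => x /Kb ->.
exact: mul0r.
Qed.

End GlobalGreen.

(** * Smooth families of functions *)

Section Families.
Context {R : realType} {n : nat} {M : topologicalType} {A : oriented_atlas R n M}.
Context {p : nat}.
Implicit Types (W : set 'rV[R]_p) (u v : 'rV[R]_p -> M -> R) (i : Defs.index A).

Definition famdom W i : set 'rV[R]_(p + n) :=
  [set z | W (lsubmx z) /\ cimg (atlas i) (rsubmx z)].

Definition famrep i u (z : 'rV[R]_(p + n)) : R :=
  u (lsubmx z) (cinv (atlas i) (rsubmx z)).

Lemma famrep_row i u x y : famrep i u (row_mx x y) = u x (cinv (atlas i) y).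
Proof. by rewrite /famrep row_mxKl row_mxKr. Qed.

Lemma famdom_row W i x y : famdom W i (row_mx x y) <-> W x /\ cimg (atlas i) y.
Proof. by rewrite /famdom /= row_mxKl row_mxKr. Qed.

Lemma famdom_open W i : open W -> open (famdom W i).
Proof.
move=> oW; have -> : famdom W i = (lsubmx @^-1` W) `&` (rsubmx @^-1` (cimg (atlas i))) by [].
apply: openI; apply: open_comp => //.
- by move=> z _; exact: continuous_lsubmx.
- by move=> z _; exact: continuous_rsubmx.
- exact: cimg_open.
Qed.

Lemma familyP W u : smooth_family A W u <-> forall k i, Ck k (famdom W i) (famrep i u).
Proof.
split=> [su k i|su i]; first by move: k; apply/smooth_onP; exact: su.
by apply/smooth_onP => k; exact: su.
Qed.

Lemma family_eq W u v : open W -> (forall z x, W z -> u z x = v z x) ->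
  smooth_family A W u -> smooth_family A W v.
Proof.
move=> oW uv /familyP su; apply/familyP => k i.
apply: Ck_eq (su k i); first exact: famdom_open.
by move=> z /set_mem [Wz _]; exact: uv.
Qed.

Lemma familyD W u v : open W -> smooth_family A W u -> smooth_family A W v ->
  smooth_family A W (fun z x => u z x + v z x).
Proof.
move=> oW /familyP su /familyP sv; apply/familyP => k i.
exact: (CkD (famdom_open oW) (su k i) (sv k i)).
Qed.

Lemma familyM W u v : open W -> smooth_family A W u -> smooth_family A W v ->
  smooth_family A W (fun z x => u z x * v z x).
Proof.
move=> oW /familyP su /familyP sv; apply/familyP => k i.
exact: (CkM (famdom_open oW) (su k i) (sv k i)).
Qed.

Lemma Ck_rsubmx k (W : set 'rV[R]_(p + n)) (V : set 'rV[R]_n) (h : 'rV[R]_n -> R) :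
  open W -> open V -> (forall z, W z -> V (rsubmx z)) -> Ck k V h ->
  Ck k W (fun z => h (rsubmx z)).
Proof.
move=> oW oV WV Hh; apply: (@Ck_comp _ _ _ _ _ _ rsubmx h oW oV WV) => // l.
apply: (@Ck_eq _ _ _ _ (fun z => z 0 (rshift p l))) => //; last exact: Ck_coord.
by move=> z _; rewrite mxE.
Qed.

Lemma Ck_lsubmx k (W : set 'rV[R]_(p + n)) (V : set 'rV[R]_p) (h : 'rV[R]_p -> R) :
  open W -> open V -> (forall z, W z -> V (lsubmx z)) -> Ck k V h ->
  Ck k W (fun z => h (lsubmx z)).
Proof.
move=> oW oV WV Hh; apply: (@Ck_comp _ _ _ _ _ _ lsubmx h oW oV WV) => // l.
apply: (@Ck_eq _ _ _ _ (fun z => z 0 (lshift n l))) => //; last exact: Ck_coord.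
by move=> z _; rewrite mxE.
Qed.

Lemma family_function W (f : M -> R) : open W -> smooth A f -> smooth_family A W (fun=> f).
Proof.
move=> oW /smoothP sf; apply/familyP => k i.
apply: (@Ck_rsubmx _ _ (cimg (atlas i)) (fun y => f (cinv (atlas i) y))).
- exact: famdom_open.
- exact: cimg_open.
- by move=> z [].
- exact: sf.
Qed.

Lemma family_scalar W (c : 'rV[R]_p -> R) : open W -> (forall k, Ck k W c) ->
  smooth_family A W (fun z _ => c z).
Proof.
move=> oW Hc; apply/familyP => k i; apply: (@Ck_lsubmx _ _ W c) => //.
- exact: famdom_open.
- by move=> z [].
Qed.

Lemma family_slice W u z : open W -> smooth_family A W u -> W z -> smooth A (u z).
Proof.
move=> oW /familyP su Wz; apply/smoothP => k i.
apply: (@Ck_eq _ _ _ _ (famrep i u \o row_mx z)); first exact: cimg_open.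
  by move=> y _; rewrite /= famrep_row.
apply: (Ck_comp _ _ _ _ (su k i)); [exact: cimg_open|exact: famdom_open| |].
  by move=> y iy; apply/famdom_row.
move=> l; have [j ->|j ->] := split_ordP l.
  apply: (@Ck_eq _ _ _ _ (fun=> z 0 j)); [exact: cimg_open| |exact: Ck_cst].
  by move=> y _; rewrite row_mxEl.
apply: (@Ck_eq _ _ _ _ (fun y => y 0 j)); [exact: cimg_open| |].
  by move=> y _; rewrite row_mxEr.
by apply: Ck_coord; exact: cimg_open.
Qed.

Definition dpar (k : 'I_p) u (z : 'rV[R]_p) (x : M) : R := partial k (fun z => u z x) z.

Lemma famrep_dpar i k u : famrep i (dpar k u) = partial (lshift n k) (famrep i u).
Proof.
apply/funext => z; rewrite -[z]hsubmxK famrep_row -partial_rowl /dpar; congr (partial _ _ _).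
by apply/funext => x; rewrite famrep_row.
Qed.

Lemma family_dpar W u k : smooth_family A W u -> smooth_family A W (dpar k u).
Proof.
move=> /familyP su; apply/familyP => j i; rewrite famrep_dpar.
exact: (Ck_partial _ (su j.+1 i)).
Qed.

Lemma family_derivable W u k z x : smooth_family A W u -> W z ->
  derivable (fun z => u z x) z (delta_mx 0 k).
Proof.
move=> /familyP su Wz; set i := chart_at A x; have ix := @chart_atP _ _ _ A x.
have := @derivable_rowl _ p n (famrep i u) k z (cmap (atlas i) x).
rewrite (_ : (fun z' => _) = fun z => u z x); last first.
  by apply/funext => z'; rewrite famrep_row cmapK.
move=> H; apply/H; apply: (Ck_derivable (su 1%N i)).
by apply/famdom_row; split => //; exact: cmap_img.
Qed.

Lemma family_continuous W u z x : open W -> smooth_family A W u -> W z ->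
  {for (z, x), continuous (fun w => u w.1 w.2)}.
Proof.
move=> oW /familyP su Wz; set i := chart_at A x; have ix := @chart_atP _ _ _ A x.
apply: (@continuous_near _ _ (fun w => famrep i u (row_mx w.1 (cmap (atlas i) w.2))) _ _
   (snd @^-1` (cdom (atlas i)))) => //.
- by apply: open_comp; [move=> w _; exact: continuous_snd|exact: cdom_open].
- by move=> w iw; rewrite famrep_row cmapK.
apply: (@continuous_comp _ _ _ (fun w : 'rV[R]_p * M => row_mx w.1 (cmap (atlas i) w.2)) (famrep i u)).
  apply: (@continuous_comp _ _ _ (fun w : 'rV[R]_p * M => (w.1, cmap (atlas i) w.2))
     (fun w => row_mx w.1 w.2)); last exact: row_mx_continuous.
  apply: continuous_pair; first exact: continuous_fst.
  apply: (@continuous_comp _ _ _ snd (cmap (atlas i))); first exact: continuous_snd.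
  exact: cmap_continuous.
apply: (Ck_continuous (su 0%N i)).
by apply/famdom_row; split => //; exact: cmap_img.
Qed.

End Families.

Lemma family_reparam (R : realType) n (M : topologicalType) (A : oriented_atlas R n M) p q
    (W : set 'rV[R]_p) (V : set 'rV[R]_q) (u : 'rV[R]_p -> M -> R) (tau : 'rV[R]_q -> 'rV[R]_p) :
  open W -> open V -> (forall z, V z -> W (tau z)) ->
  (forall k l, Ck k V (fun z => tau z 0 l)) ->
  smooth_family A W u -> smooth_family A V (fun z => u (tau z)).
Proof.
move=> oW oV VW Ht /familyP su; apply/familyP => k i.
apply: (@Ck_eq _ _ _ _ (famrep i u \o (fun z => row_mx (tau (lsubmx z)) (rsubmx z)))).
- exact: famdom_open.
- by move=> z _; rewrite /= famrep_row.
apply: (Ck_comp _ _ _ _ (su k i)); [exact: famdom_open|exact: famdom_open| |].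
  by move=> z [Vz iz]; apply/famdom_row; split => //; exact: VW.
move=> l; have [j ->|j ->] := split_ordP l.
  apply: (@Ck_eq _ _ _ _ (fun z => (tau (lsubmx z)) 0 j)); [exact: famdom_open| |].
    by move=> z _; rewrite row_mxEl.
  apply: (@Ck_lsubmx _ _ _ _ _ V (fun z => tau z 0 j)) => //; first exact: famdom_open.
  by move=> z [].
apply: (@Ck_eq _ _ _ _ (fun z : 'rV[R]_(q + n) => z 0 (rshift q j))); [exact: famdom_open| |].
  by move=> z _; rewrite row_mxEr mxE.
by apply: Ck_coord; exact: famdom_open.
Qed.

(** * Laplacians and integrals depending smoothly on parameters *)

Section ParametricIntegrals.
Context {R : realType} {n : nat} {M : ptopologicalType}.
Hypothesis hausdorffM : hausdorff_space M.
Hypothesis compactM : compact [set: M].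
Context {A : oriented_atlas R n M} (g : riemannian_metric A).
Variable mu : probability (borel M) R.
Hypothesis volmu : normalized_volume g mu.
Context {p : nat}.
Implicit Types (W : set 'rV[R]_p) (u : 'rV[R]_p -> M -> R).

(** Smoothness of every slice does not give joint smoothness, so the Laplacian is rewritten through
    partial derivatives, in the last [n] directions, of the representation in all [p + n]
    variables. *)
Lemma family_laplacian W u : open W -> smooth_family A W u ->
  smooth_family A W (fun z => laplacian g (u z)).
Proof.
move=> oW su'; have /familyP su := su'; apply/familyP => k i.
have oD := @famdom_open _ _ _ A _ W i oW.
have lift_Ck m (h : 'rV[R]_n -> R) : Ck m (cimg (atlas i)) h ->
    Ck m (famdom W i) (fun z : 'rV[R]_(p + n) => h (rsubmx z)).
  by move=> Hh; apply: (Ck_rsubmx oD _ _ Hh); [exact: cimg_open|move=> z []].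
(* The components of the flux as functions of parameters and coordinates together. *)
pose F (m : 'I_n) (z : 'rV[R]_(p + n)) : R := vol_density g i (rsubmx z) *
  \sum_(l < n) partial (rshift p l) (famrep i u) z * invmx (gram g i (rsubmx z)) l m.
have CF j m : Ck j (famdom W i) (F m).
  apply: (CkM oD (lift_Ck _ _ (Ck_vol_density g j i))).
  apply: (Ck_sum _ oD) => l _.
  exact: (CkM oD (Ck_partial _ (su j.+1 i)) (lift_Ck _ _ (Ck_inv_gram g j i l m))).
apply: (@Ck_eq _ _ _ _ (fun z => (vol_density g i (rsubmx z))^-1 *
    \sum_(m < n) partial (rshift p m) (F m) z) _ oD); last first.
  apply: (CkM oD).
    apply: (CkV oD); last exact: (lift_Ck _ _ (Ck_vol_density g k i)).
    by move=> z [_ iz]; rewrite gt_eqF// vol_density_gt0.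
  by apply: (Ck_sum _ oD) => m _; exact: (Ck_partial _ (CF k.+1 m)).
move=> z /set_mem [Wz iz]; rewrite /famrep.
rewrite (@laplacianE _ _ _ hausdorffM compactM _ g mu volmu i); last first.
- exact: cinv_dom.
- exact: (family_slice oW su').
rewrite /chart_lap cinvK// coord_lapE; congr (_ * _); apply: eq_bigr => m _.
have E1 : partial (rshift p m) (F m) z = partial (rshift p m) (F m) (row_mx (lsubmx z) (rsubmx z)).
  exact: (congr1 (partial (rshift p m) (F m)) (esym (hsubmxK z))).
apply: (etrans E1); apply: (etrans (esym (@partial_rowr R p n (F m) m (lsubmx z) (rsubmx z)))).
have E2 : (fun y => F m (row_mx (lsubmx z) y)) =
    flux g i (local_rep i (u (lsubmx z))) m; last by rewrite E2.
apply/funext => y; rewrite /F row_mxKr /flux coord_gradE.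
congr (_ * _); apply: eq_bigr => l _; congr (_ * _).
rewrite -(@partial_rowr _ p n (famrep i u) l (lsubmx z) y); congr (partial _ _ _).
by apply/funext => y'; rewrite famrep_row.
Qed.

Definition mu_family u (z : 'rV[R]_p) : R := \int[mu]_x u z x.

Lemma mu_family_continuous W u z : open W -> smooth_family A W u -> W z ->
  {for z, continuous (mu_family u)}.
Proof.
move=> oW su Wz; apply/continuous_eps => e e0.
have H := @tube R M _ setT u z compactM (fun x _ => family_continuous oW su Wz) e e0.
have Wn := open_nbhs_nbhs (conj oW Wz).
apply: filterS (filterI Wn H) => w [Ww Hw].
have cw : continuous (u w) := smooth_continuous (family_slice oW su Ww).
have cz : continuous (u z) := smooth_continuous (family_slice oW su Wz).
have -> : mu_family u z - mu_family u w = \int[mu]_x ((-1) * u w x + u z x).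
  by rewrite (mu_lin compactM mu _ cw cz) /mu_family mulN1r addrC.
apply: (mu_bound compactM).
  by move=> x; apply: continuous_affine; [exact: cw|exact: cz].
by move=> x; rewrite mulN1r addrC distrC; exact: Hw.
Qed.

Lemma mu_family_derive W u k z : open W -> smooth_family A W u -> W z ->
  is_derive z (delta_mx 0 k : 'rV[R]_p) (mu_family u) (mu_family (dpar k u) z).
Proof.
move=> oW su Wz; apply/is_derive_line0; apply: (@is_derive_estimate _ _ _ _ 1) => e e0.
have sd := @family_dpar _ _ _ _ _ W u k su.
have H := @tube R M _ setT (dpar k u) z compactM (fun x _ => family_continuous oW sd Wz) e e0.
have Hn : \forall w \near z, W w /\ forall x, [set: M] x -> `|dpar k u w x - dpar k u z x| <= e.
  by apply: filterI H; exact: (open_nbhs_nbhs (conj oW Wz)).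
have /nbhs_ballP[d /= d0 Hd] := Hn.
apply/nbhs_ballP; exists d => //= s; rewrite -ball_normE/= sub0r normrN => sd'.
have zt (t : R) : `|t| < d -> ball z d (t *: delta_mx 0 k + z).
  move=> td; rewrite -ball_normE/= opprD addrCA subrr addr0 normrN normrZ.
  by rewrite (le_lt_trans _ td)// ler_piMr// delta_norm_le.
have cw (w : 'rV[R]_p) (Ww : W w) : continuous (u w) := smooth_continuous (family_slice oW su Ww).
have cd : continuous (dpar k u z) := smooth_continuous (family_slice oW sd Wz).
have [Ws _] := Hd _ (zt s sd').
rewrite addr0 scale0r add0r mul1r.
have cl : continuous (fun x => (-1) * u z x + u (s *: delta_mx 0 k + z) x).
  by move=> x; apply: continuous_affine; exact: cw.
have -> : mu_family u (s *: delta_mx 0 k + z) - mu_family u z - s * mu_family (dpar k u) z =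
   \int[mu]_x ((- s) * dpar k u z x + ((-1) * u z x + u (s *: delta_mx 0 k + z) x)).
  by rewrite (mu_lin compactM mu _ cd cl) (mu_lin compactM mu _ (cw _ Wz) (cw _ Ws)) /mu_family; ring.
apply: (mu_bound compactM).
  by move=> x; apply: continuous_affine; [exact: cd|exact: cl].
move=> x.
have -> : - s * dpar k u z x + (-1 * u z x + u (s *: delta_mx 0 k + z) x) =
   u (s *: delta_mx 0 k + z) x - u (0 *: delta_mx 0 k + z) x - dpar k u z x * s.
  by rewrite scale0r add0r; ring.
apply: (@mean_value_estimate R (fun t => u (t *: delta_mx 0 k + z) x)) => t ts.
have [Wt Ht] := Hd _ (zt t (le_lt_trans ts sd')).
split; first by apply: (iffRL (derivable_line (fun w => u w x) _ _ _)); exact: (family_derivable su Wt).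
by rewrite (derive_line (fun w => u w x)); exact: Ht.
Qed.

Lemma Ck_mu_family k W u : open W -> smooth_family A W u -> Ck k W (mu_family u).
Proof.
move=> oW; elim: k u => [|k IH] u su.
  by split => // z Wz; exact: (mu_family_continuous oW su Wz).
apply: CkS => [z Wz|j z Wz|j].
- exact: (mu_family_continuous oW su Wz).
- by have [] := mu_family_derive j oW su Wz.
- apply: (Ck_eq oW _ (IH _ (@family_dpar _ _ _ _ _ W u j su))) => z /set_mem Wz.
  by have [_ <-] := mu_family_derive j oW su Wz.
Qed.

End ParametricIntegrals.

Section Axes.
Context {R : realType} {p : nat}.
Variables (h : 'rV[R]_p -> R) (k : 'I_p) (z : 'rV[R]_p) (phi : R -> R) (c : R).
Hypothesis hphi : forall t, h (t *: delta_mx 0 k + z) = phi (t + c).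

(** The difference quotients coincide as functions of [t], which turns partial derivatives on
    ['rV[R]_1] and ['rV[R]_2] into derivatives in a real variable. *)
Lemma growth_axis :
  (fun t : R => t^-1 *: ((h \o shift z) (t *: delta_mx 0 k) - h z)) =
  (fun t : R => t^-1 *: ((phi \o shift c) (t *: (1 : R)) - phi c)).
Proof.
have hz : h z = phi c by have := hphi 0; rewrite scale0r !add0r.
by apply/funext => t /=; rewrite hphi hz [t *: 1]mulr1.
Qed.

Lemma partial_axis : partial k h z = 'D_1 phi c.
Proof. by rewrite /partial /derive growth_axis. Qed.

Lemma derivable_axis : derivable h z (delta_mx 0 k) <-> derivable phi c 1.
Proof. by rewrite /derivable growth_axis. Qed.

End Axes.

(** * Curves and two-parameter variations as smooth families *)

Section Curves.
Context {R : realType} {n : nat} {M : ptopologicalType} {A : oriented_atlas R n M}.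
Implicit Types (J : set R) (f : R -> M -> R) (F : R -> R -> M -> R).

Definition dom1 J : set 'rV[R]_1 := [set z | J (z 0 0)].

Definition dom2 (e : R) J : set 'rV[R]_2 := [set z | `|z 0 0| < e /\ J (z 0 1)].

Definition fam1 J f := smooth_family A (dom1 J) (fun z => f (z 0 0)).

Definition fam2 e J F := smooth_family A (dom2 e J) (fun z => F (z 0 0) (z 0 1)).

Definition row1 (t : R) : 'rV[R]_1 := const_mx t.

Definition row2 (s t : R) : 'rV[R]_2 := \row_i (if i == 0 then s else t).

Lemma row1E t : row1 t 0 0 = t. Proof. by rewrite mxE. Qed.

Lemma row2E0 s t : row2 s t 0 0 = s. Proof. by rewrite mxE eqxx. Qed.

Lemma row2E1 s t : row2 s t 0 1 = t. Proof. by rewrite mxE. Qed.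

Lemma open_dom1 J : open J -> open (dom1 J).
Proof. by move=> oJ; apply: open_comp => // z _; exact: coord_continuous. Qed.

Lemma open_dom2 e J : open J -> open (dom2 e J).
Proof.
move=> oJ; rewrite (_ : dom2 e J = (fun z : 'rV[R]_2 => `|z 0 0|) @^-1` [set x | x < e] `&`
   (fun z : 'rV[R]_2 => z 0 1) @^-1` J)//.
apply: openI; apply: open_comp => //.
- move=> z _; apply: (@continuous_comp _ _ _ (fun z : 'rV[R]_2 => z 0 0) Num.norm).
    exact: coord_continuous.
  exact: norm_continuous.
- by move=> z _; exact: coord_continuous.
Qed.

Lemma open_norm_lt (e : R) : open [set s : R | `|s| < e].
Proof.
rewrite (_ : [set s : R | `|s| < e] = Num.norm @^-1` [set x | x < e])//.
by apply: open_comp; [move=> z _; exact: norm_continuous|exact: open_lt].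
Qed.

Lemma axis1 (t : R) (z : 'rV[R]_1) : (t *: delta_mx 0 0 + z) 0 0 = t + z 0 0.
Proof. by rewrite !mxE !eqxx mulr1. Qed.

Lemma axis20 (t : R) (z : 'rV[R]_2) :
  ((t *: delta_mx 0 0 + z) 0 0 = t + z 0 0) /\ ((t *: delta_mx 0 0 + z) 0 1 = z 0 1).
Proof. by rewrite !mxE !eqxx /= mulr1 mulr0 add0r. Qed.

Lemma axis21 (t : R) (z : 'rV[R]_2) :
  ((t *: delta_mx 0 1 + z) 0 0 = z 0 0) /\ ((t *: delta_mx 0 1 + z) 0 1 = t + z 0 1).
Proof. by rewrite !mxE !eqxx /= mulr1 mulr0 add0r. Qed.

Lemma fam1_dpar f z x :
  dpar 0 (fun z : 'rV[R]_1 => f (z 0 0)) z x = partial1of2 f (z 0 0) x.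
Proof.
rewrite partial1of2E; apply: (@partial_axis _ _ _ _ _ (f^~ x)) => t.
by rewrite axis1.
Qed.

Lemma fam1_partial J f : open J -> fam1 J f -> fam1 J (partial1of2 f).
Proof.
move=> oJ Jf; apply: (family_eq (open_dom1 oJ) _ (@family_dpar _ _ _ _ _ _ _ 0 Jf)).
by move=> z x _; exact: fam1_dpar.
Qed.

Lemma fam1_derive J f t x : fam1 J f -> J t ->
  is_derive t (1 : R) (fun t => f t x) (partial1of2 f t x).
Proof.
move=> Jf Jt; rewrite partial1of2E; apply: DeriveDef => //.
have Jr : dom1 J (row1 t) by rewrite /dom1 /= row1E.
have := @family_derivable _ _ _ _ _ _ _ 0 _ x Jf Jr.
by rewrite (@derivable_axis _ _ _ _ _ (f^~ x) t)// => s; rewrite axis1 row1E.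
Qed.

Lemma fam1_slice J f t : open J -> fam1 J f -> J t -> smooth A (f t).
Proof.
move=> oJ Jf Jt.
have Jr : dom1 J (row1 t) by rewrite /dom1 /= row1E.
by have := family_slice (open_dom1 oJ) Jf Jr; rewrite row1E.
Qed.

Lemma fam1D J f h : open J -> fam1 J f -> fam1 J h -> fam1 J (fun t x => f t x + h t x).
Proof. by move=> oJ Jf Jh; exact: (familyD (open_dom1 oJ) Jf Jh). Qed.

Lemma fam1M J f h : open J -> fam1 J f -> fam1 J h -> fam1 J (fun t x => f t x * h t x).
Proof. by move=> oJ Jf Jh; exact: (familyM (open_dom1 oJ) Jf Jh). Qed.

Lemma fam1_cst J (f : M -> R) : open J -> smooth A f -> fam1 J (fun=> f).
Proof. by move=> oJ sf; exact: (family_function (open_dom1 oJ) sf). Qed.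

Lemma fam1Z J f (a : R) : open J -> fam1 J f -> fam1 J (fun t x => a * f t x).
Proof. by move=> oJ Jf; exact: (fam1M oJ (fam1_cst oJ (smooth_cst a)) Jf). Qed.

Lemma fam1_eq J f h : open J -> (forall t x, J t -> f t x = h t x) -> fam1 J f -> fam1 J h.
Proof. by move=> oJ fh; apply: (family_eq (open_dom1 oJ)) => z x; exact: fh. Qed.

Lemma fam2_dpar0 F z x :
  dpar 0 (fun z : 'rV[R]_2 => F (z 0 0) (z 0 1)) z x =
  partial1of2 (fun s => F s (z 0 1)) (z 0 0) x.
Proof.
rewrite partial1of2E; apply: (@partial_axis _ _ _ _ _ (fun s => F s (z 0 1) x)) => t.
by have [-> ->] := axis20 t z.
Qed.

Lemma fam2_dpar1 F z x :
  dpar 1 (fun z : 'rV[R]_2 => F (z 0 0) (z 0 1)) z x = partial1of2 (F (z 0 0)) (z 0 1) x.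
Proof.
rewrite partial1of2E; apply: (@partial_axis _ _ _ _ _ (fun t => F (z 0 0) t x)) => t.
by have [-> ->] := axis21 t z.
Qed.

Lemma fam2_partial0 e J F : open J -> fam2 e J F ->
  fam2 e J (fun s t => partial1of2 (fun s => F s t) s).
Proof.
move=> oJ JF; apply: (family_eq (open_dom2 (e := e) oJ) _ (@family_dpar _ _ _ _ _ _ _ 0 JF)).
by move=> z x _; exact: fam2_dpar0.
Qed.

Lemma fam2_partial1 e J F : open J -> fam2 e J F ->
  fam2 e J (fun s t => partial1of2 (F s) t).
Proof.
move=> oJ JF; apply: (family_eq (open_dom2 (e := e) oJ) _ (@family_dpar _ _ _ _ _ _ _ 1 JF)).
by move=> z x _; exact: fam2_dpar1.
Qed.

Lemma fam2D e J F G : open J -> fam2 e J F -> fam2 e J G ->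
  fam2 e J (fun s t x => F s t x + G s t x).
Proof. by move=> oJ JF JG; exact: (familyD (open_dom2 oJ) JF JG). Qed.

Lemma fam2M e J F G : open J -> fam2 e J F -> fam2 e J G ->
  fam2 e J (fun s t x => F s t x * G s t x).
Proof. by move=> oJ JF JG; exact: (familyM (open_dom2 oJ) JF JG). Qed.

Lemma fam2_slice1 e J F s : open J -> `|s| < e -> fam2 e J F -> fam1 J (F s).
Proof.
move=> oJ se JF.
have Ht k (l : 'I_2) : Ck k (dom1 J) (fun z : 'rV[R]_1 => row2 s (z 0 0) 0 l).
  rewrite (_ : (fun z => _) = if l == 0 then fun=> s else fun z : 'rV[R]_1 => z 0 0); last first.
    by apply/funext => z; rewrite mxE; case: ifP.
  by case: ifP => _; [exact: Ck_cst|apply: Ck_coord; exact: open_dom1].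
have V z : dom1 J z -> dom2 e J (row2 s (z 0 0)) by move=> Jz; rewrite /dom2 /= row2E0 row2E1.
have := family_reparam (open_dom2 oJ) (open_dom1 oJ) V Ht JF.
rewrite /fam1; congr (smooth_family _ _ _); apply/funext => z; by rewrite row2E0 row2E1.
Qed.

Lemma fam2_slice0 e J F t : open J -> J t -> fam2 e J F ->
  fam1 [set s : R | `|s| < e] (fun s => F s t).
Proof.
move=> oJ Jt JF; have oe := open_dom1 (@open_norm_lt e).
have Ht k (l : 'I_2) : Ck k (dom1 [set s : R | `|s| < e]) (fun z : 'rV[R]_1 => row2 (z 0 0) t 0 l).
  rewrite (_ : (fun z => _) = if l == 0 then fun z : 'rV[R]_1 => z 0 0 else fun=> t); last first.
    by apply/funext => z; rewrite mxE; case: ifP.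
  by case: ifP => _; [exact: Ck_coord|exact: Ck_cst].
have V z : dom1 [set s : R | `|s| < e] z -> dom2 e J (row2 (z 0 0) t).
  by move=> Jz; rewrite /dom2 /= row2E0 row2E1.
have := family_reparam (open_dom2 oJ) oe V Ht JF.
rewrite /fam1; congr (smooth_family _ _ _); apply/funext => z; by rewrite row2E0 row2E1.
Qed.

Lemma fam1_fam2 e J f : open J -> fam1 J f -> fam2 e J (fun _ t => f t).
Proof.
move=> oJ Jf.
have Ht k (l : 'I_1) : Ck k (dom2 e J) (fun z : 'rV[R]_2 => row1 (z 0 1) 0 l).
  rewrite (_ : (fun z => _) = fun z : 'rV[R]_2 => z 0 1); last by apply/funext => z; rewrite mxE.
  by apply: Ck_coord; exact: open_dom2.
have V z : dom2 e J z -> dom1 J (row1 (z 0 1)) by move=> [_ Jz]; rewrite /dom1 /= row1E.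
have := family_reparam (open_dom1 oJ) (open_dom2 oJ) V Ht Jf.
rewrite /fam2; congr (smooth_family _ _ _); apply/funext => z; by rewrite row1E.
Qed.

End Curves.

Section RealIntegrable.
Context d (T : measurableType d) (R : realType) (nu : {measure set T -> \bar R}) (D : set T).
Hypothesis mD : measurable D.
Implicit Types f h : T -> R.

Lemma integrable_scale f (a : R) : nu.-integrable D (EFin \o f) ->
  nu.-integrable D (EFin \o (fun t => a * f t)).
Proof.
move=> intf; rewrite (_ : EFin \o _ = (fun t => a%:E * (EFin \o f) t)%E)//.
exact: integrableZl.
Qed.

Lemma integrable_sub f h : nu.-integrable D (EFin \o f) -> nu.-integrable D (EFin \o h) ->
  nu.-integrable D (EFin \o (fun t => f t - h t)).
Proof.
move=> intf inth; rewrite (_ : EFin \o _ = (EFin \o f) \- (EFin \o h))%E//.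
exact: integrableB.
Qed.

End RealIntegrable.

(** * Space and space-time integrals along curves and variations *)

Section CurveIntegrals.
Context {R : realType} {n : nat} {M : ptopologicalType}.
Hypothesis compactM : compact [set: M].
Context {A : oriented_atlas R n M}.
Variable mu : probability (borel M) R.
Local Notation leb := (@lebesgue_measure R).
Implicit Types (J : set R) (f : R -> M -> R) (F : R -> R -> M -> R).

Lemma fam1_mu_derive J f t : open J -> fam1 (A := A) J f -> J t ->
  is_derive t (1 : R) (fun t => \int[mu]_x f t x) (\int[mu]_x partial1of2 f t x).
Proof.
move=> oJ Jf Jt.
have Jr : dom1 J (row1 t) by rewrite /dom1 /= row1E.
have [H1 H2] := @mu_family_derive _ _ _ compactM A mu _ _ _ 0 _ (open_dom1 oJ) Jf Jr.
have ax s : mu_family mu (fun z : 'rV[R]_1 => f (z 0 0)) (s *: delta_mx 0 0 + row1 t) =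
    (fun t => \int[mu]_x f t x) (s + t).
  by rewrite /mu_family axis1 row1E.
have dE : mu_family mu (dpar 0 (fun z : 'rV[R]_1 => f (z 0 0))) (row1 t) =
   \int[mu]_x partial1of2 f t x.
  by apply: eq_Rintegral => x _; rewrite fam1_dpar row1E.
apply: DeriveDef; first exact: (iffLR (derivable_axis ax) H1).
by rewrite -(partial_axis ax) -dE -H2.
Qed.

Lemma fam1_mu_continuous J f t : open J -> fam1 (A := A) J f -> J t ->
  {for t, continuous (fun t => \int[mu]_x f t x)}.
Proof.
move=> oJ Jf Jt; have [H _] := fam1_mu_derive oJ Jf Jt.
by apply: differentiable_continuous; exact/derivable1_diffP.
Qed.

Lemma fam1_mu_within J f (a b : R) : open J -> fam1 (A := A) J f -> `[a, b] `<=` J ->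
  {within `[a, b], continuous (fun t => \int[mu]_x f t x)}.
Proof.
move=> oJ Jf abJ; apply: continuous_in_subspaceT => t /set_mem /abJ Jt.
exact: (fam1_mu_continuous oJ Jf Jt).
Qed.

Lemma Ck_fam1_mu J f k : open J -> fam1 (A := A) J f ->
  Ck k (dom1 J) (fun z => \int[mu]_x f (z 0 0) x).
Proof. by move=> oJ Jf; exact: (Ck_mu_family compactM mu k (open_dom1 oJ) Jf). Qed.

Lemma fam1_mu_FTC J f (a b : R) : open J -> fam1 (A := A) J f -> a < b -> `[a, b] `<=` J ->
  \int[leb]_(t in `[a, b]) (\int[mu]_x partial1of2 f t x) =
  \int[mu]_x f b x - \int[mu]_x f a x.
Proof.
move=> oJ Jf ab abJ.
apply: (@continuous_FTC2_line _ (fun t => \int[mu]_x f t x)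
  (fun t => \int[mu]_x partial1of2 f t x) a b ab).
  by move=> t tab; apply: (fam1_mu_derive oJ Jf); exact: abJ.
exact: (fam1_mu_within oJ (fam1_partial oJ Jf) abJ).
Qed.

Lemma fam2_mu_continuous e J F s t : open J -> fam2 (A := A) e J F -> `|s| < e -> J t ->
  {for (s, t), continuous (fun w => \int[mu]_x F w.1 w.2 x)}.
Proof.
move=> oJ JF se Jt.
have Jr : dom2 e J (row2 s t) by rewrite /dom2 /= row2E0 row2E1.
have := @mu_family_continuous _ _ _ compactM A mu _ _ _ _ (open_dom2 oJ) JF Jr.
move=> H; apply: (@continuous_ext _ _ (fun w => mu_family mu
  (fun z : 'rV[R]_2 => F (z 0 0) (z 0 1)) (row2 w.1 w.2))).
  by move=> w; rewrite /mu_family row2E0 row2E1.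
apply: (@continuous_comp _ _ _ (fun w : R * R => row2 w.1 w.2)); last exact: H.
apply: continuous_mxP => i j; rewrite ord1.
apply: (@continuous_ext _ _ (fun w : R * R => if j == 0 then w.1 else w.2)).
  by move=> w; rewrite mxE.
by case: (j == 0); [exact: continuous_fst|exact: continuous_snd].
Qed.

(** Compactness of [[a, b]] makes the estimate uniform in time; integrating it costs the factor
    [b - a]. *)
Lemma fam2_mu_derive e J F (a b : R) : 0 < e -> open J -> fam2 (A := A) e J F ->
  a < b -> `[a, b] `<=` J ->
  is_derive (0 : R) (1 : R) (fun s => \int[leb]_(t in `[a, b]) (\int[mu]_x F s t x))
    (\int[leb]_(t in `[a, b]) (\int[mu]_x partial1of2 (fun s => F s t) 0 x)).
Proof.
move=> e0 oJ JF ab abJ; apply: (@is_derive_estimate _ _ _ _ (b - a)) => d d0.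
have mab : measurable (`[a, b]%classic : set (g_sigma_algebraType R.-ocitv.-measurable)) by [].
have JdF := fam2_partial0 oJ JF.
have e00 : `|0 : R| < e by rewrite normr0.
have H := @tube R _ _ `[a, b] (fun s t => \int[mu]_x partial1of2 (fun s => F s t) s x) 0
  (@segment_compact R a b) (fun t abt => fam2_mu_continuous oJ JdF e00 (abJ t abt)) d d0.
have Hn : \forall s \near (0 : R), `|s| < e /\ forall t, `[a, b]%classic t ->
    `|\int[mu]_x partial1of2 (fun s => F s t) s x -
      \int[mu]_x partial1of2 (fun s => F s t) 0 x| <= d.
  by apply: filterI H; exact: (open_nbhs_nbhs (conj (@open_norm_lt R e) e00)).
have /nbhs_ballP[r /= r0 Hr] := Hn.
apply/nbhs_ballP; exists r => //= s; rewrite -ball_normE/= sub0r normrN => sr; rewrite addr0.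
have sb t : `|t| <= `|s| -> ball (0 : R) r t.
  by move=> ts; rewrite -ball_normE/= sub0r normrN (le_lt_trans ts).
have [se _] := Hr s (sb s (lexx _)).
have int s' : `|s'| < e -> leb.-integrable `[a, b] (EFin \o (fun t => \int[mu]_x F s' t x)).
  by move=> s'e; apply: continuous_itv_integrable; exact: (fam1_mu_within oJ (fam2_slice1 oJ s'e JF) abJ).
have intd : leb.-integrable `[a, b]
    (EFin \o (fun t => \int[mu]_x partial1of2 (fun s => F s t) 0 x)).
  by apply: continuous_itv_integrable; exact: (fam1_mu_within oJ (fam2_slice1 oJ e00 JdF) abJ).
have intZ : leb.-integrable `[a, b]
    (EFin \o (fun t => s * \int[mu]_x partial1of2 (fun s => F s t) 0 x)).
  apply: (@integrable_scale _ _ R leb `[a, b]%classic _ (fun t => \int[mu]_x partial1of2 (fun s => F s t) 0 x) s) => //; exact: intd.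
have intB : leb.-integrable `[a, b]
    (EFin \o (fun t => \int[mu]_x F s t x - \int[mu]_x F 0 t x)).
  by apply: (@integrable_sub _ _ R leb `[a, b]%classic _ (fun t => \int[mu]_x F s t x) (fun t => \int[mu]_x F 0 t x)) => //; exact: int.
rewrite -(RintegralZl s mab intd).
rewrite -(RintegralB mab (int _ se) (int _ e00)).
rewrite -(RintegralB mab intB intZ).
have intBB : leb.-integrable `[a, b] (EFin \o (fun t => \int[mu]_x F s t x - \int[mu]_x F 0 t x
    - s * \int[mu]_x partial1of2 (fun s => F s t) 0 x)).
  exact: (@integrable_sub _ _ R leb `[a, b]%classic mab _ _ intB intZ).
apply: le_trans (le_normr_Rintegral mab intBB) _.
rewrite mulrC -Rintegral_cst_itv ?(ltW ab)//; apply: le_Rintegral => //.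
- exact: (integrable_norm intBB).
- by apply: continuous_itv_integrable; apply: continuous_subspaceT => x; exact: continuous_cst.
move=> t abt; have Jt := abJ t abt.
rewrite (mulrC s).
apply: (@mean_value_estimate R (fun s => \int[mu]_x F s t x)) => r' r's.
have [r'e Hr'] := Hr r' (sb r' r's).
have [D1 D2] := fam1_mu_derive (@open_norm_lt R e) (fam2_slice0 oJ Jt JF) r'e.
by split => //; rewrite D2; exact: Hr'.
Qed.

End CurveIntegrals.

(* Unification would otherwise unfold these down to coordinate expressions. *)
#[local] Opaque laplacian grad_dot grad_normsq smooth.

(** * The potential and its gradient on the sphere *)

Section Statics.
Context {R : realType} {n : nat} {M : ptopologicalType}.
Hypothesis hausdorffM : hausdorff_space M.
Hypothesis compactM : compact [set: M].
Context {A : oriented_atlas R n M} (g : riemannian_metric A).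
Variable mu : probability (borel M) R.
Hypothesis volmu : normalized_volume g mu.
Implicit Types f h v w : M -> R.

Lemma smooth_sqr f : smooth A f -> smooth A (fun x => f x ^+ 2).
Proof. by move=> sf; exact: (smoothM sf sf). Qed.

Lemma mu_smooth_lin f h (a : R) : smooth A f -> smooth A h ->
  \int[mu]_x (a * f x + h x) = a * \int[mu]_x f x + \int[mu]_x h x.
Proof. by move=> sf sh; exact: (mu_lin compactM mu a (smooth_continuous sf) (smooth_continuous sh)). Qed.

Lemma mu_smoothD f h : smooth A f -> smooth A h ->
  \int[mu]_x (f x + h x) = \int[mu]_x f x + \int[mu]_x h x.
Proof. by move=> sf sh; exact: (muD compactM mu (smooth_continuous sf) (smooth_continuous sh)). Qed.

Lemma mu_smoothZ f (a : R) : smooth A f -> \int[mu]_x (a * f x) = a * \int[mu]_x f x.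
Proof. by move=> sf; exact: (muZ compactM mu a (smooth_continuous sf)). Qed.

Lemma mu_smoothB f h : smooth A f -> smooth A h ->
  \int[mu]_x (f x - h x) = \int[mu]_x f x - \int[mu]_x h x.
Proof.
move=> sf sh; rewrite addrC -mulN1r -(mu_smooth_lin _ sh sf).
by apply: eq_Rintegral => x _; rewrite mulN1r addrC.
Qed.

Lemma green_sym f h : smooth A f -> smooth A h ->
  \int[mu]_x (h x * laplacian g f x) = \int[mu]_x (f x * laplacian g h x).
Proof.
move=> sf sh; apply: oppr_inj.
have E1 := green_identity hausdorffM compactM volmu sf sh.
have E2 := green_identity hausdorffM compactM volmu sh sf.
have EC : \int[mu]_x grad_dot g f h x = \int[mu]_x grad_dot g h f x.
  by apply: eq_Rintegral => x _; exact: grad_dotC.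
exact: (etrans (esym E1) (etrans EC E2)).
Qed.

Lemma smooth_grad_normsq f : smooth A f -> smooth A (grad_normsq g f).
Proof.
move=> sf; have := smooth_grad_dot g sf sf; congr (smooth _ _).
by apply/funext => x; rewrite grad_normsq_dot.
Qed.

Lemma dirichlet f : smooth A f ->
  \int[mu]_x grad_normsq g f x = - \int[mu]_x (f x * laplacian g f x).
Proof.
move=> sf; apply: etrans (green_identity hausdorffM compactM volmu sf sf).
by apply: eq_Rintegral => x _; exact: grad_normsq_dot.
Qed.

Lemma lagrangianE f v : smooth A f -> smooth A v ->
  lagrangian g mu f v = 2^-1 * \int[mu]_x (v x ^+ 2 + f x * laplacian g f x).
Proof.
move=> sf sv; have sl := smooth_laplacian hausdorffM compactM volmu sf.
rewrite /lagrangian (mu_smoothB (smooth_sqr sv) (smooth_grad_normsq sf)).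
by rewrite (mu_smoothD (smooth_sqr sv) (smoothM sf sl)) (dirichlet sf) opprK.
Qed.

Lemma lagrangian_potential f v : smooth A f -> smooth A v ->
  lagrangian g mu f v = 2^-1 * \int[mu]_x (v x ^+ 2) - potential g mu f.
Proof.
move=> sf sv.
by rewrite /lagrangian (mu_smoothB (smooth_sqr sv) (smooth_grad_normsq sf)) mulrBr.
Qed.

(** The potential is a quadratic form, so the expansion is exact and its derivative at 0 can be read
    off without differentiating under the integral. *)
Lemma potential_expand f h (s : R) : smooth A f -> smooth A h ->
  potential g mu (fun x => f x + s * h x) =
  potential g mu f + s * (\int[mu]_x grad_dot g f h x) + s ^+ 2 * potential g mu h.
Proof.
move=> sf sh; rewrite /potential.
have ssh := smoothZ s sh; have sfh := smoothD sf ssh.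
have sgf := smooth_grad_normsq sf; have sgh := smooth_grad_normsq sh.
have sgd := smooth_grad_dot g sf sh.
have E x : grad_normsq g (fun x => f x + s * h x) x =
   2 * s * grad_dot g f h x + (s ^+ 2 * grad_normsq g h x + grad_normsq g f x).
  rewrite !grad_normsq_dot (grad_dotDr g x sfh sf ssh) (grad_dotZr g s x sfh sh).
  rewrite !(grad_dotC g (fun x => f x + s * h x)).
  rewrite (grad_dotDr g x sf sf ssh) (grad_dotZr g s x sf sh).
  rewrite (grad_dotDr g x sh sf ssh) (grad_dotZr g s x sh sh) (grad_dotC g h f); ring.
under eq_Rintegral do rewrite E.
have sgg := smoothD (smoothZ (s ^+ 2) sgh) sgf.
rewrite (mu_smooth_lin _ sgd sgg) (mu_smooth_lin _ sgh sgf).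
move: (\int[mu]_x grad_dot g f h x) (\int[mu]_x grad_normsq g h x)
  (\int[mu]_x grad_normsq g f x) => a b c.
by field.
Qed.

Lemma potential_derive f h : smooth A f -> smooth A h ->
  is_derive (0 : R) (1 : R) (fun s : R => potential g mu (fun x => f x + s * h x))
    (- \int[mu]_x (h x * laplacian g f x)).
Proof.
move=> sf sh; have <- := green_identity hausdorffM compactM volmu sf sh.
set P0 := potential g mu f; set P1 := \int[mu]_x _; set P2 := potential g mu h.
apply: (@is_derive_estimate _ _ _ _ 1) => e e0.
have P1' : 0 < `|P2| + 1 by rewrite ltr_wpDl.
(* The remainder is [s ^+ 2 * P2]; the radius makes [|s * P2| <= e], and the added 1 allows [P2] to
   be 0. *)
apply/nbhs_ballP; exists (e / (`|P2| + 1)); first exact: divr_gt0.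
move=> s; rewrite -ball_normE/= sub0r normrN => se.
rewrite addr0 (potential_expand s sf sh) (potential_expand 0 sf sh) -/P0 -/P1 -/P2.
have -> : P0 + s * P1 + s ^+ 2 * P2 - (P0 + 0 * P1 + 0 ^+ 2 * P2) - s * P1 = s * (s * P2) by ring.
rewrite mul1r normrM mulrC ler_wpM2r// normrM.
rewrite (@le_trans _ _ (`|s| * (`|P2| + 1)))//; first by rewrite ler_wpM2l// lerDl.
by rewrite -ler_pdivlMr// ltW.
Qed.

Lemma mul_smooth_eq0 f : smooth A f -> \int[mu]_x (f x * f x) = 0 -> forall x, f x = 0.
Proof.
move=> sf If x; apply/eqP; rewrite -sqrf_eq0 expr2; apply/eqP.
apply: (@mu_eq0 _ _ _ hausdorffM compactM _ _ mu volmu (fun x => f x * f x) _ _ If).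
  exact: (smooth_continuous (smoothM sf sf)).
by move=> z; rewrite -expr2 sqr_ge0.
Qed.

Lemma sphereE f : sphere A mu f <-> smooth A f /\ \int[mu]_x (f x * f x) = 1.
Proof.
by split=> -[sf f1]; split=> //; rewrite -f1; apply: eq_Rintegral => x _; rewrite expr2.
Qed.

Definition tproj f w x := w x - (\int[mu]_x (w x * f x)) * f x.

Lemma smooth_tproj f w : smooth A f -> smooth A w -> smooth A (tproj f w).
Proof. by move=> sf sw; exact: (smoothB sw (smoothZ _ sf)). Qed.

Lemma tproj_orth f w : sphere A mu f -> smooth A w -> \int[mu]_x (f x * tproj f w x) = 0.
Proof.
move=> /sphereE[sf f1] sw; set c := \int[mu]_x (w x * f x).
have -> : \int[mu]_x (f x * tproj f w x) = \int[mu]_x (w x * f x - c * (f x * f x)).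
  by apply: eq_Rintegral => x _; rewrite /tproj -/c; ring.
by rewrite (mu_smoothB (smoothM sw sf) (smoothZ c (smoothM sf sf))) (mu_smoothZ c (smoothM sf sf)) f1
  mulr1 subrr.
Qed.

(** [w] and its projection differ by a multiple of [f], which is orthogonal to the projection. *)
Lemma tproj_norm f w : sphere A mu f -> smooth A w ->
  \int[mu]_x (w x * tproj f w x) = \int[mu]_x (tproj f w x * tproj f w x).
Proof.
move=> Sf sw; have [sf _] := Sf; have st := smooth_tproj sf sw.
set c := \int[mu]_x (w x * f x).
have -> : \int[mu]_x (tproj f w x * tproj f w x) =
    \int[mu]_x (w x * tproj f w x - c * (f x * tproj f w x)).
  by apply: eq_Rintegral => x _; rewrite {1}/tproj -/c; ring.
rewrite (mu_smoothB (smoothM sw st) (smoothZ c (smoothM sf st))) (mu_smoothZ c (smoothM sf st)).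
by rewrite (tproj_orth Sf sw) mulr0 subr0.
Qed.

(** Tested against its own tangential projection, [w] yields the squared norm of that projection,
    which must therefore vanish. *)
Lemma normal_multiplier f w : sphere A mu f -> smooth A w ->
  (forall h, smooth A h -> \int[mu]_x (f x * h x) = 0 -> \int[mu]_x (w x * h x) = 0) ->
  forall x, w x = (\int[mu]_x (w x * f x)) * f x.
Proof.
move=> Sf sw H x; have [sf _] := Sf; have st := smooth_tproj sf sw.
have := H _ st (tproj_orth Sf sw); rewrite (tproj_norm Sf sw) => /(mul_smooth_eq0 st) /(_ x).
by move/eqP; rewrite subr_eq0 => /eqP.
Qed.

(* [a] stands for the second derivative of the curve, so that this is Newton's
   equation at one instant. *)
Lemma gradient_multiplier f a : sphere A mu f -> smooth A a ->
  is_potential_gradient g mu f (fun x => - (a x - l2 mu a f * f x)) <->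
  forall x, a x - laplacian g f x = (\int[mu]_x ((a x - laplacian g f x) * f x)) * f x.
Proof.
move=> Sf sa; have [sf _] := Sf.
have sl := smooth_laplacian hausdorffM compactM volmu sf.
have sw := smoothB sa sl.
have st := smooth_tproj sf sa.
have sN : smooth A (fun x => - tproj f a x).
  have := smoothZ (-1) st; congr (smooth _ _).
  by apply/funext => x; rewrite mulN1r.
have l2N h : smooth A h -> \int[mu]_x (f x * h x) = 0 ->
    l2 mu (fun x => - tproj f a x) h = - \int[mu]_x (a x * h x).
  move=> sh fh; set c := \int[mu]_x (a x * f x).
  rewrite /l2 (@eq_Rintegral _ _ _ mu _ (fun x => c * (f x * h x) + (-1) * (a x * h x))); last first.
    by move=> x _; rewrite /tproj -/c; ring.
  rewrite (mu_smooth_lin _ (smoothM sf sh) (smoothZ (-1) (smoothM sa sh))).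
  by rewrite (mu_smoothZ (-1) (smoothM sa sh)) fh mulr0 add0r mulN1r.
have wE h : smooth A h -> \int[mu]_x ((a x - laplacian g f x) * h x) =
    \int[mu]_x (a x * h x) - \int[mu]_x (h x * laplacian g f x).
  move=> sh; rewrite -(mu_smoothB (smoothM sa sh) (smoothM sh sl)).
  by apply: eq_Rintegral => x _; ring.
split=> [[_ grad]|H].
  apply: (normal_multiplier Sf sw) => h sh fh.
  have [_ D1] := grad h (conj sh fh); have [_ D2] := potential_derive sf sh.
  have := D1; rewrite D2 => /eqP; rewrite -/(tproj f a) (l2N h sh fh) eqr_opp => /eqP E.
  by rewrite (wE h sh) E subrr.
split.
  split; first exact: sN.
  rewrite /l2 -(mulr0 (-1)) -(tproj_orth Sf sa) -(mu_smoothZ (-1) (smoothM sf st)).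
  by apply: eq_Rintegral => x _; rewrite mulN1r mulrN.
move=> h [sh fh]; rewrite -/(tproj f a).
have -> : l2 mu (fun x => - tproj f a x) h = - \int[mu]_x (h x * laplacian g f x).
  rewrite (l2N h sh fh); congr (- _); apply/eqP; rewrite -subr_eq0 -(wE h sh); apply/eqP.
  set c := \int[mu]_x ((a x - laplacian g f x) * f x) in H.
  rewrite (@eq_Rintegral _ _ _ mu _ (fun x => c * (f x * h x))).
    by rewrite (mu_smoothZ c (smoothM sf sh)) -[\int[mu]_x _]/(l2 mu f h) fh mulr0.
  by move=> x _; rewrite H mulrA.
exact: potential_derive.
Qed.

End Statics.

(** * First variation of the action *)

Section Dynamics.
Context {R : realType} {n : nat} {M : ptopologicalType}.
Hypothesis hausdorffM : hausdorff_space M.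
Hypothesis compactM : compact [set: M].
Context {A : oriented_atlas R n M} (g : riemannian_metric A).
Variable mu : probability (borel M) R.
Hypothesis volmu : normalized_volume g mu.
Local Notation leb := (@lebesgue_measure R).
Local Notation fam1 := (fam1 (A := A)).
Local Notation fam2 := (fam2 (A := A)).
Implicit Types (J : set R) (f h : R -> M -> R) (F : R -> R -> M -> R).

Lemma partial1M J f h t x : fam1 J f -> fam1 J h -> J t ->
  partial1of2 (fun t x => f t x * h t x) t x =
  f t x * partial1of2 h t x + h t x * partial1of2 f t x.
Proof.
move=> Jf Jh Jt; have [df ef] := fam1_derive x Jf Jt; have [dh eh] := fam1_derive x Jh Jt.
move: ef eh => <- <-; rewrite partial1of2E; exact: (deriveM df dh).
Qed.

Lemma partial1D J f h t x : fam1 J f -> fam1 J h -> J t ->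
  partial1of2 (fun t x => f t x + h t x) t x = partial1of2 f t x + partial1of2 h t x.
Proof.
move=> Jf Jh Jt; have [df ef] := fam1_derive x Jf Jt; have [dh eh] := fam1_derive x Jh Jt.
move: ef eh => <- <-; rewrite partial1of2E; exact: (deriveD df dh).
Qed.

Lemma partial1_cst (f : M -> R) t x : partial1of2 (fun=> f) t x = 0.
Proof. by rewrite partial1of2E derive_cst. Qed.

Lemma partial1_eq J f h t x : open J -> (forall t, J t -> f t x = h t x) -> J t ->
  partial1of2 f t x = partial1of2 h t x.
Proof.
move=> oJ fh Jt; rewrite !partial1of2E; apply: near_eq_derive.
by move: (open_nbhs_nbhs (conj oJ Jt)); apply: filterS => s Js; exact: fh.
Qed.

Lemma fam1_laplacian J f : open J -> fam1 J f -> fam1 J (fun t => laplacian g (f t)).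
Proof.
move=> oJ Jf.
exact: (family_laplacian hausdorffM compactM volmu (open_dom1 oJ) Jf).
Qed.

Lemma fam2_laplacian e J F : open J -> fam2 e J F -> fam2 e J (fun s t => laplacian g (F s t)).
Proof.
move=> oJ JF.
exact: (family_laplacian hausdorffM compactM volmu (open_dom2 (e := e) oJ) JF).
Qed.

Lemma action_integral_lin J f h (a b c : R) : open J -> fam1 J f -> fam1 J h ->
  `[a, b] `<=` J ->
  \int[leb]_(t in `[a, b]) (\int[mu]_x (c * f t x + h t x)) =
  c * (\int[leb]_(t in `[a, b]) (\int[mu]_x f t x)) +
  \int[leb]_(t in `[a, b]) (\int[mu]_x h t x).
Proof.
move=> oJ Jf Jh abJ.
have i1 : leb.-integrable `[a, b] (EFin \o (fun t => \int[mu]_x f t x)).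
  have W := @fam1_mu_within _ _ _ compactM A mu _ _ _ _ oJ Jf abJ.
  exact: (continuous_itv_integrable W).
have i2 : leb.-integrable `[a, b] (EFin \o (fun t => \int[mu]_x h t x)).
  have W := @fam1_mu_within _ _ _ compactM A mu _ _ _ _ oJ Jh abJ.
  exact: (continuous_itv_integrable W).
have mab : measurable (`[a, b]%classic : set (g_sigma_algebraType R.-ocitv.-measurable)) by [].
rewrite -(RintegralZl c mab i1) -(RintegralD mab (integrable_scale mab c i1) i2).
apply: eq_Rintegral => t /set_mem /abJ Jt.
exact: (mu_smooth_lin compactM mu c (fam1_slice oJ Jf Jt) (fam1_slice oJ Jh Jt)).
Qed.

Lemma eq_action_integral f h (a b : R) :
  (forall t, a <= t <= b -> \int[mu]_x f t x = \int[mu]_x h t x) ->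
  \int[leb]_(t in `[a, b]) (\int[mu]_x f t x) = \int[leb]_(t in `[a, b]) (\int[mu]_x h t x).
Proof.
by move=> fh; apply: eq_Rintegral => t /set_mem/=; rewrite in_itv/=; exact: fh.
Qed.

Lemma derive_unique (phi psi : R -> R) t (a b : R) : (\forall s \near t, phi s = psi s) ->
  is_derive t (1 : R) phi a -> is_derive t (1 : R) psi b -> a = b.
Proof. by move=> H [_ <-] [_ <-]; exact: near_eq_derive. Qed.

Lemma norm0_lt (e : R) : 0 < e -> `|0 : R| < e. Proof. by rewrite normr0. Qed.

Lemma near_norm_lt (e : R) : 0 < e -> \forall s \near (0 : R), `|s| < e.
Proof.
move=> e0; apply: (@open_nbhs_nbhs R 0 [set s : R | `|s| < e]).
by split; [exact: open_norm_lt|exact: norm0_lt].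
Qed.

Section FirstVariation.
Variables (J : set R) (f : R -> M -> R) (F : R -> R -> M -> R) (e a b : R).
Hypotheses (oJ : open J) (Jf : fam1 J f) (e0 : 0 < e) (JF : fam2 e J F).
Hypotheses (F0 : forall t, J t -> F 0 t = f t) (ab : a < b) (abJ : `[a, b] `<=` J).
Hypotheses (Fa : forall s, `|s| < e -> F s a = f a) (Fb : forall s, `|s| < e -> F s b = f b).

Let e00 := norm0_lt e0.
Let oe : open [set s : R | `|s| < e] := @open_norm_lt R e.
Let vf := partial1of2 f.
Let af := partial1of2 vf.
Let h (t : R) := partial1of2 (fun s => F s t) 0.
Let Ft (s t : R) := partial1of2 (F s) t.
Let Jvf : fam1 J vf := fam1_partial oJ Jf.
Let Jaf : fam1 J af := fam1_partial oJ Jvf.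
Let Jh : fam1 J h := fam2_slice1 oJ e00 (fam2_partial0 oJ JF).
Let JFt : fam2 e J Ft := fam2_partial1 oJ JF.
Let Jlap : fam1 J (fun t => laplacian g (f t)) := fam1_laplacian oJ Jf.
Let JlapF : fam2 e J (fun s t => laplacian g (F s t)) := fam2_laplacian oJ JF.

Let Ft0 t : J t -> Ft 0 t = vf t.
Proof.
move=> Jt; apply/funext => x; apply: (partial1_eq oJ) => // s Js.
by rewrite F0.
Qed.

Let memJ t : a <= t <= b -> J t.
Proof. by move=> tab; apply: abJ; rewrite /= in_itv. Qed.

(* Symmetry of the Laplacian replaces the interchange of the s-derivative
   with the spatial ones. *)
Lemma mu_derive_laplacian t : J t ->
  \int[mu]_x (f t x * partial1of2 (fun s => laplacian g (F s t)) 0 x) =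
  \int[mu]_x (h t x * laplacian g (f t) x).
Proof.
move=> Jt; have sf := fam1_slice oJ Jf Jt.
have sl := fam1_slice oJ Jlap Jt.
have c1 := fam1M oe (fam1_cst oe sf) (fam2_slice0 oJ Jt JlapF).
have c2 := fam1M oe (fam2_slice0 oJ Jt JF) (fam1_cst oe sl).
have D1 := fam1_mu_derive compactM mu oe c1 e00.
have D2 := fam1_mu_derive compactM mu oe c2 e00.
have N : \forall s \near (0 : R), \int[mu]_x (f t x * laplacian g (F s t) x) =
    \int[mu]_x (F s t x * laplacian g (f t) x).
  apply: filterS (near_norm_lt e0) => s se.
  have sFs := fam1_slice oJ (fam2_slice1 oJ se JF) Jt.
  exact: (green_sym hausdorffM compactM volmu sFs sf).
have E := derive_unique N D1 D2.
have E1 : \int[mu]_x partial1of2 (fun (s : R) (x : M) => f t x * laplacian g (F s t) x) 0 x =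
    \int[mu]_x (f t x * partial1of2 (fun s => laplacian g (F s t)) 0 x).
  apply: eq_Rintegral => x _.
  rewrite (partial1M x (fam1_cst oe sf) (fam2_slice0 oJ Jt JlapF) e00) partial1_cst.
  by rewrite mulr0 addr0.
have E2 : \int[mu]_x partial1of2 (fun (s : R) (x : M) => F s t x * laplacian g (f t) x) 0 x =
    \int[mu]_x (h t x * laplacian g (f t) x).
  apply: eq_Rintegral => x _.
  rewrite (partial1M x (fam2_slice0 oJ Jt JF) (fam1_cst oe sl) e00) partial1_cst.
  by rewrite mulr0 add0r mulrC.
exact: (etrans (esym E1) (etrans E E2)).
Qed.

(* Integration by parts in time before differentiating in s, which avoids
   interchanging the two derivatives. *)
Lemma mu_derive_velocity :
  \int[leb]_(t in `[a, b]) (\int[mu]_x (vf t x * partial1of2 (fun s => Ft s t) 0 x)) =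
  - \int[leb]_(t in `[a, b]) (\int[mu]_x (af t x * h t x)).
Proof.
have JvF := fam2M oJ (fam1_fam2 (e := e) oJ Jvf) JFt.
have JaF := fam2M oJ (fam1_fam2 (e := e) oJ Jaf) JF.
have D1 := fam2_mu_derive compactM mu e0 oJ JvF ab abJ.
have D2 := fam2_mu_derive compactM mu e0 oJ JaF ab abJ.
(* The boundary terms of the integration by parts in time: the variation is fixed at [a] and [b], so
   they do not depend on [s] and vanish on differentiation. *)
pose c0 := \int[mu]_x (vf b x * f b x) - \int[mu]_x (vf a x * f a x).
have E s : `|s| < e ->
    \int[leb]_(t in `[a, b]) (\int[mu]_x (vf t x * Ft s t x)) =
    c0 - \int[leb]_(t in `[a, b]) (\int[mu]_x (af t x * F s t x)).
  move=> se; have JFs := fam2_slice1 oJ se JF.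
  have JFts := fam2_slice1 oJ se JFt.
  have JvFs := fam1M oJ Jvf JFs.
  have := fam1_mu_FTC compactM mu oJ JvFs ab abJ.
  rewrite (Fa se) (Fb se) -/c0 => <-.
  apply/eqP; rewrite eq_sym subr_eq addrC -[X in X + _]mul1r; apply/eqP.
  rewrite -(action_integral_lin 1 oJ (fam1M oJ Jaf JFs) (fam1M oJ Jvf JFts) abJ).
  apply: eq_action_integral => t tab; apply: eq_Rintegral => x _.
  by rewrite (partial1M x Jvf JFs (memJ tab)) mul1r addrC mulrC [X in _ + X]mulrC.
have D2' := is_deriveB (is_derive_cst c0 (0 : R) (1 : R)) D2.
have N : \forall s \near (0 : R), \int[leb]_(t in `[a, b]) (\int[mu]_x (vf t x * Ft s t x)) =
    c0 - \int[leb]_(t in `[a, b]) (\int[mu]_x (af t x * F s t x)).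
  by apply: filterS (near_norm_lt e0) => s se; exact: E.
have E0 := derive_unique N D1 D2'.
have E1 : \int[leb]_(t in `[a, b]) (\int[mu]_x
     partial1of2 (fun (s : R) (x : M) => vf t x * Ft s t x) 0 x) =
   \int[leb]_(t in `[a, b]) (\int[mu]_x (vf t x * partial1of2 (fun s => Ft s t) 0 x)).
  apply: eq_action_integral => t tab; apply: eq_Rintegral => x _.
  have Jt := memJ tab; have sv := fam1_slice oJ Jvf Jt.
  rewrite (partial1M x (fam1_cst oe sv) (fam2_slice0 oJ Jt JFt) e00) partial1_cst.
  by rewrite mulr0 addr0.
have E2 : \int[leb]_(t in `[a, b]) (\int[mu]_x
     partial1of2 (fun (s : R) (x : M) => af t x * F s t x) 0 x) =
   \int[leb]_(t in `[a, b]) (\int[mu]_x (af t x * h t x)).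
  apply: eq_action_integral => t tab; apply: eq_Rintegral => x _.
  have Jt := memJ tab; have sv := fam1_slice oJ Jaf Jt.
  rewrite (partial1M x (fam1_cst oe sv) (fam2_slice0 oJ Jt JF) e00) partial1_cst.
  by rewrite mulr0 addr0.
apply: (etrans (esym E1)); apply: (etrans E0).
exact: (etrans (sub0r _) (congr1 -%R E2)).
Qed.

(** The Lagrangian is differentiated in its Laplacian form. In the potential term the product rule
    produces two summands whose integrals agree by [mu_derive_laplacian], which absorbs the factor
    1/2; the kinetic term is [mu_derive_velocity]. *)
Lemma first_variation :
  is_derive (0 : R) (1 : R) (fun s => action g mu a b (F s))
    (\int[leb]_(t in `[a, b]) (\int[mu]_x ((-1) * (af t x * h t x) + h t x * laplacian g (f t) x))).
Proof.
pose E s t x := 2^-1 * (Ft s t x * Ft s t x + F s t x * laplacian g (F s t) x).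
have J1 := fam2M oJ JFt JFt; have J2 := fam2M oJ JF JlapF.
have J0 : fam2 e J (fun _ _ _ => 2^-1 : R).
  exact: (fam1_fam2 (e := e) oJ (fam1_cst oJ (smooth_cst (2^-1)))).
have JE : fam2 e J E := fam2M oJ J0 (fam2D oJ J1 J2).
have D := fam2_mu_derive compactM mu e0 oJ JE ab abJ.
have -> : \int[leb]_(t in `[a, b]) (\int[mu]_x ((-1) * (af t x * h t x) + h t x * laplacian g (f t) x)) =
   \int[leb]_(t in `[a, b]) (\int[mu]_x partial1of2 (fun s => E s t) 0 x).
  rewrite (action_integral_lin (-1) oJ (fam1M oJ Jaf Jh) (fam1M oJ Jh Jlap) abJ).
  rewrite mulN1r -mu_derive_velocity -[X in X + _]mul1r.
  have Jk := fam2_slice1 oJ e00 (fam2_partial0 oJ JFt).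
  rewrite -(action_integral_lin 1 oJ (fam1M oJ Jvf Jk) (fam1M oJ Jh Jlap) abJ).
  apply: eq_action_integral => t tab; have Jt := memJ tab.
  have sF := fam2_slice0 oJ Jt JF; have sFt := fam2_slice0 oJ Jt JFt.
  have sl := fam2_slice0 oJ Jt JlapF.
  have c2 := fam1_cst oe (smooth_cst (A := A) (2^-1 : R)).
  have dE x : partial1of2 (fun s => E s t) 0 x =
     1 * (vf t x * partial1of2 (fun s => Ft s t) 0 x) +
     2^-1 * (f t x * partial1of2 (fun s => laplacian g (F s t)) 0 x + h t x * laplacian g (f t) x).
    rewrite (partial1M x c2 (fam1D oe (fam1M oe sFt sFt) (fam1M oe sF sl)) e00) partial1_cst mulr0 addr0.
    rewrite (partial1D x (fam1M oe sFt sFt) (fam1M oe sF sl) e00).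
    rewrite (partial1M x sFt sFt e00) (partial1M x sF sl e00) (Ft0 Jt) (F0 Jt).
    rewrite -/(h t x); move: (vf t x) (partial1of2 _ 0 x) (f t x) (partial1of2 _ 0 x)
      (laplacian g (f t) x) (h t x) => c1 c3 c4 c5 c6 c7; by field.
  under [RHS]eq_Rintegral do rewrite dE.
  have s1 := smoothM (fam1_slice oJ Jvf Jt) (fam1_slice oJ Jk Jt).
  have Jm := fam2_slice1 oJ e00 (fam2_partial0 oJ JlapF).
  have s2 := smoothM (fam1_slice oJ Jf Jt) (fam1_slice oJ Jm Jt).
  have s3 := smoothM (fam1_slice oJ Jh Jt) (fam1_slice oJ Jlap Jt).
  rewrite (mu_smooth_lin compactM mu 1 s1 (smoothZ 2^-1 (smoothD s2 s3))).
  rewrite (mu_smooth_lin compactM mu 1 s1 s3) (mu_smoothZ compactM mu 2^-1 (smoothD s2 s3)).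
  rewrite (mu_smoothD compactM mu s2 s3) (mu_derive_laplacian Jt); congr (_ + _).
  by move: (\int[mu]_x (h t x * laplacian g (f t) x)) => c; field.
apply: (near_eq_is_derive _ D); apply: filterS (near_norm_lt e0) => s se.
apply: eq_Rintegral => t /set_mem /abJ Jt.
have sF := fam1_slice oJ (fam2_slice1 oJ se JF) Jt.
have sFt := fam1_slice oJ (fam2_slice1 oJ se JFt) Jt.
have sl := fam1_slice oJ (fam2_slice1 oJ se JlapF) Jt.
rewrite (lagrangianE hausdorffM compactM volmu sF sFt).
exact: (mu_smoothZ compactM mu 2^-1 (smoothD (smoothM sFt sFt) (smoothM sF sl))).
Qed.

End FirstVariation.
End Dynamics.

(** * Extremals, Newton's equation and multipliers *)

Section Equivalences.
Context {R : realType} {n : nat} {M : ptopologicalType}.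
Hypothesis hausdorffM : hausdorff_space M.
Hypothesis compactM : compact [set: M].
Context {A : oriented_atlas R n M} (g : riemannian_metric A).
Variable mu : probability (borel M) R.
Hypothesis volmu : normalized_volume g mu.
Local Notation leb := (@lebesgue_measure R).
Local Notation fam1 := (fam1 (A := A)).
Local Notation fam2 := (fam2 (A := A)).
Implicit Types (J : set R) (f h : R -> M -> R) (F : R -> R -> M -> R).

Lemma constant_norm_derive J h (k : R) t : open J -> fam1 J h ->
  (forall s, J s -> \int[mu]_x h s x = k) -> J t -> \int[mu]_x partial1of2 h t x = 0.
Proof.
move=> oJ Jh hk Jt; have D1 := fam1_mu_derive compactM mu oJ Jh Jt.
have N : \forall s \near t, \int[mu]_x h s x = cst k s.
  by move: (open_nbhs_nbhs (conj oJ Jt)); apply: filterS => s Js; exact: hk.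
exact: (derive_unique N D1 (is_derive_cst k t (1 : R))).
Qed.

(** Half the derivative of the constant squared norm. It serves twice: in time, for the velocity of
    the curve, and in the variation parameter at fixed time, where it says that [dF/ds] is
    tangent. *)
Lemma sphere_orthogonal J h t : open J -> fam1 J h -> (forall s, J s -> sphere A mu (h s)) ->
  J t -> \int[mu]_x (h t x * partial1of2 h t x) = 0.
Proof.
move=> oJ Jh Sh Jt.
have c s : J s -> \int[mu]_x (h s x * h s x) = 1 by move=> /Sh /sphereE[].
have := constant_norm_derive oJ (fam1M oJ Jh Jh) c Jt.
have Jp := fam1_partial oJ Jh.
have sp := smoothM (fam1_slice oJ Jh Jt) (fam1_slice oJ Jp Jt).
rewrite (@eq_Rintegral _ _ _ mu _ (fun x => 2 * (h t x * partial1of2 h t x))); last first.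
  by move=> x _; rewrite (partial1M x Jh Jh Jt); ring.
by rewrite (mu_smoothZ compactM mu 2 sp) => /eqP; rewrite mulf_eq0 pnatr_eq0 => /eqP.
Qed.

Section Curve.
Variables (J : set R) (f : R -> M -> R).
Hypotheses (oJ : open J) (Jf : fam1 J f) (Sf : forall t, J t -> sphere A mu (f t)).

Let vf := partial1of2 f.
Let af := partial1of2 vf.
Let Jvf : fam1 J vf := fam1_partial oJ Jf.
Let Jaf : fam1 J af := fam1_partial oJ Jvf.
Let Jlap : fam1 J (fun t => laplacian g (f t)) :=
  fam1_laplacian hausdorffM compactM volmu oJ Jf.

Definition residual (t : R) (x : M) : R := af t x - laplacian g (f t) x.

Lemma fam1_residual : fam1 J residual.
Proof.
apply: (fam1_eq oJ _ (fam1D oJ Jaf (fam1Z (-1) oJ Jlap))) => t x _.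
by rewrite /residual mulN1r.
Qed.

Lemma velocity_acceleration t : J t ->
  \int[mu]_x (vf t x * vf t x) + \int[mu]_x (f t x * af t x) = 0.
Proof.
move=> Jt.
have c s : J s -> \int[mu]_x (f s x * vf s x) = 0.
  by move=> Js; exact: (sphere_orthogonal oJ Jf Sf Js).
have := constant_norm_derive oJ (fam1M oJ Jf Jvf) c Jt => <-.
have sv := fam1_slice oJ Jvf Jt; have sa := fam1_slice oJ Jaf Jt.
have sf := fam1_slice oJ Jf Jt.
rewrite -(mu_smoothD compactM mu (smoothM sv sv) (smoothM sf sa)).
by apply: eq_Rintegral => x _; rewrite (partial1M x Jf Jvf Jt) addrC.
Qed.

Lemma multiplier_value lambda : multiplier_equation g J lambda f ->
  forall t, J t ->
    lambda t = \int[mu]_x (vf t x ^+ 2 + f t x * laplacian g (f t) x).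
Proof.
move=> Hl t Jt; have [sf f1] := (sphereE mu (f t)).1 (Sf Jt).
have sv := fam1_slice oJ Jvf Jt; have sa := fam1_slice oJ Jaf Jt.
have sl := fam1_slice oJ Jlap Jt.
rewrite (mu_smoothD compactM mu (smooth_sqr sv) (smoothM sf sl)).
(* Pairing the equation with [f t], of norm 1, isolates the multiplier. *)
have E : \int[mu]_x ((- lambda t) * (f t x * f t x)) =
    \int[mu]_x (f t x * af t x - f t x * laplacian g (f t) x).
  apply: eq_Rintegral => x _; have := Hl t Jt x; rewrite -/vf -/af => H.
  by rewrite mulrA -H; ring.
rewrite (mu_smoothZ compactM mu _ (smoothM sf sf)) f1 mulr1 in E.
rewrite (mu_smoothB compactM mu (smoothM sf sa) (smoothM sf sl)) in E.
have := velocity_acceleration Jt; have -> : \int[mu]_x (vf t x ^+ 2) = \int[mu]_x (vf t x * vf t x).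
  by apply: eq_Rintegral => x _; rewrite expr2.
move: E; move: (\int[mu]_x (f t x * af t x)) (\int[mu]_x (f t x * laplacian g (f t) x))
  (\int[mu]_x (vf t x * vf t x)) (lambda t) => c1 c2 c3 c4; lra.
Qed.

Lemma newton_multiplier :
  newton_equation g mu J f <-> exists lambda, multiplier_equation g J lambda f.
Proof.
have sa t (Jt : J t) := fam1_slice oJ Jaf Jt.
split=> [N|[lambda Hl] t Jt].
  exists (fun t => - \int[mu]_x (residual t x * f t x)) => t Jt x; rewrite opprK.
  exact: ((gradient_multiplier hausdorffM compactM volmu (Sf Jt) (sa t Jt)).1 (N t Jt) x).
apply: ((gradient_multiplier hausdorffM compactM volmu (Sf Jt) (sa t Jt)).2) => x.
have [sf f1] := (sphereE mu (f t)).1 (Sf Jt).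
have E z : af t z - laplacian g (f t) z = - lambda t * f t z by exact: Hl.
apply: (etrans (E x)); congr (_ * _).
rewrite (@eq_Rintegral _ _ _ mu _ (fun z => - lambda t * (f t z * f t z))); last first.
  by move=> z _; rewrite E mulrA.
by rewrite (mu_smoothZ compactM mu _ (smoothM sf sf)) f1 mulr1.
Qed.

Lemma variation_fam2 (a b : R) F : Defs.variation A mu J a b f F ->
  exists2 e : R, 0 < e & [/\ fam2 e J F, forall s t, `|s| < e -> J t -> sphere A mu (F s t),
    forall t, J t -> F 0 t = f t, forall s, `|s| < e -> F s a = f a &
    forall s, `|s| < e -> F s b = f b].
Proof. by []. Qed.

Lemma multiplier_extremal lambda : multiplier_equation g J lambda f -> extremal g mu J f.
Proof.
move=> Hl a b ab abJ F /variation_fam2[e e0 [JF SF F0 Fa Fb]].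
have := first_variation hausdorffM compactM volmu oJ Jf e0 JF F0 ab abJ Fa Fb.
set V := Rintegral _ _ _; suff -> : V = 0 by [].
have e00 := norm0_lt e0.
pose h t := partial1of2 (fun s => F s t) 0.
have Jh : fam1 J h := fam2_slice1 oJ e00 (fam2_partial0 oJ JF).
transitivity (\int[leb]_(t in `[a, b]) (0 : R)); last first.
  by rewrite Rintegral_cst_itv ?mul0r// ltW.
apply: eq_Rintegral => t /set_mem /abJ Jt.
have sf := fam1_slice oJ Jf Jt; have sh := fam1_slice oJ Jh Jt.
have fh : \int[mu]_x (f t x * h t x) = 0.
  have := sphere_orthogonal (open_norm_lt (e := e)) (fam2_slice0 oJ Jt JF)
    (fun s se => SF s t se Jt) e00.
  by rewrite (F0 t Jt).
rewrite (@eq_Rintegral _ _ _ mu _ (fun x => lambda t * (f t x * h t x))).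
  by rewrite (mu_smoothZ compactM mu _ (smoothM sf sh)) fh mulr0.
move=> x _; rewrite -/(h t x) -/vf -/af.
have := Hl t Jt x; rewrite -/vf -/af.
move: (af t x) (laplacian g (f t) x) (lambda t) (f t x) (h t x) => c1 c2 c3 c4 c5 E.
by rewrite (_ : c1 = c2 - c3 * c4); [ring|lra].
Qed.

(* The variation pushes [f] along the tangential part of the residual of the
   wave equation, and is brought back to the sphere by dividing by its L^2 norm. *)
Section RenormalizedVariation.
Variables (a b : R).
Hypotheses (ab : a < b) (abJ : `[a, b] `<=` J).

(** Positive exactly on the open interval between [a] and [b], so no interior instant is lost. *)
Definition cutoff (t : R) : R := bump (t - a) * bump (b - t).

Definition direction (t : R) (x : M) : R := tproj mu (f t) (residual t) x.

Definition direction_sqnorm (t : R) : R := \int[mu]_x (direction t x * direction t x).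

(** By Pythagoras, the inverse of the L^2 norm of [f + s * cutoff * direction] at time [t]: [f] has
    norm 1 and is orthogonal to the direction. The radicand is at least 1, hence smoothness for
    every [s]. *)
Definition normalizer (s t : R) : R :=
  (Num.sqrt (1 + (s * s) * (cutoff t * cutoff t * direction_sqnorm t)))^-1.

Definition renormalized (s t : R) (x : M) : R :=
  (f t x + s * cutoff t * direction t x) * normalizer s t.

Lemma Ck_shift1 k (c d : R) : Ck k (dom1 J) (fun z : 'rV[R]_1 => c * z 0 0 + d).
Proof.
have o := open_dom1 oJ; apply: (CkD o _ (Ck_cst _ _ _)).
exact: (CkM o (Ck_cst _ _ _) (Ck_coord _ _ o)).
Qed.

Lemma fam1_cutoff : fam1 J (fun t _ => cutoff t).
Proof.
have o := open_dom1 oJ; apply: (family_scalar o) => k; rewrite /cutoff.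
have B (c d : R) : Ck k (dom1 J) (fun z : 'rV[R]_1 => bump (c * z 0 0 + d)).
  exact: (Ck_bump o (Ck_shift1 k c d)).
apply: (Ck_eq o _ (CkM o (B 1 (- a)) (B (-1) b))) => z _.
by rewrite mul1r mulN1r [- _ + b]addrC.
Qed.

Lemma fam1_mu_scalar h : fam1 J h -> fam1 J (fun t _ => \int[mu]_x h t x).
Proof.
move=> Jh; apply: (family_scalar (open_dom1 oJ)) => k.
exact: (Ck_fam1_mu compactM mu k oJ Jh).
Qed.

Lemma fam1_direction : fam1 J direction.
Proof.
have Jr := fam1_residual.
have Jc := fam1_mu_scalar (fam1M oJ Jr Jf).
apply: (fam1_eq oJ _ (fam1D oJ Jr (fam1Z (-1) oJ (fam1M oJ Jc Jf)))) => t x _.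
by rewrite /direction /tproj mulN1r.
Qed.

Lemma direction_sqnorm_ge0 t : 0 <= direction_sqnorm t.
Proof. by apply: Rintegral_ge0 => x _; rewrite -expr2 sqr_ge0. Qed.

Lemma normalizer_arg_gt0 s t : 0 < 1 + (s * s) * (cutoff t * cutoff t * direction_sqnorm t).
Proof.
apply: ltr_pwDl => //; apply: mulr_ge0; first by rewrite -expr2 sqr_ge0.
by apply: mulr_ge0; [rewrite -expr2 sqr_ge0|exact: direction_sqnorm_ge0].
Qed.

Lemma Ck_fam1_scalar k (c : R -> R) e :
  (forall k, Ck k (dom1 J) (fun z : 'rV[R]_1 => c (z 0 0))) ->
  Ck k (dom2 e J) (fun z : 'rV[R]_2 => c (z 0 1)).
Proof.
move=> Hc; have o2 := open_dom2 (e := e) oJ.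
have V z : dom2 e J z -> dom1 J (row1 (z 0 1)) by move=> [_ Jz]; rewrite /dom1 /= row1E.
have Ht (l : 'I_1) : Ck k (dom2 e J) (fun z : 'rV[R]_2 => row1 (z 0 1) 0 l).
  by apply: (Ck_eq o2 _ (Ck_coord k 1 o2)) => z _; rewrite mxE.
apply: (Ck_eq o2 _ (Ck_comp o2 (open_dom1 oJ) V Ht (Hc k))) => z _.
by rewrite /= row1E.
Qed.

Lemma fam2_renormalized e : fam2 e J renormalized.
Proof.
have o2 := open_dom2 (e := e) oJ; have o1 := open_dom1 oJ.
have Jd := fam1_direction.
have J2f := fam1_fam2 (e := e) oJ Jf.
have J2d := fam1_fam2 (e := e) oJ (fam1M oJ fam1_cutoff Jd).
have Js : fam2 e J (fun s _ _ => s).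
  by apply: (family_scalar o2) => k; exact: Ck_coord.
have Jn : fam2 e J (fun s t _ => normalizer s t).
  apply: (family_scalar o2) => k; rewrite /normalizer.
  have q j : Ck j (dom1 J) (fun z : 'rV[R]_1 => cutoff (z 0 0) * cutoff (z 0 0) * direction_sqnorm (z 0 0)).
    have cC : Ck j (dom1 J) (fun z : 'rV[R]_1 => cutoff (z 0 0)).
      have B (c d : R) : Ck j (dom1 J) (fun z : 'rV[R]_1 => bump (c * z 0 0 + d)).
        exact: (Ck_bump o1 (Ck_shift1 j c d)).
      apply: (Ck_eq o1 _ (CkM o1 (B 1 (- a)) (B (-1) b))) => z _.
      by rewrite /cutoff mul1r mulN1r [- _ + b]addrC.
    exact: (CkM o1 (CkM o1 cC cC) (Ck_fam1_mu compactM mu j oJ (fam1M oJ Jd Jd))).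
  have q2 := Ck_fam1_scalar k (c := fun t => cutoff t * cutoff t * direction_sqnorm t) e q.
  have cs := Ck_coord k 0 o2.
  have g2 := CkD o2 (Ck_cst k _ 1) (CkM o2 (CkM o2 cs cs) q2).
  have sq := Ck_sqrt o2 _ g2.
  apply: (CkV o2); last by apply: sq => z _; exact: normalizer_arg_gt0.
  by move=> z _; rewrite sqrtr_eq0 -ltNge; exact: normalizer_arg_gt0.
have H := fam2M oJ (fam2D oJ J2f (fam2M oJ Js J2d)) Jn.
apply: (family_eq o2 _ H) => z x _; by rewrite /renormalized mulrA.
Qed.

Lemma direction_orth t : J t -> \int[mu]_x (f t x * direction t x) = 0.
Proof.
by move=> Jt; exact: (tproj_orth compactM (Sf Jt) (fam1_slice oJ fam1_residual Jt)).
Qed.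

Lemma sphere_renormalized s t : `|s| < 1 -> J t -> sphere A mu (renormalized s t).
Proof.
move=> s1 Jt; apply/sphereE; split.
  have Jr : fam2 1 J renormalized by exact: fam2_renormalized.
  exact: (fam1_slice oJ (fam2_slice1 oJ s1 Jr) Jt).
have [sf f1] := (sphereE mu (f t)).1 (Sf Jt).
have sd := fam1_slice oJ fam1_direction Jt.
set c := normalizer s t; set k := s * cutoff t.
have -> : \int[mu]_x (renormalized s t x * renormalized s t x) =
   \int[mu]_x ((c * c) * (f t x * f t x) + ((c * c * (2 * k)) * (f t x * direction t x) +
       (c * c * (k * k)) * (direction t x * direction t x))).
  by apply: eq_Rintegral => x _; rewrite /renormalized -/c -/k; ring.
have s1' := smoothM sf sf; have s2' := smoothM sf sd; have s3' := smoothM sd sd.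
rewrite (mu_smooth_lin compactM mu _ s1' (smoothD (smoothZ _ s2') (smoothZ _ s3'))).
rewrite (mu_smooth_lin compactM mu _ s2' (smoothZ _ s3')) (mu_smoothZ compactM mu _ s3').
rewrite f1 (direction_orth Jt) -/(direction_sqnorm t).
set q := 1 + (s * s) * (cutoff t * cutoff t * direction_sqnorm t).
have q0 : 0 < q := normalizer_arg_gt0 s t.
have cE : c * c = q^-1.
  by rewrite /c /normalizer -/q -invfM -expr2 sqr_sqrtr// ltW.
have -> : c * c * 1 + (c * c * (2 * k) * 0 + c * c * (k * k) * direction_sqnorm t) = c * c * q.
  by rewrite /q /k; ring.
by rewrite cE mulVf// gt_eqF.
Qed.

Lemma normalizer0 t : normalizer 0 t = 1.
Proof. by rewrite /normalizer !mul0r addr0 sqrtr1 invr1. Qed.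

Lemma renormalized0 t : renormalized 0 t = f t.
Proof.
by apply/funext => x; rewrite /renormalized normalizer0 !mul0r addr0 mulr1.
Qed.

Lemma renormalized_fixed s t : cutoff t = 0 -> renormalized s t = f t.
Proof.
move=> c0; apply/funext => x.
by rewrite /renormalized /normalizer c0 !(mulr0, mul0r, addr0) sqrtr1 invr1 mulr1.
Qed.

Lemma renormalized_variation : Defs.variation A mu J a b f renormalized.
Proof.
(* Any positive bound on [s] would do, since the normalizer is smooth for all [s]. *)
exists 1; first exact: ltr01.
split.
- exact: fam2_renormalized.
- exact: sphere_renormalized.
- by move=> t _; exact: renormalized0.
- by move=> s _; apply: renormalized_fixed; rewrite /cutoff subrr (bump_eq0 (lexx 0)) mul0r.
- by move=> s _; apply: renormalized_fixed; rewrite /cutoff subrr (bump_eq0 (lexx 0)) mulr0.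
Qed.

(** The radicand is even in [s], so the return to the sphere is a second-order effect and the
    derivative at 0 is that of the unnormalized variation. *)
Lemma renormalized_derive t x :
  partial1of2 (fun s => renormalized s t) 0 x = cutoff t * direction t x.
Proof.
rewrite partial1of2E.
set q := cutoff t * cutoff t * direction_sqnorm t.
pose r (s : R) : R := 1 + (s * s) * q.
have d1 : is_derive (0 : R) (1 : R) r 0.
  apply: is_derive_eq.
  by rewrite !mul0r /GRing.scale/= ?(mul0r, mulr0, addr0).
have d2 : is_derive (1 : R) (1 : R) (fun y : R => (Num.sqrt y)^-1)
    (- (Num.sqrt (1 : R)) ^- 2 *: (2 * Num.sqrt (1 : R))^-1).
  have H := is_derive1_sqrt (@ltr01 R).
  apply: DeriveDef; first by apply: derivableV; rewrite ?sqrtr1 ?oner_neq0//; case: H.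
  by rewrite deriveV ?sqrtr1 ?oner_neq0//; case: H => // _ ->; rewrite sqrtr1.
set k := (X in is_derive _ _ _ X) in d2.
have d2' : is_derive (r 0) (1 : R) (fun y : R => (Num.sqrt y)^-1) k.
  by rewrite /r !mul0r addr0.
have d3 := is_derive_scalar_comp d2' d1; rewrite mulr0 in d3.
have d4 : is_derive (0 : R) (1 : R) (fun s : R => f t x + s * cutoff t * direction t x)
    (cutoff t * direction t x).
  rewrite (_ : (fun s => _) = fun s : R => f t x + s * (cutoff t * direction t x)); last first.
    by apply/funext => s; rewrite mulrA.
  apply: is_derive_eq.
  by rewrite /GRing.scale/= ?(mul0r, mulr0, addr0, add0r, mulr1, mul1r).
have [_ E] := is_deriveM d4 d3.
apply: (etrans E); rewrite scaler0 add0r /= /r !mul0r addr0 sqrtr1 invr1.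
exact: mul1r.
Qed.

Lemma extremal_direction t0 : extremal g mu J f -> a < t0 < b ->
  direction_sqnorm t0 = 0.
Proof.
move=> ext t0ab.
have ca : cutoff a = 0 by rewrite /cutoff subrr (bump_eq0 (lexx 0)) mul0r.
have cb : cutoff b = 0 by rewrite /cutoff subrr (bump_eq0 (lexx 0)) mulr0.
have [_ E] := ext a b ab abJ renormalized renormalized_variation.
have Jr : fam2 1 J renormalized by exact: fam2_renormalized.
have := first_variation hausdorffM compactM volmu oJ Jf ltr01 Jr
  (fun t _ => renormalized0 t) ab abJ
  (fun s _ => renormalized_fixed s ca) (fun s _ => renormalized_fixed s cb).
case=> _; rewrite E => {E} E.
pose k t x := cutoff t * (direction t x * direction t x).
have Jd := fam1_direction; have Jdd := fam1M oJ Jd Jd.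
have Jk : fam1 J k := fam1M oJ fam1_cutoff Jdd.
have kE t : J t -> \int[mu]_x k t x = cutoff t * direction_sqnorm t.
  move=> Jt; exact: (mu_smoothZ compactM mu (cutoff t) (fam1_slice oJ Jdd Jt)).
have I0 : \int[leb]_(t in `[a, b]) (\int[mu]_x k t x) = 0.
  apply: oppr_inj; rewrite oppr0 E.
  have J0 := fam1_cst oJ (smooth_cst (A := A) (0 : R)).
  have := action_integral_lin compactM mu (-1) oJ Jk J0 abJ.
  rewrite mulN1r.
  have -> : \int[leb]_(t in `[a, b]) (\int[mu]_x (0 : R)) = 0.
    by rewrite mu_cst Rintegral_cst_itv ?mul0r// ltW.
  rewrite addr0 => <-; apply: eq_Rintegral => t /set_mem /abJ Jt.
  have sr := fam1_slice oJ fam1_residual Jt.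
  have sd := fam1_slice oJ Jd Jt.
  (* This turns the pairing of the residual with its tangential part into the squared norm of that
     part. *)
  have Er := tproj_norm compactM (Sf Jt) sr; rewrite -/(direction t) in Er.
  transitivity (- (cutoff t * direction_sqnorm t)).
    rewrite -(kE t Jt) -[RHS]mulN1r.
    apply: (etrans _ (mu_smoothZ compactM mu (-1) (fam1_slice oJ Jk Jt))).
    by apply: eq_Rintegral => x _; rewrite addr0.
  rewrite /direction_sqnorm -Er -mulNr -(mu_smoothZ compactM mu _ (smoothM sr sd)).
  apply: eq_Rintegral => x _; rewrite renormalized_derive /residual.
  rewrite -/vf -/af.
  by move: (af t x) (laplacian g (f t) x) (cutoff t) (direction t x) => c1 c2 c3 c4; ring.
have Jt0 : J t0.
  by apply: abJ; rewrite /= in_itv/=; move: t0ab => /andP[? ?]; rewrite !ltW.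
have c0 : 0 < cutoff t0.
  by move: t0ab => /andP[? ?]; rewrite /cutoff mulr_gt0// bump_gt0 subr_gt0.
(* A positive value at [t0] would persist nearby by continuity and make the integral of a
   nonnegative function, known to be 0, positive. *)
apply/eqP; rewrite eq_le direction_sqnorm_ge0 andbT leNgt; apply/negP => N0.
have W := @fam1_mu_within _ _ _ compactM A mu _ _ _ _ oJ Jk abJ.
have k0 t : a <= t <= b -> 0 <= \int[mu]_x k t x.
  move=> tab; have Jt : J t by apply: abJ; rewrite /= in_itv.
  by rewrite (kE t Jt) mulr_ge0 ?direction_sqnorm_ge0// /cutoff mulr_ge0// bump_ge0.
have := itv_Rintegral_gt0 W k0 t0ab (@fam1_mu_continuous _ _ _ compactM A mu _ _ _ oJ Jk Jt0).
by rewrite I0 ltxx (kE t0 Jt0) mulr_gt0// => /(_ isT).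
Qed.

End RenormalizedVariation.

Lemma extremal_multiplier : extremal g mu J f ->
  exists lambda, multiplier_equation g J lambda f.
Proof.
move=> ext; exists (fun t => - \int[mu]_x (residual t x * f t x)) => t Jt x; rewrite opprK.
(* The conclusion is pointwise in time, so the interval may depend on [t]; openness of [J] leaves
   room for one centred at [t]. *)
have [d /= d0 Hd] : exists2 d : R, 0 < d & forall s, `|t - s| <= d -> J s.
  have /nbhs_ballP[d /= d0 Hd] := open_nbhs_nbhs (conj oJ Jt).
  exists (d / 2); first by rewrite divr_gt0.
  move=> s sd; apply: Hd; rewrite -ball_normE/=; apply: le_lt_trans sd _.
  by rewrite gtr_pMr// invf_lt1// ltr1n.
have ab : t - d < t + d by lra.
have abJ : `[t - d, t + d] `<=` J.
  by move=> s /=; rewrite in_itv/= => /andP[h1 h2]; apply: Hd; rewrite ler_norml; apply/andP; split; lra.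
have tab : t - d < t < t + d by apply/andP; split; lra.
have sd := fam1_slice oJ fam1_direction Jt.
have := mul_smooth_eq0 hausdorffM compactM volmu sd (extremal_direction ab abJ ext tab) x.
by rewrite /direction /tproj => /eqP; rewrite subr_eq0 => /eqP.
Qed.

Lemma extremal_newton : extremal g mu J f <-> newton_equation g mu J f.
Proof.
split=> [/extremal_multiplier|/newton_multiplier]; first by move=> H; exact/newton_multiplier.
by move=> [lambda]; exact: multiplier_extremal.
Qed.

End Curve.
End Equivalences.

Theorem proposition8p3 (R : realType) (n : nat) (M : ptopologicalType)
    (hausdorffM : hausdorff_space M) (compactM : compact [set: M])
    (A : oriented_atlas R n M) (g : riemannian_metric A)
    (mu : probability (borel M) R) (volmu : normalized_volume g mu) :
  (forall f v : M -> R, smooth A f -> smooth A v ->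
     lagrangian g mu f v
       = 2^-1 * \int[mu]_x (v x ^+ 2 + f x * laplacian g f x) /\
     lagrangian g mu f v
       = 2^-1 * \int[mu]_x (v x ^+ 2) - potential g mu f) /\
  (forall (J : set R) (f : R -> M -> R),
     open J -> is_interval J -> smooth_curve A mu J f ->
     [/\ extremal g mu J f <-> newton_equation g mu J f,
         newton_equation g mu J f <->
           exists lambda : R -> R, multiplier_equation g J lambda f &
         forall lambda : R -> R, multiplier_equation g J lambda f ->
           forall t, J t ->
             lambda t = 2 * lagrangian g mu (f t) (partial1of2 f t) /\
             lambda t = \int[mu]_x (partial1of2 f t x ^+ 2
                                      + f t x * laplacian g (f t) x)]).
Proof.
split=> [f v sf sv|J f oJ _ [Jf Sf]].
  split; first exact: (lagrangianE hausdorffM compactM volmu sf sv).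
  exact: (lagrangian_potential compactM g mu sf sv).
split.
- exact: (extremal_newton hausdorffM compactM volmu oJ Jf Sf).
- exact: (newton_multiplier hausdorffM compactM volmu oJ Jf Sf).
- move=> lambda Hl t Jt.
  have E := multiplier_value hausdorffM compactM volmu oJ Jf Sf Hl Jt.
  split=> //; rewrite E.
  have sf := fam1_slice oJ Jf Jt; have sv := fam1_slice oJ (fam1_partial oJ Jf) Jt.
  by rewrite (lagrangianE hausdorffM compactM volmu sf sv) mulrA mulfV ?mul1r.
Qed.
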